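(* Consider a network operating under a WMW policy, and a vector $\lambda$ in its capacity region, with a corresponding set of invariant states $\mathcal{I}(\lambda)$. Fix some $T\in\mathbb{R}_+$, and let $\{\lambda^r\}$ be a sequence that converges to $\lambda$. Consider two functions $f:\mathbb{N}\times\mathbb{R}_+\to\mathbb{R}_+$ and $g:\mathbb{N}\to\mathbb{R}_+$, with $\liminf_{r\to\infty}\, g(r)/r>0$. Let $A^r(\cdot)$ be an $f$-tailed sequence of arrival processes with limit mean $\lambda$, and let $\hat q^r(\cdot)$ be a corresponding sequence of $g$-time-scaled queue length processes. Suppose that $d\big(\hat q^r(0)\,,\, \mathcal{I}(\lambda)\big) \to 0$, as $r\to\infty$. (a) Suppose that for every $\epsilon>0$, we have $\liminf_{r\to\infty}\, rf(r,\epsilon)/g(r) > 0$. Then, for any $\delta>0$, $$\mathbb{P}\Big(\sup_{t\in [0,T]}\,d\big(\hat q^r(t)\,,\, \mathcal{I}(\lambda)\big)>\delta\Big) \xrightarrow[r\to\infty]{} 0.$$ (b) Under all the assumptions stated above together with the assumption of part (a) (namely, $\liminf_{r\to\infty} rf(r,\epsilon)/g(r)>0$ for every $\epsilon>0$), the rate of convergence in (a) can be bounded: for any $\delta>0$, there exists an $\epsilon>0$ such that $$\frac{rf(r,\epsilon)}{g(r)}\, \mathbb{P}\Big(\sup_{t\in [0,T]}\,d\big(\hat q^r(t)\,,\, \mathcal{I}(\lambda)\big)>\delta\Big) \xrightarrow[r\to\infty]{} 0.$$ Moreover, for the case of a MW policy, this holds for every $\epsilon\le\min(\delta,\alpha)/(2C)$,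 where $C$ is the sensitivity constant of the network and $\alpha=\alpha(\lambda)$ is the attraction constant associated with $\lambda$. (c) Conversely, suppose that $f:\mathbb{N}\times\mathbb{R}_+\to\mathbb{R}_+$ and $g:\mathbb{N}\to\mathbb{R}_+$ are such that $\lim_{r\to\infty}\, rf(r,\epsilon)/g(r) = 0$ for every $\epsilon>0$, and $\lim_{r\to\infty} g(r)/r =\infty$. Then, for any network operating under a MW policy, any arrival rate $\lambda$ in its capacity region (excluding its extreme points), and any $q_0\in\mathcal{I}(\lambda)$, there exists an $f$-tailed sequence of arrival processes and a corresponding sequence of $g$-time-scaled processes $\hat q^r(\cdot)$, $r\in\mathbb{N}$, initialized at $\hat q^r(0) = q_0$, such that $$\mathbb{P}\Big(\sup_{t\in [0,T]}\,d\big(\hat q^r(t)\,,\, \mathcal{I}(\lambda)\big)>\delta\Big) \xrightarrow[r\to\infty]{} 1,$$ for all $\delta>0$.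
   Context: Network model: $n$ queues, a non-negative $n\times n$ routing matrix $R$, and a finite set $\mathcal{S}\subset\mathbb{R}_+^n$ of service vectors such that for any $\mu\in\mathcal{S}$ and any $i$, the vector obtained by setting the $i$th component of $\mu$ to zero is also in $\mathcal{S}$. Given arrivals $A(t)\in\mathbb{R}_+^n$, queues evolve as $Q(t+1)=Q(t)+A(t)+(R-I)\min(\mu(t),Q(t))$ (componentwise min). A $w$-WMW policy ($w\in\mathbb{R}^n_{++}$, $W=\mathrm{diag}(w)$) chooses $\mu(t)\in\arg\max_{\mu\in\mathcal{S}} Q(t)^TW(I-R)\mu$; MW is the case $w=(1,\dots,1)$. The capacity region $\mathcal{C}$ is the closure of the set of arrival rates for which some policy makes the network positive recurrent. A fluid solution for rate $\lambda$ is an absolutely continuous $q:\mathbb{R}_+\to\mathbb{R}_+^n$ such that, together with functions $s_\mu:\mathbb{R}_+\to[0,1]$ ($\mu\in\mathcal{S}$) and $y:\mathbb{R}_+\to\mathbb{R}_+^n$, a.e. $\dot q=\lambda+(R-I)(\sum_\mu s_\mu\mu-y)$, $\sum_\mu s_\mu=1$, $y_i\le\sum_\mu s_\mu\mu_i$, $y_i=0$ whenever $q_i>0$, and $s_\mu=0$ whenever $\mu$ is not a maximizer of $q^TW(I-R)\mu$. The set of invariant states is $\mathcal{I}(\lambda)=\{q_0\in\mathbb{R}_+^n: q(t)\equiv q_0 \text{ is a fluid solution}\}$; $d(x,\mathcal{I})$ is Euclidean distance. A sequence $A^r(\cdot)$ of stationary processes with means $\lambda^r\to\lambda$ is $f$-tailed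 with limit mean $\lambda$ if for every $\delta>0$, $f(r,\delta)\,\mathbb{P}\big(\frac1r\sup_{t\le r}\|\sum_{\tau=0}^t (A^r(\tau)-\lambda^r)\|_2>\delta\big)\to0$ as $r\to\infty$. The $g$-time-scaled processes are $\hat q^r(t)=\frac1r Q^r(\lfloor g(r)t\rfloor)$, where $Q^r$ is the queue process driven by $A^r$. The sensitivity constant $C$ is a network constant such that for any arrival function $A(\cdot)$, any $\lambda\succeq0$, and the fluid solution $q$ with $q(0)=Q(0)$, $\|Q(k)-q(k)\|_2\le C\big(1+\|\lambda\|+\max_{t<k}\|\sum_{\tau=0}^t(A(\tau)-\lambda)\|_2\big)$ for all $k\in\mathbb{Z}_+$. The attraction constant $\alpha(\lambda)>0$ (for MW and $\lambda\in\mathcal{C}$) is such that for every fluid solution $q$ with rate $\lambda$, $q(t)\notin\mathcal{I}(\lambda)$ implies the right derivative of $d(q(t),\mathcal{I}(\lambda))$ exists and is at most $-\alpha(\lambda)$.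
   Formalization: In part (c) the horizon is taken with T > 0, since for T = 0 the claim fails: the process starts at q_0 in I(λ), so the supremum is 0 and the probability is 0 rather than tending to 1. *)

(* Defs.v *)
From HB Require Import structures.
From mathcomp Require Import all_boot all_order all_algebra.
From mathcomp Require Import all_classical all_reals all_analysis.
Set Implicit Arguments. Unset Strict Implicit. Unset Printing Implicit Defensive.
Import Order.TTheory GRing.Theory Num.Theory.
Import numFieldNormedType.Exports.
Local Open Scope classical_set_scope.
Local Open Scope ring_scope.

Section NetworkDefs.
Variable R : realType.
Variable n : nat.
Implicit Types (x y q w lam mu a : 'cV[R]_n) (Rm : 'M[R]_n) (S : seq 'cV[R]_n).

Definition norm2 x : R := Num.sqrt (\sum_i (x i 0) ^+ 2).
Definition dist_set x (I : set 'cV[R]_n) : R := inf [set norm2 (x - y) | y in I].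

Definition nonneg x : Prop := forall i, 0 <= x i 0.

Definition cmin x y : 'cV[R]_n := \col_i Order.min (x i 0) (y i 0).

Definition zero_comp mu (i : 'I_n) : 'cV[R]_n := \col_j (if j == i then 0 else mu j 0).

(* Network model: non-negative routing matrix Rm, finite set S (a list) of
   service vectors in R_+^n, closed under zeroing any single component. *)
Definition network_ok Rm S : Prop :=
  (forall i j, 0 <= Rm i j) /\
  (forall mu, mu \in S -> nonneg mu) /\
  (forall mu i, mu \in S -> zero_comp mu i \in S).

(* the vector of all ones (the MW weights) *)
Definition ones : 'cV[R]_n := const_mx 1.
Definition pos_weights w : Prop := forall i, 0 < w i 0.

Definition wobj Rm w q mu : R := \sum_i q i 0 * w i 0 * ((1%:M - Rm) *m mu) i 0.

Definition wmw_choice Rm S w q mu : Prop :=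
  mu \in S /\ forall nu, nu \in S -> wobj Rm w q nu <= wobj Rm w q mu.

Definition qstep Rm q a mu : 'cV[R]_n := q + a + (Rm - 1%:M) *m cmin mu q.

(* Q is a (deterministic) queue trajectory driven by the arrival function A
   under the w-WMW policy (with arbitrary tie-breaking at each step). *)
Definition wmw_path Rm S w (A : nat -> 'cV[R]_n) (Q : nat -> 'cV[R]_n) : Prop :=
  forall t, exists mu, wmw_choice Rm S w (Q t) mu /\ Q t.+1 = qstep Rm (Q t) (A t) mu.

Definition max_dev (A : nat -> 'cV[R]_n) lam (k : nat) : R :=
  \big[Num.max/0]_(t < k) norm2 (\sum_(tau < t.+1) (A tau - lam)).

Definition abs_cont_on (f : R -> R) (a b : R) : Prop :=
  forall e, 0 < e -> exists2 d, 0 < d &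
    forall (k : nat) (u v : 'I_k -> R),
      (forall j, a <= u j /\ u j <= v j /\ v j <= b) ->
      (forall j l, j != l -> v j <= u l \/ v l <= u j) ->
      \sum_j (v j - u j) < d -> \sum_j `|f (v j) - f (u j)| < e.

Definition fluid_solution Rm S w lam (q : R -> 'cV[R]_n) : Prop :=
  (forall t, 0 <= t -> nonneg (q t)) /\
  (forall i t, 0 <= t -> abs_cont_on (fun u => q u i 0) 0 t) /\
  exists (s : 'cV[R]_n -> R -> R) (y : R -> 'cV[R]_n),
    (forall mu t, 0 <= t -> 0 <= s mu t <= 1) /\
    (forall t, 0 <= t -> nonneg (y t)) /\
    {ae (@lebesgue_measure R), forall t : R, 0 < t ->
       (forall i, derivable (fun u => q u i 0) t 1) /\
       (forall i, derive1 (fun u => q u i 0) t =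
           (lam + (Rm - 1%:M) *m (\sum_(mu <- undup S) s mu t *: mu - y t)) i 0) /\
       \sum_(mu <- undup S) s mu t = 1 /\
       (forall i, y t i 0 <= (\sum_(mu <- undup S) s mu t *: mu) i 0) /\
       (forall i, 0 < q t i 0 -> y t i 0 = 0) /\
       (forall mu, mu \in S -> ~ wmw_choice Rm S w (q t) mu -> s mu t = 0)}.

Definition invariant_states Rm S w lam : set 'cV[R]_n :=
  [set q0 | nonneg q0 /\ fluid_solution Rm S w lam (fun _ => q0)].

(* stationarity of a process (A t)_t of random vectors: shift invariance of all
   finite-dimensional distributions, tested on Borel rectangles *)
Definition stationary {d} {T : measurableType d} (P : probability T R)
    (A : nat -> T -> 'cV[R]_n) : Prop :=
  forall (k m : nat) (B : nat -> 'I_n -> set R), (forall t i, measurable (B t i)) ->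
    P [set om | forall t i, (t < m)%N -> B t i (A (t + k)%N om i 0)] =
    P [set om | forall t i, (t < m)%N -> B t i (A t om i 0)].

Definition arrival_process {d} {T : measurableType d} (A : nat -> T -> 'cV[R]_n) : Prop :=
  (forall t i, measurable_fun setT (fun om => A t om i 0)) /\
  (forall t om, nonneg (A t om)).

Definition stationary_with_mean {d} {T : measurableType d} (P : probability T R)
    (A : nat -> T -> 'cV[R]_n) lam : Prop :=
  arrival_process A /\ stationary P A /\
  forall i, (\int[P]_om (A 0%N om i 0)%:E = (lam i 0)%:E)%E.

Definition iid {d} {T : measurableType d} (P : probability T R)
    (A : nat -> T -> 'cV[R]_n) : Prop :=
  (forall (m : nat) (B : nat -> 'I_n -> set R), (forall t i, measurable (B t i)) ->
    P [set om | forall t i, (t < m)%N -> B t i (A t om i 0)] =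
    (\prod_(t < m) P [set om | forall i, B t i (A t om i ord0)])%E) /\
  (forall t (B : 'I_n -> set R), (forall i, measurable (B i)) ->
    P [set om | forall i, B i (A t om i 0)] = P [set om | forall i, B i (A 0%N om i 0)]).

Fixpoint pol_queue Rm (pi : 'cV[R]_n -> 'cV[R]_n) (A : nat -> 'cV[R]_n) x (t : nat)
  : 'cV[R]_n :=
  match t with
  | 0 => x
  | t'.+1 => let q := pol_queue Rm pi A x t' in qstep Rm q (A t') (pi q)
  end.

(* lam is supportable: there are i.i.d. arrivals with mean lam and a policy
   under which the network is positive recurrent (finite expected return time
   to a bounded set, from every initial state). *)
Definition supportable Rm S lam : Prop :=
  exists (d : measure_display) (T : measurableType d) (P : probability T R)
         (A : nat -> T -> 'cV[R]_n) (pi : 'cV[R]_n -> 'cV[R]_n),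
    arrival_process A /\ iid P A /\
    (forall i, (\int[P]_om (A 0%N om i 0)%:E = (lam i 0)%:E)%E) /\
    (forall x, pi x \in S) /\
    (forall x t i, nonneg x ->
       measurable_fun setT (fun om => pol_queue Rm pi (A^~ om) x t i 0)) /\
    exists M : R, forall x, nonneg x ->
      (\int[P]_om ereal_inf [set (t%:R)%:E | t in
          [set t : nat | (1 <= t)%N /\ (norm2 (pol_queue Rm pi (A^~ om) x t) <= M)%R]]
        < +oo)%E.

Definition capacity_region Rm S : set 'cV[R]_n :=
  [set lam | forall e, 0 < e -> exists lam', supportable Rm S lam' /\ norm2 (lam - lam') < e].

Definition extreme_point (C : set 'cV[R]_n) lam : Prop :=
  C lam /\ forall y z (th : R), C y -> C z -> 0 < th < 1 ->
    lam = th *: y + (1 - th) *: z -> y = lam /\ z = lam.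

Definition f_tailed (f : nat -> R -> R)
    (d : nat -> measure_display) (T : forall r, measurableType (d r))
    (P : forall r, probability (T r) R) (A : forall r, nat -> T r -> 'cV[R]_n)
    (lamr : nat -> 'cV[R]_n) lam : Prop :=
  (forall r, stationary_with_mean (P r) (A r) (lamr r)) /\
  (forall i, (fun r => lamr r i 0) @ \oo --> lam i 0) /\
  forall delta, 0 < delta ->
    (fun r => f r delta * fine (P r [set om |
        (r%:R)^-1 * max_dev (A r ^~ om) (lamr r) r.+1 > delta])) @ \oo --> 0.

Definition scaled (g : nat -> R) (r : nat) (Q : nat -> 'cV[R]_n) (t : R) : 'cV[R]_n :=
  (r%:R)^-1 *: Q `|Num.floor (g r * t)|%N.

Definition far_event {d} {Om : measurableType d} (g : nat -> R) (r : nat)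
    (Q : nat -> Om -> 'cV[R]_n) (I : set 'cV[R]_n) (Tend delta : R) : set Om :=
  [set om | sup [set dist_set (scaled g r (Q^~ om) t) I | t in `[0, Tend]] > delta].

Definition queue_processes Rm S w
    (d : nat -> measure_display) (T : forall r, measurableType (d r))
    (A : forall r, nat -> T r -> 'cV[R]_n) (Q : forall r, nat -> T r -> 'cV[R]_n)
    (Q0 : nat -> 'cV[R]_n) : Prop :=
  forall r, (forall t i, measurable_fun setT (fun om => Q r t om i 0)) /\
    forall om, Q r 0%N om = Q0 r /\ wmw_path Rm S w (A r ^~ om) (Q r ^~ om).

Definition sensitivity_const Rm S (C : R) : Prop :=
  0 < C /\
  forall (A : nat -> 'cV[R]_n) lam (Q : nat -> 'cV[R]_n) (q : R -> 'cV[R]_n),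
    (forall t, nonneg (A t)) -> nonneg lam -> nonneg (Q 0%N) ->
    wmw_path Rm S ones A Q -> fluid_solution Rm S ones lam q -> q 0 = Q 0%N ->
    forall k : nat,
      norm2 (Q k - q k%:R) <= C * (1 + norm2 lam + max_dev A lam k).

Definition attraction_const Rm S lam (alpha : R) : Prop :=
  0 < alpha /\
  forall q : R -> 'cV[R]_n, fluid_solution Rm S ones lam q -> forall t, 0 <= t ->
    ~ invariant_states Rm S ones lam (q t) ->
    exists2 D, D <= - alpha &
      (fun s => (dist_set (q (t + s)) (invariant_states Rm S ones lam)
                 - dist_set (q t) (invariant_states Rm S ones lam)) / s) @ 0^'+ --> D.

End NetworkDefs.

(* Main.v *)
Require Import Defs.
From HB Require Import structures.
From mathcomp Require Import all_boot all_order all_algebra.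
From mathcomp Require Import all_classical all_reals all_analysis.
From mathcomp Require Import measurable_realfun ring lra zify.
Set Implicit Arguments. Unset Strict Implicit. Unset Printing Implicit Defensive.
Import Order.TTheory GRing.Theory Num.Theory.
Import numFieldNormedType.Exports.
Local Open Scope classical_set_scope.
Local Open Scope ring_scope.

(** With [Phi q := max_(mu in S) wobj q mu - <q, lam>_w], WMW is a (sub)gradient
    descent of the convex, positively homogeneous, piecewise linear function
    [Phi] on the orthant, up to bounded errors.  For [lam] in the capacity region
    [Phi >= 0], the invariant states are the polyhedral cone [Phi = 0], and
    Hoffman's error bound gives [Phi q >= c * dist q].  Hence, once the cumulative
    fluctuation of the arrivals is subtracted, the squared distance of the queue
    to a fixed invariant state decreases at rate proportional to [dist]: over a
    window of [r] steps with fluctuation at most [e * r], a queue starting within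
    [th * r] of the cone stays within [delta * r] and ends within [th * r].  A
    union bound over the [g r / r] windows gives (a) and (b).  For MW, windows
    overlapping by three quarters make the constant [min delta alpha / (2 C)]
    sufficient; a fluid solution to compare with is piecewise linear, following
    the least-norm velocity, whose norm strictly decreases at each breakpoint and
    takes finitely many values.

    For (c), the arrivals are [lam] plus one burst per period [g r * Tend] with
    uniform random phase: a window of length [r] contains a burst with probability
    of order [r / g r], but one occurs before time [g r * Tend] with certainty. *)

(** * Weighted norms and distances *)

Section WeightedDot.
Variables (R : realType) (n : nat).
Implicit Types (x y z w : 'cV[R]_n) (a : R).

Definition dotw w x y : R := \sum_i w i 0 * x i 0 * y i 0.

Lemma dotwC w x y : dotw w x y = dotw w y x.
Proof. by apply: eq_bigr => i _; rewrite mulrAC. Qed.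

Lemma dotwDl w x y z : dotw w (x + y) z = dotw w x z + dotw w y z.
Proof. by rewrite -big_split /=; apply: eq_bigr => i _; rewrite mxE; ring. Qed.

Lemma dotwZl w a x z : dotw w (a *: x) z = a * dotw w x z.
Proof. by rewrite mulr_sumr; apply: eq_bigr => i _; rewrite mxE; ring. Qed.

Lemma dotwNl w x z : dotw w (- x) z = - dotw w x z.
Proof. by rewrite -scaleN1r dotwZl mulN1r. Qed.

Lemma dotwBl w x y z : dotw w (x - y) z = dotw w x z - dotw w y z.
Proof. by rewrite dotwDl dotwNl. Qed.

Lemma dotwDr w x y z : dotw w z (x + y) = dotw w z x + dotw w z y.
Proof. by rewrite dotwC dotwDl !(dotwC _ z). Qed.

Lemma dotwZr w a x z : dotw w z (a *: x) = a * dotw w z x.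
Proof. by rewrite dotwC dotwZl (dotwC _ z). Qed.

Lemma dotwNr w x z : dotw w z (- x) = - dotw w z x.
Proof. by rewrite dotwC dotwNl (dotwC _ z). Qed.

Lemma dotwBr w x y z : dotw w z (x - y) = dotw w z x - dotw w z y.
Proof. by rewrite dotwDr dotwNr. Qed.

Lemma dotw0l w z : dotw w 0 z = 0.
Proof. by rewrite -(scale0r 0) dotwZl mul0r. Qed.

Lemma dotw0r w z : dotw w z 0 = 0.
Proof. by rewrite dotwC dotw0l. Qed.

Lemma dotw_sqrD w x y :
  dotw w (x + y) (x + y) = dotw w x x + 2 * dotw w x y + dotw w y y.
Proof. rewrite !dotwDl !dotwDr (dotwC w y x); ring. Qed.

Lemma dotw_ge0 w x y : nonneg w -> nonneg x -> nonneg y -> 0 <= dotw w x y.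
Proof. by move=> w0 x0 y0; apply: sumr_ge0 => i _; rewrite !mulr_ge0. Qed.

Lemma dotw_delta w x i : dotw w (delta_mx i 0) x = w i 0 * x i 0.
Proof.
rewrite /dotw (bigD1 i)//= mxE !eqxx mulr1 big1 ?addr0// => j /negbTE ji.
by rewrite mxE ji mulr0 mul0r.
Qed.

End WeightedDot.

Notation dot := (dotw (ones _ _)).

Section EuclideanNorm.
Variables (R : realType) (n : nat).
Implicit Types (x y z : 'cV[R]_n) (a e : R).

Lemma norm2_ge0 x : 0 <= norm2 x.
Proof. exact: sqrtr_ge0. Qed.

Lemma dotE x y : dot x y = \sum_i x i 0 * y i 0.
Proof. by apply: eq_bigr => i _; rewrite mxE mul1r. Qed.

Lemma norm2_sqr x : norm2 x ^+ 2 = dot x x.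
Proof.
rewrite sqr_sqrtr; first by rewrite dotE; apply: eq_bigr => i _; rewrite expr2.
by apply: sumr_ge0 => i _; exact: sqr_ge0.
Qed.

Lemma norm2_sqr_sum x : norm2 x ^+ 2 = \sum_i x i 0 ^+ 2.
Proof. by rewrite norm2_sqr dotE; apply: eq_bigr => i _; rewrite expr2. Qed.

Lemma coord_le_norm2 x i : `|x i 0| <= norm2 x.
Proof.
rewrite -sqrtr_sqr; apply: ler_wsqrtr.
by rewrite (bigD1 i) //= lerDl; apply: sumr_ge0 => j _; exact: sqr_ge0.
Qed.

Lemma norm2_0 : norm2 (0 : 'cV[R]_n) = 0.
Proof. by apply/eqP; rewrite -sqrf_eq0 norm2_sqr dotw0l. Qed.

Lemma norm2_eq0 x : (norm2 x == 0) = (x == 0).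
Proof.
apply/eqP/eqP => [x0|->]; last exact: norm2_0.
by apply/colP => i; rewrite mxE; apply/eqP; rewrite -normr_le0 -x0 coord_le_norm2.
Qed.

Lemma norm2_gt0 x : (0 < norm2 x) = (x != 0).
Proof. by rewrite lt0r norm2_ge0 andbT norm2_eq0. Qed.

Lemma norm2Z a x : norm2 (a *: x) = `|a| * norm2 x.
Proof.
rewrite /norm2 -sqrtr_sqr -sqrtrM ?sqr_ge0//; congr Num.sqrt.
by rewrite mulr_sumr; apply: eq_bigr => i _; rewrite mxE exprMn.
Qed.

Lemma norm2N x : norm2 (- x) = norm2 x.
Proof. by rewrite -scaleN1r norm2Z normrN1 mul1r. Qed.

Lemma norm2_distC x y : norm2 (x - y) = norm2 (y - x).
Proof. by rewrite -opprB norm2N. Qed.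

Lemma norm2_sqrB x y : norm2 (x - y) ^+ 2 = norm2 x ^+ 2 - 2 * dot x y + norm2 y ^+ 2.
Proof. by rewrite !norm2_sqr dotw_sqrD dotwNr dotwNl dotwNr; ring. Qed.

Lemma dot_le_norm2 x y : dot x y <= norm2 x * norm2 y.
Proof.
have [->|x0] := eqVneq x 0; first by rewrite dotw0l norm2_0 mul0r.
have [->|y0] := eqVneq y 0; first by rewrite dotw0r norm2_0 mulr0.
have := sqr_ge0 (norm2 (norm2 y *: x - norm2 x *: y)).
rewrite norm2_sqrB !norm2Z dotwZl dotwZr !ger0_norm ?norm2_ge0// => xy.
have xy0 : 0 < norm2 x * norm2 y by rewrite mulr_gt0 ?norm2_gt0.
rewrite -(ler_pM2l xy0); nra.
Qed.

Lemma norm2D x y : norm2 (x + y) <= norm2 x + norm2 y.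
Proof.
rewrite -(@ler_pXn2r _ 2%N) ?nnegrE ?addr_ge0 ?norm2_ge0//.
rewrite norm2_sqr dotw_sqrD -!norm2_sqr.
by have := dot_le_norm2 x y; nra.
Qed.

Lemma norm2_sum (J : Type) (r : seq J) (F : J -> 'cV[R]_n) :
  norm2 (\sum_(j <- r) F j) <= \sum_(j <- r) norm2 (F j).
Proof.
elim/big_rec2: _ => [|j b x _ xb]; first by rewrite norm2_0.
by apply: le_trans (norm2D _ _) _; rewrite lerD2l.
Qed.

Lemma norm2_triangle x y z : norm2 (x - z) <= norm2 (x - y) + norm2 (y - z).
Proof. by rewrite -{1}(subrK y x) -addrA norm2D. Qed.

Lemma norm2_le_sum x : norm2 x <= \sum_i `|x i 0|.
Proof.
rewrite -[leRHS]ger0_norm ?sumr_ge0// -sqrtr_sqr ler_wsqrtr//.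
suff [] : 0 <= \sum_i `|x i 0| /\ \sum_i (x i 0) ^+ 2 <= (\sum_i `|x i 0|) ^+ 2 by [].
elim/big_rec2 : _ => [|i a b _ [b0 ab]]; first by rewrite expr0n.
split; first by rewrite addr_ge0.
have := normr_ge0 (x i 0); rewrite -(real_normK (num_real (x i 0))); nra.
Qed.

Lemma norm2_le_coord x e : (forall i, `|x i 0| <= e) -> norm2 x <= n%:R * e.
Proof.
move=> xe; apply: le_trans (norm2_le_sum x) _.
apply: le_trans (ler_sum _ (fun i _ => xe i)) _.
by rewrite sumr_const card_ord mulr_natl.
Qed.

Lemma norm2_lt_coord x e : 0 < e -> (forall i, `|x i 0| <= e / n.+1%:R) -> norm2 x < e.
Proof.
move=> e0 /norm2_le_coord/le_lt_trans; apply.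
by rewrite mulrCA gtr_pMr// ltr_pdivrMr// mul1r ltr_nat.
Qed.

(* First-order optimality of [u] for the distance to a ray: expand the square
   and let the step tend to zero. *)
Lemma dot_le0_of_norm2_min u x a : 0 < a ->
  (forall t, 0 < t <= a -> norm2 u <= norm2 (u - t *: x)) -> dot u x <= 0.
Proof.
move=> a0 umin; rewrite leNgt; apply/negP => ux.
have x0 : 0 < 1 + norm2 x ^+ 2 by rewrite ltr_wpDr// sqr_ge0.
pose t := Num.min a (dot u x / (1 + norm2 x ^+ 2)).
have t0 : 0 < t by rewrite lt_min a0 divr_gt0.
have := umin t; rewrite t0 /t ge_min lexx /= -/t => /(_ isT).
have tx : t * (1 + norm2 x ^+ 2) <= dot u x by rewrite -ler_pdivlMr// ge_min lexx orbT.
rewrite -(@ler_pXn2r _ 2%N) ?nnegrE ?norm2_ge0// norm2_sqrB dotwZr norm2Z (gtr0_norm t0).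
have := sqr_ge0 (norm2 x); nra.
Qed.

End EuclideanNorm.

Section WeightedNorm.
Variables (R : realType) (n : nat) (w : 'cV[R]_n).
Hypothesis w_gt0 : pos_weights w.
Implicit Types x y : 'cV[R]_n.

Lemma pos_weights_nonneg : nonneg w.
Proof. by move=> i; rewrite ltW. Qed.

Definition min_weight : R := \big[Num.min/1]_i w i 0.

(* One is added so that the constant is positive even in dimension zero. *)
Definition sum_weight : R := 1 + \sum_i w i 0.

Lemma min_weight_gt0 : 0 < min_weight.
Proof. by apply/bigmin_gtP; split. Qed.

Lemma sum_weight_gt0 : 0 < sum_weight.
Proof. by rewrite ltr_pwDl// sumr_ge0// => i _; exact: pos_weights_nonneg. Qed.

Lemma norm2_le_dotw x : min_weight * norm2 x ^+ 2 <= dotw w x x.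
Proof.
rewrite norm2_sqr_sum mulr_sumr; apply: ler_sum => i _.
by rewrite -mulrA -expr2 ler_wpM2r ?sqr_ge0//; exact: bigmin_le_cond.
Qed.

Lemma normr_dotw_le x y : `|dotw w x y| <= sum_weight * norm2 x * norm2 y.
Proof.
apply: le_trans (ler_norm_sum _ _ _) _.
apply: (@le_trans _ _ (\sum_i w i 0 * (norm2 x * norm2 y))).
  apply: ler_sum => i _; rewrite !normrM (gtr0_norm (w_gt0 i)) -mulrA ler_pM2l//.
  by rewrite ler_pM// coord_le_norm2.
by rewrite -mulr_suml -mulrA ler_wpM2r ?mulr_ge0 ?norm2_ge0// lerDr.
Qed.

Lemma dotw_le_norm2 x : dotw w x x <= sum_weight * norm2 x ^+ 2.
Proof. by rewrite expr2 mulrA (le_trans (ler_norm _))// normr_dotw_le. Qed.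

End WeightedNorm.

Section DistanceToSet.
Variables (R : realType) (n : nat).
Implicit Types (x y p : 'cV[R]_n) (I : set 'cV[R]_n).

Lemma dist_set_has_inf x I : I !=set0 -> has_inf [set norm2 (x - y) | y in I].
Proof.
move=> [y Iy]; split; first by exists (norm2 (x - y)), y.
by exists 0 => _ [z _ <-]; exact: norm2_ge0.
Qed.

Lemma dist_set_ge x I (b : R) : I !=set0 -> (forall y, I y -> b <= norm2 (x - y)) ->
  b <= dist_set x I.
Proof.
move=> I0 bI; apply: lb_le_inf; first by have [] := dist_set_has_inf x I0.
by move=> _ [y /bI + <-].
Qed.

Lemma dist_set_ge0 x I : 0 <= dist_set x I.
Proof.
have [I0|/set0P/negP/negPn/eqP->] := pselect (I !=set0).
  by apply: dist_set_ge => // y _; exact: norm2_ge0.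
by rewrite /dist_set image_set0 inf0.
Qed.

Lemma dist_set_le x y I : I y -> dist_set x I <= norm2 (x - y).
Proof.
by move=> Iy; apply: ge_inf; [exists 0 => _ [z _ <-]; exact: norm2_ge0|exists y].
Qed.

Lemma dist_set_subset x I I' : I !=set0 -> I `<=` I' -> dist_set x I' <= dist_set x I.
Proof. by move=> I0 II'; apply: dist_set_ge => // y /II'; exact: dist_set_le. Qed.

Lemma dist_set_adherent x I (e : R) : I !=set0 -> 0 < e ->
  exists2 y, I y & norm2 (x - y) < dist_set x I + e.
Proof.
move=> I0 e0; have [_ [y Iy <-] xy] := inf_adherent e0 (dist_set_has_inf x I0).
by exists y.
Qed.

Lemma dist_set_leD x y I : I !=set0 -> dist_set x I <= dist_set y I + norm2 (x - y).
Proof.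
move=> I0; apply/ler_addgt0Pr => e e0.
have [z Iz yz] := dist_set_adherent y I0 e0.
apply: le_trans (dist_set_le x Iz) _; apply: le_trans (norm2_triangle x y z) _; lra.
Qed.

Lemma dist_set_lipschitz x y I : I !=set0 ->
  `|dist_set x I - dist_set y I| <= norm2 (x - y).
Proof.
move=> I0; rewrite ler_norml; apply/andP; split.
  by have := dist_set_leD y x I0; rewrite norm2_distC; lra.
by have := dist_set_leD x y I0; lra.
Qed.

Lemma dist_set_self x I : I x -> dist_set x I = 0.
Proof.
move=> Ix; apply/eqP; rewrite eq_le dist_set_ge0 andbT.
by rewrite (le_trans (dist_set_le x Ix))// subrr norm2_0.
Qed.

Lemma dist_setZ x I (a : R) : I !=set0 -> 0 < a ->
  (forall b y, 0 < b -> I y -> I (b *: y)) ->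
  dist_set (a *: x) I = a * dist_set x I.
Proof.
move=> I0 a0 coneI.
have le_scale (c : R) y : 0 < c -> c * dist_set y I <= dist_set (c *: y) I.
  move=> c0; apply: dist_set_ge => // z Iz; rewrite -ler_pdivlMl//.
  have cV0 : 0 < c^-1 by rewrite invr_gt0.
  apply: le_trans (dist_set_le y (coneI _ _ cV0 Iz)) _.
  by rewrite -[X in X - _](scalerK (lt0r_neq0 c0)) -scalerBr norm2Z gtr0_norm.
apply/eqP; rewrite eq_le le_scale// andbT -ler_pdivrMl//.
have := @le_scale a^-1 (a *: x); rewrite scalerK ?lt0r_neq0//; apply.
by rewrite invr_gt0.
Qed.

End DistanceToSet.

Section ColumnTopology.
Variables (R : realType) (n : nat).
Implicit Types (x y p q : 'cV[R]_n) (A : set 'cV[R]_n).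

Lemma sum_continuous (T : topologicalType) (J : Type) (s : seq J) (F : J -> T -> R) :
  (forall j, continuous (F j)) -> continuous (fun t => \sum_(j <- s) F j t).
Proof. by move=> cF; apply: continuous_big => //; exact: add_continuous. Qed.

Lemma dotw_continuous (w : 'cV[R]_n) x : continuous (dotw w x).
Proof.
apply: sum_continuous => i y.
apply: (@continuousM _ _ (cst (w i 0 * x i 0)) (fun z : 'cV[R]_n => z i 0)).
  exact: cst_continuous.
exact: coord_continuous.
Qed.

Lemma norm2_continuous : continuous (@norm2 R n).
Proof.
move=> x; apply: (@continuous_comp _ _ _ (fun z : 'cV[R]_n => \sum_i z i 0 ^+ 2)); last first.
  exact: sqrt_continuous.
apply: sum_continuous => i y.
apply: (@continuous_comp _ _ _ (fun z : 'cV[R]_n => z i 0) (fun r => r ^+ 2)).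
  exact: coord_continuous.
exact: exprn_continuous.
Qed.

Lemma norm2B_continuous q : continuous (fun x => norm2 (q - x)).
Proof.
move=> x; apply: (@continuous_comp _ _ _ (fun z : 'cV[R]_n => q - z)); last exact: norm2_continuous.
by apply: continuousB; [exact: cst_continuous|exact: cvg_id].
Qed.

Lemma linear_comb_continuous k (F : 'I_k -> 'cV[R]_n) :
  continuous (fun c : 'cV[R]_k => \sum_j c j 0 *: F j).
Proof.
apply: continuous_big => [|j _ c]; first exact: add_continuous.
exact: (cvgZr_tmp (@coord_continuous R _ _ j 0 c)).
Qed.

Lemma mulmx_continuous k (B : 'M[R]_(n, k)) : continuous (fun x : 'cV[R]_k => B *m x).
Proof.
rewrite (_ : (fun _ => _) = fun x : 'cV[R]_k => \sum_j x j 0 *: col j B).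
  exact: linear_comb_continuous.
apply/funext => x; apply/colP => i; rewrite mxE summxE.
by apply: eq_bigr => j _; rewrite !mxE mulrC.
Qed.

Lemma trmx_continuous (m k : nat) : continuous (@trmx R m k).
Proof.
move=> M A [P MP PA]; exists (fun i j => P j i) => [i j|N NP].
  by have := MP j i; rewrite mxE.
by apply: PA => i j; rewrite mxE.
Qed.

Lemma closed_bounded_compact A (K : R) :
  closed A -> (forall x, A x -> norm2 x <= K) -> compact A.
Proof.
move=> cA AK; have -> : A = trmx @` ((@trmx R 1 n) @^-1` A).
  by apply/seteqP; split=> [x Ax|_ [v Av <-]//]; exists x^T; rewrite /= trmxK.
apply: continuous_compact; first by apply: continuous_subspaceT; exact: trmx_continuous.
apply: bounded_closed_compact; last first.
  by apply: preimage_closed => // v _; exact: trmx_continuous.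
exists `|K|; split=> [|M KM v /AK vK]; first exact: num_real.
rewrite /Num.norm/= mx_normrE; apply/bigmax_leP; split=> [|[i j] _ /=].
  by rewrite (le_trans _ (ltW KM)).
rewrite (ord1 i); have := coord_le_norm2 v^T j; rewrite mxE => /le_trans; apply.
by rewrite (le_trans vK)// (le_trans (ler_norm K))// ltW.
Qed.

Lemma dist_set_attained q A : closed A -> A !=set0 ->
  exists2 p, A p & norm2 (q - p) = dist_set q A.
Proof.
move=> cA [a Aa]; pose B := A `&` [set x | norm2 (q - x) <= norm2 (q - a)].
have cB : closed B.
  apply: closedI => //; apply: (@preimage_closed _ _ _ [set r | r <= norm2 (q - a)]).
    by move=> x _; exact: norm2B_continuous.
  exact: closed_le.
have compB : compact B.
  apply: (@closed_bounded_compact _ (norm2 q + norm2 (q - a))) => // x [_ /= xa].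
  rewrite -[x]subr0; apply: le_trans (norm2_triangle x q 0) _.
  by rewrite subr0 norm2_distC addrC lerD2l.
have B0 : B !=set0 by exists a; split=> /=.
have [|p] := @compact_EVT_min _ _ (fun x => norm2 (q - x)) _ B0 compB.
  by apply: continuous_subspaceT; exact: norm2B_continuous.
rewrite inE => -[Ap pa] pmin; exists p => //; apply/eqP.
rewrite eq_le dist_set_le// andbT; apply: dist_set_ge; first by exists a.
move=> y Ay; have [ya|/ltW] := leP (norm2 (q - y)) (norm2 (q - a)).
  by apply: pmin; rewrite inE.
exact: (le_trans pa).
Qed.

Lemma closed_dist_set_eq0 q A : closed A -> A !=set0 -> dist_set q A = 0 -> A q.
Proof.
move=> cA A0; have [p Ap <-] := dist_set_attained q cA A0.
by move/eqP; rewrite norm2_eq0 subr_eq0 => /eqP ->.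
Qed.

End ColumnTopology.

(** * Mixtures of service vectors *)

Section ConvexHull.
Variables (R : realType) (n : nat).
Implicit Types (S : seq 'cV[R]_n) (m mu : 'cV[R]_n) (s : 'cV[R]_n -> R).

Definition convex_weights S s : Prop :=
  (forall mu, 0 <= s mu) /\ \sum_(mu <- undup S) s mu = 1.

Definition mixture S s : 'cV[R]_n := \sum_(mu <- undup S) s mu *: mu.

Definition hull S : set 'cV[R]_n := [set mixture S s | s in convex_weights S].

Lemma convex_weights_le1 S s mu : convex_weights S s -> mu \in S -> s mu <= 1.
Proof.
move=> [s0 <-] muS; rewrite (bigD1_seq mu) ?undup_uniq ?mem_undup//= lerDl.
exact: sumr_ge0.
Qed.

Lemma convex_sum_le S s (F G : 'cV[R]_n -> R) : convex_weights S s ->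
  (forall mu, mu \in S -> s mu != 0 -> F mu <= G mu) ->
  \sum_(mu <- undup S) s mu * F mu <= \sum_(mu <- undup S) s mu * G mu.
Proof.
move=> [s0 _] FG; rewrite big_seq [leRHS]big_seq; apply: ler_sum => mu.
rewrite mem_undup => muS; have [->|smu] := eqVneq (s mu) 0; first by rewrite !mul0r.
by rewrite ler_wpM2l// FG.
Qed.

Lemma convex_sum_cst S s (b : R) : convex_weights S s ->
  \sum_(mu <- undup S) s mu * b = b.
Proof. by move=> [_ s1]; rewrite -mulr_suml s1 mul1r. Qed.

Lemma hull_mem S mu : mu \in S -> hull S mu.
Proof.
rewrite -mem_undup => muS; exists (fun nu => (nu == mu)%:R); first split.
- by move=> nu; rewrite ler0n.
- by rewrite (bigD1_seq mu) ?undup_uniq//= eqxx big1 ?addr0// => nu /negbTE ->.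
- rewrite /mixture (bigD1_seq mu) ?undup_uniq//= eqxx scale1r big1 ?addr0// => nu /negbTE ->.
  by rewrite scale0r.
Qed.

Lemma hull_comb S (J : eqType) (r : seq J) (c : J -> R) (F : J -> 'cV[R]_n) :
  (forall j, j \in r -> 0 <= c j) -> \sum_(j <- r) c j = 1 ->
  (forall j, j \in r -> hull S (F j)) -> hull S (\sum_(j <- r) c j *: F j).
Proof.
move=> c0 c1 hF.
have /choice[s sP] : forall j, exists s, j \in r -> convex_weights S s /\ mixture S s = F j.
  move=> j; have [/hF[s ? ?]|_] := boolP (j \in r); first by exists s.
  by exists (fun=> 0).
exists (fun mu => \sum_(j <- r | j \in r) c j * s j mu); first split.
- by move=> mu; apply: sumr_ge0 => j jr; rewrite mulr_ge0 ?c0//; have [[]] := sP j jr.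
- rewrite exchange_big /= -[RHS]c1 [RHS]big_seq; apply: eq_bigr => j jr.
  by rewrite -mulr_sumr; have [[_ ->]] := sP j jr; rewrite mulr1.
- rewrite /mixture; under eq_bigr do rewrite scaler_suml.
  rewrite exchange_big /= [RHS]big_seq; apply: eq_bigr => j jr.
  have [_ <-] := sP j jr; rewrite scaler_sumr.
  by apply: eq_bigr => mu _; rewrite scalerA.
Qed.

Lemma hull_bounded_weights S m : hull S m ->
  exists s, [/\ convex_weights S s, forall mu, s mu <= 1 & mixture S s = m].
Proof.
move=> [s cs <-]; exists (fun mu => Num.min (s mu) 1); split=> [|mu|].
- split=> [mu|]; first by rewrite le_min cs.1 ler01.
  rewrite -[RHS]cs.2 big_seq [RHS]big_seq; apply: eq_bigr => mu.
  by rewrite mem_undup => /(convex_weights_le1 cs)/min_idPl ->.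
- by rewrite ge_min lexx orbT.
- rewrite /mixture big_seq [RHS]big_seq; apply: eq_bigr => mu.
  by rewrite mem_undup => /(convex_weights_le1 cs)/min_idPl ->.
Qed.

Lemma hull_conv S m1 m2 (t : R) : hull S m1 -> hull S m2 -> 0 <= t <= 1 ->
  hull S (t *: m1 + (1 - t) *: m2).
Proof.
move=> hm1 hm2 /andP[t0 t1].
have := @hull_comb S bool [:: true; false] (fun b => if b then t else 1 - t)
  (fun b => if b then m1 else m2).
rewrite !big_cons !big_nil !addr0 /=; apply.
- by case=> _ //; rewrite subr_ge0.
- by rewrite addrC subrK.
- by case.
Qed.

Lemma hull_subset S S' : {subset S' <= S} -> hull S' `<=` hull S.
Proof.
move=> S'S _ [s [s0 s1] <-]; apply: hull_comb => // mu.
by rewrite mem_undup => /S'S; exact: hull_mem.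
Qed.

Definition simplex k : set 'cV[R]_k := [set c | nonneg c /\ \sum_j c j 0 = 1].

Arguments simplex k : clear implicits.

Lemma simplex_compact k : compact (simplex k).
Proof.
have sum_cont : continuous (fun c : 'cV[R]_k => \sum_j c j 0).
  by apply: sum_continuous => j; exact: coord_continuous.
apply: (@closed_bounded_compact _ _ _ k%:R).
  rewrite (_ : simplex k = \bigcap_j (fun c : 'cV[R]_k => c j 0) @^-1` [set x | 0 <= x]
      `&` (fun c : 'cV[R]_k => \sum_j c j 0) @^-1` [set 1]); last first.
    apply/seteqP; split=> c [c0 c1]; split=> //; first by move=> j _; exact: c0.
    by move=> j; exact: c0.
  apply: closedI; last by apply: preimage_closed => [c _|]; [exact: sum_cont|exact: closed_eq].
  apply: closed_bigI => j _; apply: preimage_closed => [c _|]; last exact: closed_ge.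
  exact: coord_continuous.
move=> c [c0 c1]; rewrite -[leRHS]mulr1; apply: norm2_le_coord => j.
by rewrite ger0_norm// -c1 (bigD1 j)//= lerDl; apply: sumr_ge0.
Qed.

Lemma hull_simplexE S : hull S =
  (fun c => \sum_j c j 0 *: (undup S)`_j) @` simplex (size (undup S)).
Proof.
apply/seteqP; split=> [_ [s [s0 s1] <-]|_ [c [c0 c1] <-]].
  exists (\col_j s (undup S)`_j); first split.
  - by move=> j; rewrite mxE.
  - by rewrite -s1 (big_nth 0) big_mkord; apply: eq_bigr => j _; rewrite mxE.
  - by rewrite /mixture (big_nth 0) big_mkord; apply: eq_bigr => j _; rewrite mxE.
apply: hull_comb => // j _; apply: hull_mem.
by rewrite -mem_undup mem_nth.
Qed.

Lemma hull_compact S : compact (hull S).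
Proof.
rewrite hull_simplexE; apply: continuous_compact; last exact: simplex_compact.
by apply: continuous_subspaceT; exact: linear_comb_continuous.
Qed.

End ConvexHull.

(** * Optimal services *)

Section ServiceObjective.
Variables (R : realType) (n : nat) (Rm : 'M[R]_n).
Implicit Types (S : seq 'cV[R]_n) (m mu nu q w : 'cV[R]_n) (s : 'cV[R]_n -> R).

Lemma wobjE w q mu : wobj Rm w q mu = dotw w q ((1%:M - Rm) *m mu).
Proof. by apply: eq_bigr => i _; rewrite (mulrC (q i 0)). Qed.

Lemma wobjBr w q m1 m2 : wobj Rm w q (m1 - m2) = wobj Rm w q m1 - wobj Rm w q m2.
Proof. by rewrite !wobjE mulmxBr dotwBr. Qed.

Lemma wobjDl w q1 q2 m : wobj Rm w (q1 + q2) m = wobj Rm w q1 m + wobj Rm w q2 m.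
Proof. by rewrite !wobjE dotwDl. Qed.

Lemma wobjZl w q a m : wobj Rm w (a *: q) m = a * wobj Rm w q m.
Proof. by rewrite !wobjE dotwZl. Qed.

Lemma wobj_mixture S w q s :
  wobj Rm w q (mixture S s) = \sum_(mu <- undup S) s mu * wobj Rm w q mu.
Proof.
rewrite /mixture; elim: undup => [|mu r IH]; first by rewrite !big_nil wobjE mulmx0 dotw0r.
by rewrite !big_cons -IH !wobjE mulmxDr dotwDr -scalemxAr dotwZr.
Qed.

Lemma hull_wobj_le S w q b m : (forall nu, nu \in S -> wobj Rm w q nu <= b) ->
  hull S m -> wobj Rm w q m <= b.
Proof.
move=> Sb [s cs <-]; rewrite wobj_mixture -(convex_sum_cst b cs).
by apply: convex_sum_le => // mu muS _; exact: Sb.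
Qed.

Lemma hull_wobj_ge S w q b m : (forall nu, nu \in S -> b <= wobj Rm w q nu) ->
  hull S m -> b <= wobj Rm w q m.
Proof.
move=> Sb [s cs <-]; rewrite wobj_mixture -(convex_sum_cst b cs).
by apply: convex_sum_le => // mu muS _; exact: Sb.
Qed.

Lemma optimal_weights_support S w q s : convex_weights S s ->
  (forall nu, nu \in S -> wobj Rm w q nu <= wobj Rm w q (mixture S s)) ->
  forall mu, mu \in S -> s mu != 0 -> wmw_choice Rm S w q mu.
Proof.
move=> cs smax mu muS smu; set b := wobj _ _ _ _ in smax.
have gap0 : \sum_(nu <- undup S) s nu * (b - wobj Rm w q nu) == 0.
  under eq_bigr do rewrite mulrBr.
  by rewrite sumrB convex_sum_cst// -wobj_mixture subrr.
split=> //; suff -> : wobj Rm w q mu = b by [].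
move: gap0; rewrite big_seq psumr_eq0; last first.
  by move=> nu; rewrite mem_undup => nuS; rewrite mulr_ge0 ?cs.1// subr_ge0 smax.
move=> /allP/(_ mu); rewrite !mem_undup muS mulf_eq0 (negbTE smu) /= subr_eq0.
by move=> /(_ isT)/eqP.
Qed.

Lemma wmw_choice_exists S w q : S != [::] -> exists mu, wmw_choice Rm S w q mu.
Proof.
elim: S => // mu [_ _|nu S IH _].
  by exists mu; split=> [|nu]; rewrite inE // => /eqP ->.
have [best [bestS bmax]] := IH isT.
have [mu_le|mu_gt] := leP (wobj Rm w q mu) (wobj Rm w q best).
  exists best; split=> [|nu']; rewrite inE ?bestS ?orbT//.
  by move=> /predU1P[->|/bmax].
exists mu; split=> [|nu']; first exact: mem_head.
by rewrite inE => /predU1P[->//|/bmax/le_trans]; apply; exact: ltW.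
Qed.

Definition optimal_services S w q : seq 'cV[R]_n :=
  [seq mu <- S | `[< wmw_choice Rm S w q mu >]].

Lemma optimal_services_neq0 S w q : S != [::] -> optimal_services S w q != [::].
Proof.
move=> /(wmw_choice_exists w q)[mu much]; rewrite -has_filter; apply/hasP.
by exists mu; [exact: much.1|apply/asboolP].
Qed.

Lemma hull_optimalP S w q m : hull (optimal_services S w q) m <->
  hull S m /\ forall nu, nu \in S -> wobj Rm w q nu <= wobj Rm w q m.
Proof.
split=> [hm|[[s cs <-] smax]].
  split=> [|nu nuS]; first by apply: hull_subset hm; exact: mem_subseq (filter_subseq _ _).
  apply: hull_wobj_ge hm => mu; rewrite mem_filter => /andP[/asboolP[_ mumax] _].
  exact: mumax.
have supp mu : mu \in undup S -> ~~ `[< wmw_choice Rm S w q mu >] -> s mu = 0.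
  rewrite mem_undup => muS /asboolPn nopt; apply/eqP/negPn/negP => smu.
  exact: nopt (optimal_weights_support cs smax muS smu).
have restrict (V : nmodType) (F : 'cV[R]_n -> V) : (forall mu, s mu = 0 -> F mu = 0) ->
    \sum_(mu <- undup (optimal_services S w q)) F mu = \sum_(mu <- undup S) F mu.
  move=> sF; rewrite -filter_undup big_filter big_mkcond /= big_seq [RHS]big_seq.
  apply: eq_bigr => mu muS; case: ifPn => // nopt.
  by rewrite sF//; exact: supp.
exists s; first by split; [exact: cs.1|rewrite restrict// cs.2].
by rewrite /mixture restrict// => mu ->; rewrite scale0r.
Qed.

End ServiceObjective.

Section Network.
Variables (R : realType) (n : nat) (Rm : 'M[R]_n) (S : seq 'cV[R]_n).
Hypothesis net : network_ok Rm S.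
Implicit Types (a m mu nu p q w x y : 'cV[R]_n).

Lemma routing_nonneg x : nonneg x -> nonneg (Rm *m x).
Proof.
by move=> x0 i; rewrite mxE; apply: sumr_ge0 => j _; rewrite mulr_ge0//; exact: net.1.
Qed.

Lemma hull_nonneg m : hull S m -> nonneg m.
Proof.
move=> [s [s0 _] <-] i; rewrite summxE big_seq; apply: sumr_ge0 => mu.
by rewrite mem_undup => /net.2.1 mu0; rewrite mxE mulr_ge0.
Qed.

Lemma hull_zero_comp m i : hull S m -> hull S (zero_comp m i).
Proof.
move=> [s [s0 s1] <-].
rewrite (_ : zero_comp _ _ = \sum_(mu <- undup S) s mu *: zero_comp mu i).
  by apply: hull_comb => // mu; rewrite mem_undup => muS; apply/hull_mem/net.2.2.
apply/colP => j; rewrite mxE !summxE; case: ifPn => ji.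
  by rewrite big1// => mu _; rewrite !mxE ji mulr0.
by apply: eq_bigr => mu _; rewrite !mxE (negbTE ji).
Qed.

Lemma hull_decr_comp m i b : hull S m -> 0 <= b <= m i 0 ->
  hull S (\col_j if j == i then b else m j 0).
Proof.
move=> hm /andP[b0 bm]; pose t := b / m i 0.
have [mi0|mi0] := eqVneq (m i 0) 0.
  rewrite (_ : (\col__ _) = m)//; apply/colP => j; rewrite mxE; case: eqP => // ->.
  by apply/eqP; rewrite eq_le bm mi0 b0.
have mi : 0 < m i 0 by rewrite lt0r mi0 (le_trans b0).
rewrite (_ : (\col__ _) = t *: m + (1 - t) *: zero_comp m i).
  apply: hull_conv => //; first exact: hull_zero_comp.
  by rewrite divr_ge0 ?(ltW mi)//= ler_pdivrMr// mul1r.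
apply/colP => j; rewrite !mxE; case: eqP => [->|_]; first by rewrite mulr0 addr0 divfK.
by rewrite -mulrDl addrC subrK mul1r.
Qed.

Lemma hull_le m m' : hull S m -> (forall i, 0 <= m' i 0 <= m i 0) -> hull S m'.
Proof.
move=> hm mm'.
suff lowered (r : seq 'I_n) : hull S (\col_i if i \in r then m' i 0 else m i 0).
  rewrite (_ : m' = \col_i if i \in enum 'I_n then m' i 0 else m i 0)//.
  by apply/colP => j; rewrite mxE mem_enum.
elim: r => [|k r IH].
  by rewrite (_ : (\col__ _) = m)//; apply/colP => j; rewrite mxE.
have /(hull_decr_comp (b := m' k 0) IH) : 0 <= m' k 0 <=
    (\col_i if i \in r then m' i 0 else m i 0) k 0.
  by rewrite mxE; have /andP[m0 mk] := mm' k; case: ifP; rewrite m0 ?lexx.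
congr hull; apply/colP => j; rewrite !mxE inE.
by case: (eqVneq j k) => [->|].
Qed.

Lemma wobj_unserved w q y : nonneg w -> nonneg q -> nonneg y ->
  (forall i, 0 < q i 0 -> y i 0 = 0) ->
  wobj Rm w q y = - dotw w q (Rm *m y).
Proof.
move=> w0 q0 y0 qy; rewrite wobjE mulmxBl mul1mx dotwBr.
rewrite (_ : dotw w q y = 0) ?sub0r//; apply: big1 => i _.
have := q0 i; rewrite le_eqVlt => /predU1P[<-|/qy ->]; last by rewrite mulr0.
by rewrite mulr0 mul0r.
Qed.

Lemma wobj_unserved_le0 w q y : nonneg w -> nonneg q -> nonneg y ->
  (forall i, 0 < q i 0 -> y i 0 = 0) -> wobj Rm w q y <= 0.
Proof.
move=> w0 q0 y0 qy; rewrite wobj_unserved// oppr_le0.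
by apply: dotw_ge0 => //; exact: routing_nonneg.
Qed.

Lemma cmin_bounds mu q i : mu \in S -> nonneg q -> 0 <= cmin mu q i 0 <= mu i 0.
Proof. by move=> muS q0; rewrite mxE le_min q0 net.2.1//= ge_min lexx. Qed.

Lemma cmin_hull mu q : mu \in S -> nonneg q -> hull S (cmin mu q).
Proof.
by move=> muS q0; apply: hull_le (hull_mem muS) _ => i; exact: cmin_bounds.
Qed.

Lemma qstep_nonneg q a mu : mu \in S -> nonneg q -> nonneg a -> nonneg (qstep Rm q a mu).
Proof.
move=> muS q0 a0 i; rewrite /qstep mulmxBl mul1mx.
have := routing_nonneg (hull_nonneg (cmin_hull muS q0)) i; rewrite !mxE.
have : Num.min (mu i 0) (q i 0) <= q i 0 by rewrite ge_min lexx orbT.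
have := a0 i; lra.
Qed.

Lemma wmw_path_nonneg w (A Q : nat -> 'cV[R]_n) : wmw_path Rm S w A Q ->
  (forall t, nonneg (A t)) -> nonneg (Q 0%N) -> forall t, nonneg (Q t).
Proof.
move=> path A0 Q0; elim=> // t IH.
by have [mu [[muS _] ->]] := path t; exact: qstep_nonneg.
Qed.

End Network.

(** * Fluid solutions and invariant states *)

Section RealFunctions.
Variable R : realType.
Implicit Types (f : R -> R) (a b c t : R).

Lemma lipschitz_abs_cont f c a b : 0 <= c ->
  (forall s t, `|f t - f s| <= c * `|t - s|) -> abs_cont_on f a b.
Proof.
move=> c0 lip e e0; have c1 : 0 < c + 1 by rewrite ltr_wpDl.
exists (e / (c + 1)) => [|k u v uv _]; first by rewrite divr_gt0.
have uv0 j : 0 <= v j - u j by have [_ []] := uv j; rewrite subr_ge0.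
rewrite ltr_pdivlMr// => /(le_lt_trans _); apply.
rewrite mulr_suml; apply: ler_sum => j _; apply: le_trans (lip _ _) _.
by rewrite mulrC ger0_norm// ler_wpM2l// lerDl.
Qed.

Lemma near_affine_is_derive f t c :
  (\forall u \near t, f u = f t + (u - t) * c) -> is_derive t 1 f c.
Proof.
move=> fE; apply: (@near_eq_is_derive _ _ _ (fun u => f t + (u - t) * c)) => //.
  by near=> u; rewrite [RHS](near fE).
by apply: is_derive_eq; rewrite /= !scaler0 subr0 add0r /GRing.scale /= mulr1 add0r mul1r.
Unshelve. all: end_near. Qed.

Lemma ae_exists_gt0 (P : R -> Prop) :
  {ae (@lebesgue_measure R), forall t, P t} -> exists2 t, 0 < t & P t.
Proof.
move=> [N [mN N0 PN]]; apply: contrapT => nP.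
have : (@lebesgue_measure R `]0%R, 1%R[%classic <= 0)%E.
  rewrite -N0; apply: le_measure; rewrite ?inE// => t /=.
  by rewrite in_itv /= => /andP[t0 _]; apply: PN => /= Pt; apply: nP; exists t.
by rewrite lebesgue_measure_itv /= lte_fin ltr01 oppr0 adde0 lee_fin ler10.
Qed.

Lemma ae_notin_seq (E : seq R) (P : R -> Prop) : (forall t, t \notin E -> P t) ->
  {ae (@lebesgue_measure R), forall t, P t}.
Proof.
move=> EP; have cE : countable [set` E] := finite_set_countable (finite_seq E).
exists [set` E]; split; last first.
- by move=> t /= nP; apply: contrapT => /negP /EP.
- exact: countable_lebesgue_measure0.
- by apply: countable_measurable => // t; exact: measurable_set1.
Qed.

End RealFunctions.

Section FluidSolutions.
Variables (R : realType) (n : nat) (Rm : 'M[R]_n) (S : seq 'cV[R]_n) (w lam : 'cV[R]_n).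
Hypothesis net : network_ok Rm S.
Implicit Types (m mu nu y : 'cV[R]_n) (q : R -> 'cV[R]_n).

Definition veloc m := lam - (1%:M - Rm) *m m.

Definition pl_fluid q : Prop :=
  [/\ forall t, 0 <= t -> nonneg (q t),
      exists2 c : R, 0 <= c & forall s t, norm2 (q t - q s) <= c * `|t - s| &
      exists E : seq R, forall t, 0 < t -> t \notin E ->
        exists2 m, hull (optimal_services Rm S w (q t)) m &
          \forall u \near t, q u = q t + (u - t) *: veloc m].

Lemma pl_fluid_weights q t m : hull (optimal_services Rm S w (q t)) m ->
  (\forall u \near t, q u = q t + (u - t) *: veloc m) ->
  exists s, [/\ convex_weights S s, forall mu, s mu <= 1,
    forall mu, mu \in S -> s mu != 0 -> wmw_choice Rm S w (q t) mu &
    forall i, is_derive t 1 (fun u => q u i 0) (veloc (mixture S s) i 0)].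
Proof.
move=> /hull_optimalP[/hull_bounded_weights[s [cs s1 <-]] mmax] qE.
exists s; split=> // [|i]; first exact: (optimal_weights_support cs mmax).
apply: near_affine_is_derive; apply: filterS qE => u ->.
by rewrite mxE [X in _ + X]mxE.
Qed.

Lemma pl_fluid_solution q : pl_fluid q -> fluid_solution Rm S w lam q.
Proof.
move=> [q0 [c c0 qlip] [E qE]]; split=> //; split=> [i t _|].
  apply: lipschitz_abs_cont c0 _ => s u.
  by apply: le_trans (qlip s u); have := coord_le_norm2 (q u - q s) i; rewrite !mxE.
have /choice[s sP] : forall t, exists s : 'cV[R]_n -> R, (forall mu, 0 <= s mu <= 1) /\
    (0 < t -> t \notin E -> [/\ convex_weights S s,
      forall mu, mu \in S -> s mu != 0 -> wmw_choice Rm S w (q t) mu &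
      forall i, is_derive t 1 (fun u => q u i 0) (veloc (mixture S s) i 0)]).
  move=> t; have [/andP[t0 tE]|tE] := boolP ((0 < t) && (t \notin E)); last first.
    by exists (fun=> 0); split=> [mu|t0 tE']; [rewrite lexx ler01|rewrite t0 tE' in tE].
  have [m hm /(pl_fluid_weights hm)[s [cs s1 supp dq]]] := qE t t0 tE.
  by exists s; split=> [mu|_ _]; rewrite ?s1 ?cs.1.
exists (fun mu t => s t mu), (fun=> 0); split; first by move=> mu t _; exact: (sP t).1.
split=> [t _ i|]; first by rewrite mxE.
apply: (@ae_notin_seq _ E) => t tE t0; have [cs supp dq] := (sP t).2 t0 tE.
split; [|split; [|split; [|split; [|split]]]].
- by move=> i; have [] := dq i.
- move=> i; rewrite derive1E subr0 -[X in lam + X *m _]opprB mulNmx.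
  by have [_ ->] := dq i.
- exact: cs.2.
- by move=> i; rewrite mxE (hull_nonneg net)//; exists (s t).
- by move=> i _; rewrite mxE.
- by move=> mu muS nopt; apply/eqP/negPn/negP => /(supp _ muS).
Qed.

End FluidSolutions.

Section InvariantStates.
Variables (R : realType) (n : nat) (Rm : 'M[R]_n) (S : seq 'cV[R]_n) (w lam : 'cV[R]_n).
Hypotheses (net : network_ok Rm S) (w_gt0 : pos_weights w).
Implicit Types (m mu nu q : 'cV[R]_n).

Definition sustainable : Prop := exists2 rho, hull S rho & lam = (1%:M - Rm) *m rho.

Definition inv_cone : set 'cV[R]_n :=
  [set q | nonneg q /\ forall nu, nu \in S -> wobj Rm w q nu <= dotw w q lam].

Lemma invariant_states_sub_cone : invariant_states Rm S w lam `<=` inv_cone.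
Proof.
move=> q [q0 [_ [_ [s [y [s01 [y0 /ae_exists_gt0]]]]]]].
move=> [t t0 /(_ t0)[_ [dq [s1 [_ [qy smax]]]]]]; split=> // nu nuS.
have cs : convex_weights S (s^~ t).
  by split=> [mu|//]; have /andP[] := s01 mu t (ltW t0).
rewrite -/(mixture S (s^~ t)) in dq; set m := mixture _ _ in dq.
have -> : lam = (1%:M - Rm) *m (m - y t).
  apply/eqP; rewrite -subr_eq0 -mulNmx opprB; apply/eqP/colP => i.
  by rewrite [RHS]mxE -dq derive1_cst.
have : wobj Rm w q (y t) <= 0.
  by apply: (wobj_unserved_le0 net) => //; [exact: pos_weights_nonneg|exact/y0/ltW].
have : wobj Rm w q nu <= wobj Rm w q m.
  rewrite wobj_mixture -(convex_sum_cst (wobj Rm w q nu) cs).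
  apply: convex_sum_le => // mu muS smu.
  suff [_ ->] : wmw_choice Rm S w q mu by [].
  by apply: contrapT => /(smax _ muS) smu0; rewrite smu0 eqxx in smu.
by rewrite -wobjE wobjBr; lra.
Qed.

Lemma inv_cone_sub_invariant_states : sustainable -> inv_cone `<=` invariant_states Rm S w lam.
Proof.
move=> [rho hull_rho lamE] q [q0 qS]; split=> //; apply: pl_fluid_solution => //.
split=> //; first by exists 0 => // s t; rewrite subrr norm2_0 mul0r.
exists [::] => t _ _; exists rho.
  by apply/hull_optimalP; split=> // nu /qS; rewrite [wobj _ _ _ rho]wobjE -lamE.
by apply: (@nearW _ (nbhs t)) => u; rewrite /veloc -lamE subrr scaler0 addr0.
Qed.

Lemma invariant_statesE : sustainable -> invariant_states Rm S w lam = inv_cone.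
Proof.
move=> sus; apply/seteqP; split; first exact: invariant_states_sub_cone.
exact: inv_cone_sub_invariant_states.
Qed.

Lemma inv_coneZ a q : 0 <= a -> inv_cone q -> inv_cone (a *: q).
Proof.
move=> a0 [q0 qS]; split=> [i|nu nuS]; first by rewrite mxE mulr_ge0.
by rewrite wobjZl dotwZl ler_wpM2l// qS.
Qed.

Lemma inv_cone_neq0 : inv_cone !=set0.
Proof.
exists 0; split=> [i|nu nuS]; first by rewrite mxE.
by rewrite wobjE !dotw0l.
Qed.

Lemma dist_inv_coneZ a q : 0 < a -> dist_set (a *: q) inv_cone = a * dist_set q inv_cone.
Proof.
move=> a0; apply: dist_setZ => //; first exact: inv_cone_neq0.
by move=> b y b0; apply: inv_coneZ; exact: ltW.
Qed.

Lemma inv_cone_closed : closed inv_cone.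
Proof.
have closed_dotw_le y b : closed [set q | dotw w y q <= b].
  apply: (@preimage_closed _ _ (dotw w y) [set r | r <= b]); last exact: closed_le.
  by move=> q _; exact: dotw_continuous.
rewrite (_ : inv_cone = (\bigcap_i [set q | dotw w (- delta_mx i 0) q <= 0]) `&`
    \bigcap_(nu in [set` S]) [set q | dotw w ((1%:M - Rm) *m nu - lam) q <= 0]).
  by apply: closedI; apply: closed_bigI.
have coordE q i : (dotw w (- delta_mx i 0) q <= 0) = (0 <= q i 0).
  by rewrite dotwNl dotw_delta oppr_le0 pmulr_rge0.
have objE q nu : (dotw w ((1%:M - Rm) *m nu - lam) q <= 0) =
    (wobj Rm w q nu <= dotw w q lam).
  by rewrite dotwBl wobjE subr_le0 !(dotwC _ _ q).
apply/seteqP; split=> q [q0 qS]; split=> [i|nu nuS].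
- by move=> _ /=; rewrite coordE.
- by rewrite /= objE qS.
- by rewrite -coordE; exact: q0.
- by rewrite -objE; exact: qS.
Qed.

End InvariantStates.

(** * Hoffman's error bound *)

Section PolyhedralCone.
Variables (R : realType) (n : nat) (T : finType) (a : T -> 'cV[R]_n).
Implicit Types (x p q u : 'cV[R]_n) (J : {set T}) (C : set 'cV[R]_n).

Definition poly_cone J : set 'cV[R]_n := [set x | forall j, j \in J -> dot (a j) x <= 0].

Definition polar C : set 'cV[R]_n := [set u | forall x, C x -> dot u x <= 0].

Definition excess J x : R := \sum_(j in J) Num.max 0 (dot (a j) x).

Definition active J x : {set T} := [set j in J | dot (a j) x == 0]%SET.

Lemma dot_le_closed u (b : R) : closed [set x | dot u x <= b].
Proof.
apply: (@preimage_closed _ _ (dotw (ones R n) u) [set r | r <= b]); last exact: closed_le.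
by move=> x _; exact: dotw_continuous.
Qed.

Lemma poly_cone_closed J : closed (poly_cone J).
Proof.
rewrite (_ : poly_cone J = \bigcap_(j in [set` J]) [set x | dot (a j) x <= 0]).
  by apply: closed_bigI => j _; exact: dot_le_closed.
by apply/seteqP; split=> x xJ j jJ; exact: xJ.
Qed.

Lemma poly_cone_neq0 J : poly_cone J !=set0.
Proof. by exists 0 => j _; rewrite dotw0r. Qed.

Lemma polar_closed C : closed (polar C).
Proof.
rewrite (_ : polar C = \bigcap_(x in C) [set u | dot x u <= 0]).
  by apply: closed_bigI => x _; exact: dot_le_closed.
by apply/seteqP; split=> u uC x Cx /=; [rewrite dotwC|rewrite dotwC]; exact: uC.
Qed.

Lemma excess_ge0 J x : 0 <= excess J x.
Proof. by apply: sumr_ge0 => j _; rewrite le_max lexx. Qed.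

Lemma excessZ J (c : R) x : 0 <= c -> excess J (c *: x) = c * excess J x.
Proof.
by move=> c0; rewrite mulr_sumr; apply: eq_bigr => j _; rewrite dotwZr maxr_pMr// mulr0.
Qed.

Lemma excess_continuous J : continuous (excess J).
Proof.
rewrite (_ : excess J = fun x => \sum_(j <- enum J) Num.max 0 (dot (a j) x)); last first.
  by apply/funext => x; rewrite /excess big_enum.
apply: sum_continuous => j x.
apply: (@continuous_max _ _ (cst 0) (dotw (ones R n) (a j))); first exact: cst_continuous.
exact: dotw_continuous.
Qed.

Lemma polar_excess_gt0 J u : polar (poly_cone J) u -> u != 0 -> 0 < excess J u.
Proof.
move=> pu u0; rewrite lt0r excess_ge0 andbT; apply: contra u0 => /eqP exc0.
rewrite -norm2_eq0 -sqrf_eq0 eq_le sqr_ge0 andbT norm2_sqr; apply: pu => j jJ.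
move/eqP: exc0; rewrite psumr_eq0 => [/allP/(_ j)|i _]; last by rewrite le_max lexx.
by rewrite mem_index_enum jJ => /(_ isT)/eqP <-; rewrite le_max lexx orbT.
Qed.

Lemma polar_excess_ge J : exists2 c : R, 0 < c &
  forall u, polar (poly_cone J) u -> c * norm2 u <= excess J u.
Proof.
pose A := polar (poly_cone J) `&` [set u | norm2 u = 1].
have normalized u : polar (poly_cone J) u -> u != 0 -> A ((norm2 u)^-1 *: u).
  rewrite -norm2_gt0 => pu u0; split=> [x Jx|/=].
    by rewrite dotwZl mulr_ge0_le0 ?invr_ge0 ?norm2_ge0// pu.
  by rewrite norm2Z ger0_norm ?invr_ge0 ?norm2_ge0// mulVf// gt_eqF.
have cA : compact A.
  apply: (@closed_bounded_compact _ _ _ 1) => [|u [_ /= ->]//].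
  apply: closedI; first exact: polar_closed.
  apply: (@preimage_closed _ _ (@norm2 R n) [set r | r = 1]); last exact: closed_eq.
  by move=> u _; exact: norm2_continuous.
have [A0|A0] := pselect (A !=set0); last first.
  exists 1 => // u pu; have [->|u0] := eqVneq u 0; first by rewrite norm2_0 mulr0 excess_ge0.
  by exfalso; apply: A0; exists ((norm2 u)^-1 *: u); exact: normalized.
have [|v] := @compact_EVT_min _ _ (excess J) _ A0 cA.
  by apply: continuous_subspaceT; exact: excess_continuous.
rewrite inE => -[pv v1] vmin; exists (excess J v).
  by apply: polar_excess_gt0 => //; rewrite -norm2_gt0 v1.
move=> u pu; have [->|u0] := eqVneq u 0; first by rewrite norm2_0 mulr0 excess_ge0.
have := vmin _ (mem_set (normalized u pu u0)).
by rewrite excessZ ?invr_ge0 ?norm2_ge0// ler_pdivlMl ?norm2_gt0// mulrC.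
Qed.

Lemma poly_cone_move J p x : poly_cone J p -> poly_cone (active J p) x ->
  exists2 t : R, 0 < t & forall s, 0 < s <= t -> poly_cone J (p + s *: x).
Proof.
move=> Kp px; pose slope j := (- dot (a j) p) / (1 + `|dot (a j) x|).
have den j : 0 < 1 + `|dot (a j) x| by rewrite ltr_pwDl.
pose J' := J :\: active J p.
exists (\big[Num.min/1]_(j in J') slope j) => [|s /andP[s0 st] j jJ].
  apply/bigmin_gtP; split=> // j; rewrite !inE negb_and => /andP[/orP[/negP//|jp] jJ].
  by rewrite divr_gt0// oppr_gt0 lt_neqAle jp Kp.
rewrite dotwDr dotwZr; have [jp|jp] := eqVneq (dot (a j) p) 0.
  by rewrite jp add0r mulr_ge0_le0 ?(ltW s0)// px// inE jJ jp eqxx.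
have : s <= slope j.
  by rewrite (le_trans st)// bigmin_le_cond// !inE negb_and jp jJ orbT.
rewrite ler_pdivlMr// => sj; have := ler_norm (dot (a j) x); nra.
Qed.

Lemma projection_residual_polar J q p : poly_cone J p ->
  norm2 (q - p) = dist_set q (poly_cone J) -> polar (poly_cone (active J p)) (q - p).
Proof.
move=> Kp qp x px; have [t t0 tK] := poly_cone_move Kp px.
apply: (dot_le0_of_norm2_min t0) => s st; rewrite qp -addrA -opprD.
by apply: dist_set_le; exact: tK.
Qed.

Lemma hoffman J : exists2 c : R, 0 < c &
  forall q, c * dist_set q (poly_cone J) <= excess J q.
Proof.
have /choice[c cP] : forall J', exists c : R, 0 < c /\
    forall u, polar (poly_cone J') u -> c * norm2 u <= excess J' u.
  by move=> J'; have [c c0 cu] := polar_excess_ge J'; exists c.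
exists (\big[Num.min/1]_J' c J') => [|q].
  by apply/bigmin_gtP; split=> // J' _; exact: (cP J').1.
have [p Kp qp] := dist_set_attained q (@poly_cone_closed J) (poly_cone_neq0 J).
rewrite -qp; apply: (@le_trans _ _ (c (active J p) * norm2 (q - p))).
  by rewrite ler_wpM2r ?norm2_ge0// bigmin_le_cond.
apply: le_trans ((cP _).2 _ (projection_residual_polar Kp qp)) _.
apply: (@le_trans _ _ (excess (active J p) q)).
  apply: ler_sum => j; rewrite inE => /andP[_ /eqP jp].
  by rewrite dotwBr jp subr0.
rewrite /excess [leRHS](bigID (mem (active J p))) /= ler_wpDr//.
  by apply: sumr_ge0 => j _; rewrite le_max lexx.
rewrite le_eqVlt; apply/orP; left; apply/eqP; apply: eq_bigl => j.
by rewrite !inE andbA andbb.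
Qed.

End PolyhedralCone.

Section ErrorBound.
Variables (R : realType) (n : nat) (Rm : 'M[R]_n) (S : seq 'cV[R]_n) (w lam : 'cV[R]_n).
Implicit Types (mu nu p q x : 'cV[R]_n).
Local Notation K := (inv_cone Rm S w lam).

Definition error_bound (c : R) : Prop := forall q mu, nonneg q ->
  wmw_choice Rm S w q mu -> c * dist_set q K <= wobj Rm w q mu - dotw w q lam.

Definition cone_normals (j : 'I_n + seq_sub S) : 'cV[R]_n :=
  match j with
  | inl i => - delta_mx i 0
  | inr mu => \col_i (w i 0 * (((1%:M - Rm) *m val mu) i 0 - lam i 0))
  end.

Lemma dot_service_normal x (mu : seq_sub S) :
  dot (cone_normals (inr mu)) x = wobj Rm w x (val mu) - dotw w x lam.
Proof. by rewrite wobjE -dotwBr dotE; apply: eq_bigr => i _; rewrite !mxE; ring. Qed.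

Lemma dot_coord_normal x i : dot (cone_normals (inl i)) x = - x i 0.
Proof. by rewrite dotwNl dotw_delta mxE mul1r. Qed.

Lemma poly_cone_inv_cone : poly_cone cone_normals [set: _]%SET `<=` K.
Proof.
move=> x ax; split=> [i|nu nuS].
  by rewrite -oppr_le0 -dot_coord_normal ax ?inE.
by rewrite -subr_le0 -(dot_service_normal x (SeqSub nuS)) ax ?inE.
Qed.

Lemma inv_cone_error_bound : sustainable Rm S lam ->
  exists2 c : R, 0 < c & error_bound c.
Proof.
move=> [rho hull_rho lamE]; have [c c0 cP] := hoffman cone_normals [set: _]%SET.
pose N : R := #|{: 'I_n + seq_sub S}|.+1%:R.
exists (c / N) => [|q mu q0 [muS mumax]]; first by rewrite divr_gt0.
have slack0 : 0 <= wobj Rm w q mu - dotw w q lam.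
  by rewrite subr_ge0 lamE -wobjE; exact: hull_wobj_le mumax hull_rho.
rewrite mulrAC ler_pdivrMr//; apply: (@le_trans _ _ (excess cone_normals [set: _]%SET q)).
  apply: le_trans (cP q); rewrite ler_pM2l//.
  by apply: dist_set_subset poly_cone_inv_cone; exact: poly_cone_neq0.
apply: (@le_trans _ _ (\sum_(j in [set: 'I_n + seq_sub S]%SET)
    (wobj Rm w q mu - dotw w q lam))).
  apply: ler_sum => -[i|nu] _; rewrite ge_max slack0 /=.
    by rewrite dot_coord_normal (le_trans _ slack0)// oppr_le0.
  by rewrite dot_service_normal lerB// mumax// ssvalP.
by rewrite sumr_const cardsT -[leLHS]mulr_natr ler_wpM2l// ler_nat.
Qed.

End ErrorBound.

(** * Lyapunov drift *)

Section Drift.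
Variables (R : realType) (n : nat) (Rm : 'M[R]_n) (S : seq 'cV[R]_n) (w lam : 'cV[R]_n).
Hypotheses (net : network_ok Rm S) (w_gt0 : pos_weights w).
Implicit Types (m mu nu p q x : 'cV[R]_n) (A Q : nat -> 'cV[R]_n).
Local Notation K := (inv_cone Rm S w lam).
Local Notation v := (veloc Rm lam).

Definition max_service : R := \big[Num.max/0]_(mu <- S) norm2 mu.

Definition max_speed : R := \big[Num.max/0]_(mu <- S) norm2 (v mu).

Lemma max_service_ge0 : 0 <= max_service.
Proof. exact: bigmax_ge_id. Qed.

Lemma max_speed_ge0 : 0 <= max_speed.
Proof. exact: bigmax_ge_id. Qed.

Lemma service_le_max mu i : mu \in S -> mu i 0 <= max_service.
Proof.
move=> muS; apply: le_trans (ler_norm _) (le_trans (coord_le_norm2 mu i) _).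
exact: (le_bigmax_seq 0 mu).
Qed.

Lemma veloc_mixture s : convex_weights S s ->
  v (mixture S s) = \sum_(mu <- undup S) s mu *: v mu.
Proof.
move=> [_ s1]; under eq_bigr do rewrite scalerBr scalemxAr.
by rewrite sumrB -scaler_suml s1 scale1r -mulmx_sumr.
Qed.

Lemma hull_speed_le m : hull S m -> norm2 (v m) <= max_speed.
Proof.
move=> [s cs <-]; rewrite veloc_mixture//; apply: le_trans (norm2_sum _ _) _.
rewrite -(convex_sum_cst max_speed cs); under eq_bigr do rewrite norm2Z ger0_norm ?cs.1//.
by apply: convex_sum_le => // mu muS _; exact: (le_bigmax_seq 0 mu).
Qed.

Lemma veloc_qstep mu q a : qstep Rm q a mu = q + (a - lam) + v (cmin mu q).
Proof. by rewrite /qstep -(opprB 1%:M Rm) mulNmx /veloc addrA -[in RHS](addrA q) subrK. Qed.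

Lemma unmet_service_le mu q i : mu \in S -> nonneg q ->
  q i 0 * (mu - cmin mu q) i 0 <= max_service ^+ 2.
Proof.
move=> muS q0; rewrite !mxE; have := service_le_max i muS.
move: (q0 i) (net.2.1 _ muS i) max_service_ge0.
move: (q i 0) (mu i 0) max_service => b c d b0 c0 d0 cd.
by case: (leP c b) => cb; rewrite ?subrr ?mulr0 ?sqr_ge0//; nra.
Qed.

Lemma drift_dot mu q p : wmw_choice Rm S w q mu -> nonneg q -> K p ->
  dotw w (v (cmin mu q)) (q - p) <=
  - (wobj Rm w q mu - dotw w q lam) + sum_weight w * max_service ^+ 2.
Proof.
move=> [muS _] q0 [p0 pS].
have p_le := hull_wobj_le pS (cmin_hull net muS q0).
have q_le : wobj Rm w q (mu - cmin mu q) <= sum_weight w * max_service ^+ 2.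
  rewrite wobjE mulmxBl mul1mx dotwBr.
  have : 0 <= dotw w q (Rm *m (mu - cmin mu q)).
    apply: dotw_ge0 => //; first exact: pos_weights_nonneg.
    by apply: (routing_nonneg net) => i; rewrite !mxE subr_ge0 ge_min lexx.
  suff : dotw w q (mu - cmin mu q) <= sum_weight w * max_service ^+ 2 by lra.
  apply: (@le_trans _ _ (\sum_i w i 0 * max_service ^+ 2)).
    by apply: ler_sum => i _; rewrite -mulrA ler_pM2l// unmet_service_le.
  by rewrite -mulr_suml ler_wpM2r ?sqr_ge0// lerDr.
move: q_le; rewrite wobjBr /veloc dotwBr !dotwBl ![dotw w (_ *m _) _]dotwC -!wobjE.
rewrite ![dotw w lam _]dotwC; lra.
Qed.

Definition cumdev A k : 'cV[R]_n := \sum_(t < k) (A t - lam).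

Definition quiet A k (e : R) : Prop := forall l, (l <= k)%N -> norm2 (cumdev A l) <= e.

Definition wmw_queue A Q : Prop := wmw_path Rm S w A Q /\ forall t, nonneg (Q t).

Definition deviation_gain : R := 2 * sum_weight w * max_speed.

Definition step_cost : R := sum_weight w * (2 * max_service ^+ 2 + max_speed ^+ 2).

Lemma deviation_gain_ge0 : 0 <= deviation_gain.
Proof. by rewrite !mulr_ge0 ?max_speed_ge0 ?(ltW (sum_weight_gt0 w_gt0)). Qed.

Lemma step_cost_ge0 : 0 <= step_cost.
Proof.
apply: mulr_ge0; first exact/ltW/sum_weight_gt0.
by rewrite addr_ge0 ?mulr_ge0 ?max_service_ge0 ?max_speed_ge0.
Qed.

Section LyapunovFunction.
Variable c : R.
Hypothesis err : error_bound Rm S w lam c.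
Variables (A Q : nat -> 'cV[R]_n) (p : 'cV[R]_n).
Hypotheses (queue : wmw_queue A Q) (Kp : K p).
(* Subtracting the cumulative fluctuation leaves a process driven by the
   velocities only. *)
Local Notation z k := (Q k - cumdev A k - p).

Lemma lyapunov_step k : dotw w (z k.+1) (z k.+1) <= dotw w (z k) (z k)
  - 2 * c * dist_set (Q k) K + deviation_gain * norm2 (cumdev A k) + step_cost.
Proof.
have [path /(_ k) Q0] := queue; have [mu [choice_mu QE]] := path k.
set u := cumdev A k; set vk := v (cmin mu (Q k)).
have -> : z k.+1 = z k + vk.
  rewrite /cumdev big_ord_recr /= -/u QE veloc_qstep -/vk.
  by apply/colP => i; rewrite !mxE; ring.
have speed : norm2 vk <= max_speed.
  by apply: hull_speed_le; apply: (cmin_hull net) => //; exact: choice_mu.1.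
have W0 := sum_weight_gt0 w_gt0.
have zv : dotw w (z k) vk = dotw w vk (Q k - p) - dotw w vk u.
  by rewrite -dotwBr dotwC (addrAC (Q k)).
have uv : - dotw w vk u <= sum_weight w * max_speed * norm2 u.
  have := normr_dotw_le w_gt0 vk u; rewrite ler_norml => /andP[uv _].
  by rewrite lerNl (le_trans _ uv)// lerN2 ler_wpM2r ?norm2_ge0// ler_pM2l.
have vv : dotw w vk vk <= sum_weight w * max_speed ^+ 2.
  apply: le_trans (dotw_le_norm2 w_gt0 _) _.
  by rewrite ler_pM2l// ler_pXn2r ?nnegrE ?norm2_ge0// max_speed_ge0.
have := drift_dot choice_mu Q0 Kp; have := err Q0 choice_mu.
rewrite dotw_sqrD zv -/vk /deviation_gain /step_cost; lra.
Qed.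

Lemma lyapunov_sum k (a : R) : quiet A k a ->
  dotw w (z k) (z k) + 2 * c * (\sum_(l < k) dist_set (Q l) K) <=
  dotw w (Q 0%N - p) (Q 0%N - p) + k%:R * (deviation_gain * a + step_cost).
Proof.
elim: k => [|k IH] quietA.
  by rewrite /cumdev !big_ord0 !subr0 mulr0 mul0r addr0.
have := lyapunov_step k; have {}IH := IH (fun l lk => quietA l (leqW lk)).
have : deviation_gain * norm2 (cumdev A k) <= deviation_gain * a.
  by rewrite ler_wpM2l ?deviation_gain_ge0// quietA.
rewrite big_ord_recr /= -natr1 mulrDl mul1r; lra.
Qed.

End LyapunovFunction.

Lemma window_energy c A Q k (a : R) :
  error_bound Rm S w lam c ->
  wmw_queue A Q -> quiet A k a ->
  exists2 z : R, 0 <= z /\ dist_set (Q k) K <= z + a &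
    min_weight w * z ^+ 2 + 2 * c * (\sum_(l < k) dist_set (Q l) K) <=
    sum_weight w * dist_set (Q 0%N) K ^+ 2 + k%:R * (deviation_gain * a + step_cost).
Proof.
move=> err queue quietA.
have [p Kp <-] : exists2 p, K p & norm2 (Q 0%N - p) = dist_set (Q 0%N) K.
  by apply: dist_set_attained; [exact: inv_cone_closed|exact: inv_cone_neq0].
exists (norm2 (Q k - cumdev A k - p)).
  split; first exact: norm2_ge0.
  apply: le_trans (dist_set_le _ Kp) _.
  rewrite -{1}(subrK (cumdev A k) (Q k)) addrAC (le_trans (norm2D _ _))// lerD2l.
  exact: quietA.
apply: le_trans (le_trans (lyapunov_sum err queue Kp quietA) _).
  by rewrite lerD2r norm2_le_dotw.
by rewrite lerD2r dotw_le_norm2.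
Qed.

End Drift.

(** * Windows of [r] steps *)

Section After.
Variables (R : realType) (n : nat) (Rm : 'M[R]_n) (S : seq 'cV[R]_n) (w lam : 'cV[R]_n).
Implicit Types A Q : nat -> 'cV[R]_n.

Definition after (V : Type) s (A : nat -> V) : nat -> V := fun t => A (s + t)%N.

Lemma cumdev_after A s k : cumdev lam (after s A) k = cumdev lam A (s + k) - cumdev lam A s.
Proof. by rewrite /cumdev [X in _ = X - _]big_split_ord addrAC subrr add0r. Qed.

Lemma quiet_after A s k l e : quiet lam A l e -> (s + k <= l)%N ->
  quiet lam (after s A) k (2 * e).
Proof.
move=> quietA skl j jk; rewrite cumdev_after (le_trans (norm2D _ _))// norm2N mulrDl mul1r.
by rewrite lerD ?quietA// ?(leq_trans _ skl)// ?leq_add2l// leq_addr.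
Qed.

Lemma wmw_path_after A Q s : wmw_path Rm S w A Q -> wmw_path Rm S w (after s A) (after s Q).
Proof. by move=> path t; have := path (s + t)%N; rewrite /after addnS. Qed.

Lemma wmw_queue_after A Q s : wmw_queue Rm S w A Q ->
  wmw_queue Rm S w (after s A) (after s Q).
Proof. by move=> [path Q0]; split=> [|t]; [exact: wmw_path_after|exact: Q0]. Qed.

End After.

Section Windows.
Variables (R : realType) (n : nat) (Rm : 'M[R]_n) (S : seq 'cV[R]_n) (w lam : 'cV[R]_n).
Hypotheses (net : network_ok Rm S) (w_gt0 : pos_weights w) (sus : sustainable Rm S lam).
Local Notation K := (inv_cone Rm S w lam).
Local Notation M := (deviation_gain Rm S w lam).
Local Notation B := (step_cost Rm S w lam).
Let M_ge0 : 0 <= M := deviation_gain_ge0 Rm S lam w_gt0.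
Let B_ge0 : 0 <= B := step_cost_ge0 Rm S lam w_gt0.

Lemma window_noise (b : R) : 0 < b -> exists2 e : R, 0 < e &
  \forall r \near \oo, forall k (a : R), (k <= r)%N -> 0 <= a <= e * r%:R ->
    k%:R * (M * a + B) <= b * r%:R ^+ 2.
Proof.
move=> b0; have b2 : 0 < b / 2 by rewrite divr_gt0.
have M1 : 0 < M + 1 by rewrite ltr_wpDl.
exists (b / 2 / (M + 1)); first by rewrite divr_gt0.
near=> r => k a kr /andP[a0 ar].
have : B / (b / 2) <= r%:R by near: r; exact: nbhs_infty_ger.
rewrite ler_pdivrMr// => Br.
have Me : M * (b / 2 / (M + 1)) <= b / 2.
  by rewrite mulrCA ler_piMr ?(ltW b2)// ler_pdivrMr// mul1r lerDl.
have MaB : M * a + B <= b * r%:R.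
  have : M * a <= M * (b / 2 / (M + 1) * r%:R) by rewrite ler_wpM2l.
  have : M * (b / 2 / (M + 1)) * r%:R <= b / 2 * r%:R by rewrite ler_wpM2r.
  rewrite -mulrA; lra.
apply: (@le_trans _ _ (r%:R * (M * a + B))).
  by rewrite ler_wpM2r ?ler_nat// addr_ge0// (mulr_ge0 M_ge0).
by rewrite expr2 mulrCA ler_wpM2l.
Unshelve. all: end_near. Qed.

Lemma window_stay : exists2 s : R, 0 < s <= 1 & forall th, 0 < th ->
  exists2 e : R, 0 < e & \forall r \near \oo, forall A Q k, wmw_queue Rm S w A Q ->
    (k <= r)%N -> dist_set (Q 0%N) K <= s * th * r%:R -> quiet lam A k (e * r%:R) ->
    dist_set (Q k) K <= th * r%:R.
Proof.
have wm := min_weight_gt0 w_gt0; have ws := sum_weight_gt0 w_gt0.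
pose s := Num.min 1 (min_weight w / (8 * sum_weight w)).
have s0 : 0 < s by rewrite lt_min ltr01 divr_gt0// mulr_gt0.
have s1 : s <= 1 by rewrite ge_min lexx.
exists s => [|th th0]; first by rewrite s0.
have sw : sum_weight w * s ^+ 2 <= min_weight w / 8.
  have : s <= min_weight w / (8 * sum_weight w) by rewrite ge_min lexx orbT.
  have : s ^+ 2 <= s by rewrite expr2 ler_piMr// ltW.
  rewrite -(ler_pM2l ws) ler_pdivlMr ?mulr_gt0//; lra.
have b0 : 0 < min_weight w * th ^+ 2 / 8 by rewrite divr_gt0// mulr_gt0// exprn_gt0.
have [e e0 noise] := window_noise b0.
exists (Num.min e (th / 2)) => [|]; first by rewrite lt_min e0 divr_gt0.
have [c c0 err] := inv_cone_error_bound w sus.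
near=> r => A Q k queue kr dQ0 quietA; set a := _ * r%:R in quietA.
have a0 : 0 <= a by apply: le_trans (norm2_ge0 _) (quietA 0%N (leq0n k)).
have ae : a <= e * r%:R by rewrite ler_wpM2r// ge_min lexx.
have ath : a <= th / 2 * r%:R by rewrite ler_wpM2r// ge_min lexx orbT.
have [z [z0 dQk] energy] := window_energy net w_gt0 err queue quietA.
suff : z <= th / 2 * r%:R by lra.
have sum_ge0 : 0 <= 2 * c * \sum_(l < k) dist_set (Q l) K.
  by rewrite !mulr_ge0 ?(ltW c0)//; apply: sumr_ge0 => l _; exact: dist_set_ge0.
have start : sum_weight w * dist_set (Q 0%N) K ^+ 2 <= min_weight w / 8 * (th * r%:R) ^+ 2.
  apply: (@le_trans _ _ (sum_weight w * s ^+ 2 * (th * r%:R) ^+ 2)).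
    rewrite -mulrA ler_pM2l// -exprMn mulrA.
    by rewrite ler_pXn2r ?nnegrE ?dist_set_ge0// !mulr_ge0// ltW.
  by rewrite ler_wpM2r ?sqr_ge0.
have thr0 : 0 <= th / 2 * r%:R by rewrite mulr_ge0// divr_ge0// ltW.
have cost : k%:R * (M * a + B) <= min_weight w * th ^+ 2 / 8 * r%:R ^+ 2.
  by apply: (near noise r); rewrite ?a0.
rewrite -(@ler_pXn2r _ 2%N) ?nnegrE// -(ler_pM2l wm).
rewrite !exprMn in start *; lra.
Unshelve. all: end_near. Qed.

Lemma window_visit (s : R) : 0 < s -> exists2 th0 : R, 0 < th0 &
  forall th, 0 < th <= th0 -> exists2 e : R, 0 < e &
  \forall r \near \oo, forall A Q, wmw_queue Rm S w A Q ->
    dist_set (Q 0%N) K <= th * r%:R -> quiet lam A r (e * r%:R) ->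
    exists2 k, (k < r)%N & dist_set (Q k) K <= s * th * r%:R.
Proof.
move=> s0; have wm := min_weight_gt0 w_gt0; have ws := sum_weight_gt0 w_gt0.
have [c c0 err] := inv_cone_error_bound w sus.
exists (c * s / (2 * sum_weight w)) => [|th /andP[th0]]; first by rewrite divr_gt0 ?mulr_gt0.
rewrite ler_pdivlMr ?mulr_gt0// => thc.
have b0 : 0 < c * s * th / 2 by rewrite divr_gt0// !mulr_gt0.
have [e e0 noise] := window_noise b0; exists e => //.
near=> r => A Q queue dQ0 quietA; apply: contrapT => never.
have r0 : 0 < r%:R :> R by rewrite ltr0n; near: r; exact: nbhs_infty_gt.
have [z _ energy] := window_energy net w_gt0 err queue quietA.
have total : r%:R * (s * th * r%:R) <= \sum_(l < r) dist_set (Q l) K.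
  rewrite mulr_natl -[X in _ *+ X]card_ord -sumr_const; apply: ler_sum => l _.
  by rewrite ltW// ltNge; apply/negP => dQl; apply: never; exists l.
have start : sum_weight w * dist_set (Q 0%N) K ^+ 2 <= c * s * th / 2 * r%:R ^+ 2.
  apply: (@le_trans _ _ (sum_weight w * (th * r%:R) ^+ 2)).
    by rewrite ler_pM2l// ler_pXn2r ?nnegrE ?dist_set_ge0// mulr_ge0// ltW.
  rewrite exprMn mulrA ler_wpM2r ?sqr_ge0//; nra.
have cost : r%:R * (M * (e * r%:R) + B) <= c * s * th / 2 * r%:R ^+ 2.
  by apply: (near noise r) => //; rewrite ?lexx ?mulr_ge0// ltW.
have := mulr_ge0 (ltW wm) (sqr_ge0 z).
have : 2 * c * (r%:R * (s * th * r%:R)) <= 2 * c * \sum_(l < r) dist_set (Q l) K.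
  by rewrite ler_pM2l// mulr_gt0.
have : 0 < c * s * th * r%:R ^+ 2 by rewrite !mulr_gt0.
rewrite !expr2 in energy start cost *; lra.
Unshelve. all: end_near. Qed.

Lemma window_return (delta : R) : 0 < delta -> exists2 th : R, 0 < th &
  exists2 e : R, 0 < e & \forall r \near \oo, forall A Q, wmw_queue Rm S w A Q ->
    dist_set (Q 0%N) K <= th * r%:R -> quiet lam A r (e * r%:R) ->
    (forall k, (k <= r)%N -> dist_set (Q k) K <= delta * r%:R) /\
    dist_set (Q r) K <= th * r%:R.
Proof.
move=> delta0; have [s /andP[s0 s1] stay] := window_stay.
have [th0 th00 visit] := window_visit s0.
pose th := Num.min (s * delta) th0.
have th_gt0 : 0 < th by rewrite lt_min mulr_gt0.
have [e_stay e_stay0 stay_delta] := stay delta delta0.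
have [e_end e_end0 stay_th] := stay th th_gt0.
have [|e_visit e_visit0 visit_th] := visit th; first by rewrite th_gt0 ge_min lexx orbT.
exists th => //; exists (Num.min e_stay (Num.min (e_end / 2) e_visit)).
  by rewrite !lt_min e_stay0 e_visit0 divr_gt0.
near=> r => A Q queue dQ0 quietA.
have quietW e k : Num.min e_stay (Num.min (e_end / 2) e_visit) <= e -> (k <= r)%N ->
    quiet lam A k (e * r%:R).
  move=> le_e kr l lk; apply: le_trans (quietA l (leq_trans lk kr)) _.
  by rewrite ler_wpM2r.
split=> [k kr|].
  apply: (near stay_delta r _ A) => //; last by apply: quietW; rewrite // ge_min lexx.
  by rewrite (le_trans dQ0)// ler_wpM2r// ge_min lexx.
have [//||k kr dQk] := near visit_th r _ A Q queue dQ0.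
  by apply: quietW; rewrite // !ge_min lexx !orbT.
have -> : Q r = after k Q (r - k)%N by rewrite /after subnKC// ltnW.
apply: (near stay_th r _ (after k A)); first by [].
- exact: wmw_queue_after.
- exact: leq_subr.
- by rewrite /after addn0.
rewrite -(divfK (_ : 2 != 0) e_end) ?pnatr_eq0// (mulrC (e_end / 2)) -mulrA.
apply: quiet_after (quietW (e_end / 2) r _ _) _ => //; first by rewrite !ge_min lexx orbT.
by rewrite subnKC// ltnW.
Unshelve. all: end_near. Qed.

End Windows.

(** * Existence of fluid solutions under MaxWeight *)

Section AffineExit.
Variables (R : realType) (T : finType) (a b : T -> R).

Lemma affine_exit : (forall j, 0 <= a j) -> (forall j, a j = 0 -> 0 <= b j) ->
  (forall j, 0 <= b j) \/ exists2 t : R, 0 < t &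
    (forall s j, 0 <= s <= t -> 0 <= a j + s * b j) /\
    exists2 j, a j + t * b j = 0 & b j < 0.
Proof.
move=> a0 ab.
have [b0|/existsNP[j0 /negP]] := pselect (forall j, 0 <= b j); first by left.
rewrite -ltNge => bj0; right.
case: (@Order.TotalTheory.arg_minP _ _ _ j0 (fun j => b j < 0) (fun j => a j / (- b j)) bj0).
move=> j bj jmin; exists (a j / (- b j)).
  rewrite divr_gt0 ?oppr_gt0// lt0r a0 andbT; apply/negP => /eqP/ab.
  by rewrite leNgt bj.
split=> [s k /andP[s0 sj]|].
  have [bk|bk] := leP 0 (b k); first by rewrite addr_ge0// mulr_ge0.
  have := le_trans sj (jmin k bk); rewrite ler_pdivlMr ?oppr_gt0//; lra.
by exists j => //; rewrite invrN mulrN mulNr divfK ?subrr// lt_eqF.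
Qed.

End AffineExit.

Section Faces.
Variables (R : realType) (n : nat) (Rm : 'M[R]_n) (S : seq 'cV[R]_n) (w lam : 'cV[R]_n).
Implicit Types (m nu q u : 'cV[R]_n).
Local Notation v := (veloc Rm lam).

Definition face_slack m q (j : 'I_n + seq_sub S) : R :=
  match j with inl i => q i 0 | inr nu => wobj Rm w q (m - val nu) end.

Definition face m : set 'cV[R]_n := [set q | forall j, 0 <= face_slack m q j].

Lemma face_slack_line m q u t j :
  face_slack m (q + t *: u) j = face_slack m q j + t * face_slack m u j.
Proof. by case: j => [i|nu] /=; rewrite ?wobjDl ?wobjZl// mxE [X in _ + X]mxE. Qed.

Lemma faceP m q : hull S m ->
  face m q <-> nonneg q /\ hull (optimal_services Rm S w q) m.
Proof.
move=> hm; split=> [mq|[q0 /hull_optimalP[_ mmax]] [i|nu]] /=; last first.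
- by rewrite wobjBr subr_ge0 mmax// ssvalP.
- exact: q0.
split=> [i|]; first exact: (mq (inl i)).
apply/hull_optimalP; split=> // nu nuS.
by have := mq (inr (SeqSub nuS)); rewrite /= wobjBr subr_ge0.
Qed.

Lemma line_shift q u s t : q + t *: u = (q + s *: u) + (t - s) *: u.
Proof. by rewrite -addrA -scalerDl (addrC s) subrK. Qed.

Lemma norm2_line q u s t : norm2 ((q + t *: u) - (q + s *: u)) = norm2 u * `|t - s|.
Proof. by rewrite (line_shift q u s) addrAC subrr add0r norm2Z mulrC. Qed.

Lemma pl_fluid_ray q m : hull S m -> (forall t, 0 <= t -> face m (q + t *: v m)) ->
  pl_fluid Rm S w lam (fun t => q + t *: v m).
Proof.
move=> hm mt; split; first by move=> t /mt/(faceP _ hm)[].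
  by exists (norm2 (v m)) => [|s t]; rewrite ?norm2_ge0// norm2_line.
exists [::] => t /ltW/mt/(faceP _ hm)[_ opt] _; exists m => //.
by apply: (@nearW _ (nbhs t)) => u; exact: line_shift.
Qed.

Lemma pl_fluid_cons q m (T : R) (q' : R -> 'cV[R]_n) : 0 < T -> hull S m ->
  (forall t, 0 <= t <= T -> face m (q + t *: v m)) ->
  pl_fluid Rm S w lam q' -> q' 0 = q + T *: v m ->
  pl_fluid Rm S w lam (fun t => if t <= T then q + t *: v m else q' (t - T)).
Proof.
move=> T0 hm mt [q'0 [c c0 q'lip] [E q'E]] q'T; split.
- move=> t t0; case: leP => tT; last by apply: q'0; rewrite subr_ge0 ltW.
  by have /(faceP _ hm)[] : face m (q + t *: v m) by apply: mt; rewrite t0.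
- exists (norm2 (v m) + c) => [|s t]; first by rewrite addr_ge0 ?norm2_ge0.
  wlog st : s t / s <= t.
    by move=> sorted; have [/sorted//|/ltW/sorted] := leP s t; rewrite norm2_distC distrC.
  rewrite ger0_norm ?subr_ge0// mulrDl.
  have v0 := norm2_ge0 (v m).
  case: (leP t T) => tT; case: (leP s T) => sT.
  + by rewrite norm2_line ger0_norm ?subr_ge0// lerDl mulr_ge0// subr_ge0.
  + by have := le_lt_trans (le_trans st tT) sT; rewrite ltxx.
  + have := norm2_triangle (q' (t - T)) (q' 0) (q + s *: v m).
    have := q'lip 0 (t - T); rewrite subr0 gtr0_norm ?subr_gt0// q'T.
    rewrite norm2_line ger0_norm ?subr_ge0// => lip /le_trans; apply.
    have := ltW tT; nra.
  + have := q'lip (s - T) (t - T); rewrite opprB addrA subrK => lip.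
    by rewrite (le_trans lip)// ger0_norm ?subr_ge0// lerDr mulr_ge0 ?subr_ge0.
- exists (T :: [seq x + T | x <- E]) => t t0; rewrite inE negb_or => /andP[tT tE].
  case: leP => [leT|gtT].
    have {tT leT} ltT : t < T by rewrite lt_neqAle tT.
    have /(faceP _ hm)[_ opt] : face m (q + t *: v m) by apply: mt; rewrite !ltW.
    exists m => //; near=> u; have -> : u <= T by apply/ltW; near: u; exact: lt_nbhsl.
    exact: line_shift.
  have tT0 : 0 < t - T by rewrite subr_gt0.
  have [|m' opt' q'near] := q'E _ tT0.
    by apply: contra tE => tE; apply/mapP; exists (t - T) => //; rewrite subrK.
  have shiftT : (u - T) @[u --> t] --> t - T by apply: cvgB; [exact: cvg_id|exact: cvg_cst].
  exists m' => //; near=> u; have -> : (u <= T) = false.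
    by apply/negbTE; rewrite -ltNge; near: u; exact: lt_nbhsr.
  have -> : u - t = u - T - (t - T) by ring.
  by near: u; exact: shiftT q'near.
Unshelve. all: end_near. Qed.

End Faces.

Section LeastSpeed.
Variables (R : realType) (n : nat) (Rm : 'M[R]_n) (S : seq 'cV[R]_n) (lam : 'cV[R]_n).
Hypotheses (net : network_ok Rm S) (lam0 : nonneg lam) (S0 : S != [::]).
Implicit Types (m nu q y : 'cV[R]_n) (L : seq 'cV[R]_n).
Local Notation MW := (ones R n).
Local Notation v := (veloc Rm lam).
Local Notation optimal := (optimal_services Rm S MW).

Definition speed L : R := dist_set lam [set (1%:M - Rm) *m m | m in hull L].

Definition min_speed L m : Prop := hull L m /\ norm2 (v m) = speed L.

Lemma ones_gt0 : pos_weights MW.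
Proof. by move=> i; rewrite mxE. Qed.

Lemma speed_le L m : hull L m -> speed L <= norm2 (v m).
Proof. by move=> hm; apply: dist_set_le; exists m. Qed.

Lemma min_speed_exists L : L != [::] -> exists m, min_speed L m.
Proof.
move=> L0; have hull0 : [set (1%:M - Rm) *m m | m in hull L] !=set0.
  case: L L0 => // mu L _; exists ((1%:M - Rm) *m mu), mu => //.
  by apply: hull_mem; exact: mem_head.
have [|_ [m hm <-] mE] := dist_set_attained lam _ hull0; last by exists m.
apply: compact_closed; first exact: norm_hausdorff.
apply: continuous_compact; last exact: hull_compact.
by apply: continuous_subspaceT; exact: mulmx_continuous.
Qed.

Lemma min_speed_wobj_le L m m' : min_speed L m -> hull L m' ->
  wobj Rm MW (v m) m' <= wobj Rm MW (v m) m.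
Proof.
move=> [hm vm] hm'; rewrite -subr_le0 -wobjBr wobjE.
apply: (dot_le0_of_norm2_min ltr01) => t /andP[t0 t1].
rewrite vm (_ : v m - _ = v (t *: m' + (1 - t) *: m)).
  by apply/speed_le/hull_conv => //; rewrite ltW.
rewrite /veloc -addrA -opprD scalemxAr -mulmxDr; congr (_ - _ *m _).
by apply/colP => i; rewrite !mxE; ring.
Qed.

Lemma min_speed_tight q m nu : min_speed (optimal q) m -> nu \in S ->
  wobj Rm MW q (m - nu) = 0 -> 0 <= wobj Rm MW (v m) (m - nu).
Proof.
move=> mm nuS /eqP; rewrite !wobjBr subr_eq0 subr_ge0 => /eqP nuE.
have [_ mmax] := (hull_optimalP _ _ _ _ _).1 mm.1.
apply: (min_speed_wobj_le mm); apply/hull_optimalP.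
by split; [exact: hull_mem|rewrite -nuE].
Qed.

Definition idle_service q m : 'cV[R]_n :=
  \col_j if (q j 0 == 0) && (v m j 0 < 0) then m j 0 else 0.

Lemma idle_service_nonneg q m : hull S m -> nonneg (idle_service q m).
Proof. by move=> /(hull_nonneg net) m0 j; rewrite mxE; case: ifP. Qed.

Lemma routing_idle_le q m j : hull S m ->
  0 <= (Rm *m idle_service q m) j 0 <= (Rm *m m) j 0.
Proof.
move=> hm; rewrite (routing_nonneg net (idle_service_nonneg q hm)) -subr_ge0 /=.
have -> : (Rm *m m) j 0 - (Rm *m idle_service q m) j 0 = (Rm *m (m - idle_service q m)) j 0.
  by rewrite mulmxBr [RHS]mxE [X in _ = _ + X]mxE.
apply: (routing_nonneg net) => k; rewrite !mxE.
by case: ifP; rewrite ?subrr// subr0 (hull_nonneg net hm).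
Qed.

Lemma idle_service_unused q m j : 0 < q j 0 -> idle_service q m j 0 = 0.
Proof. by move=> qj; rewrite mxE gt_eqF. Qed.

Lemma idle_service_optimal q m : nonneg q -> hull (optimal q) m ->
  hull (optimal q) (m - idle_service q m).
Proof.
move=> q0 /hull_optimalP[hm mmax]; apply/hull_optimalP; split=> [|nu /mmax].
  apply: (hull_le net hm) => j; rewrite !mxE.
  by case: ifP => _; rewrite ?subrr ?subr0 ?lexx (hull_nonneg net hm).
move=> /le_trans; apply; rewrite wobjBr lerBrDr gerDl.
apply: (wobj_unserved_le0 net) => //; first exact/pos_weights_nonneg/ones_gt0.
  exact: idle_service_nonneg.
by move=> j; exact: idle_service_unused.
Qed.

Lemma routing_idle_eq0 q m j : nonneg q -> hull (optimal q) m -> q j 0 != 0 ->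
  (Rm *m idle_service q m) j 0 = 0.
Proof.
move=> q0 hm qj; have [hSm mmax] := (hull_optimalP _ _ _ _ _).1 hm.
have routing0 : nonneg (Rm *m idle_service q m).
  exact/(routing_nonneg net)/idle_service_nonneg.
have : wobj Rm MW q (m - idle_service q m) <= wobj Rm MW q m.
  apply: (hull_wobj_le mmax).
  by have [] := (hull_optimalP _ _ _ _ _).1 (idle_service_optimal q0 hm).
have MW0 : nonneg MW := pos_weights_nonneg ones_gt0.
have unused k : 0 < q k 0 -> idle_service q m k 0 = 0 by exact: idle_service_unused.
rewrite wobjBr (wobj_unserved Rm MW0 q0 (idle_service_nonneg q hSm) unused) opprK.
rewrite gerDl dotE => sum_le0; have := qj.
have : \sum_k q k 0 * (Rm *m idle_service q m) k 0 == 0.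
  by rewrite eq_le sum_le0 sumr_ge0// => k _; rewrite mulr_ge0.
rewrite psumr_eq0 => [/allP/(_ j (mem_index_enum _))|k _]; last by rewrite mulr_ge0.
by rewrite /= mulf_eq0 => /predU1P[->|/eqP//]; rewrite eqxx.
Qed.

(* Where the queue is empty the least-speed velocity points inward: otherwise
   withdrawing the idle service would keep the service optimal and reduce the
   speed. *)
Lemma min_speed_inward q m i : nonneg q -> min_speed (optimal q) m ->
  q i 0 = 0 -> 0 <= v m i 0.
Proof.
move=> q0 mm qi; rewrite leNgt; apply/negP => vi.
have [hm _] := mm; have [hSm _] := (hull_optimalP _ _ _ _ _).1 hm.
set y := idle_service q m.
have := min_speed_wobj_le mm (idle_service_optimal q0 hm).
rewrite -subr_ge0 -wobjBr opprB addrC subrK wobjE dotE; apply/negP; rewrite -ltNge.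
have gainE j : ((1%:M - Rm) *m y) j 0 = y j 0 - (Rm *m y) j 0.
  by rewrite mulmxBl mul1mx mxE [X in _ + X]mxE.
have velE j : v m j 0 = lam j 0 - m j 0 + (Rm *m m) j 0.
  by rewrite /veloc mulmxBl mul1mx !mxE; ring.
have decr j : q j 0 = 0 -> v m j 0 < 0 -> v m j 0 * ((1%:M - Rm) *m y) j 0 < 0.
  move=> qj vj; rewrite nmulr_rlt0// gainE [y j 0]mxE qj eqxx vj /=.
  have /andP[_] := routing_idle_le q j hSm; have := lam0 j.
  by move: vj; rewrite velE; lra.
rewrite (bigD1 i)//= -[ltRHS]addr0 ltr_leD ?decr//; apply: sumr_le0 => j _.
have [qj|qj] := eqVneq (q j 0) 0; last first.
  have qj0 : 0 < q j 0 by rewrite lt0r qj q0.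
  by rewrite gainE [y j 0]idle_service_unused// routing_idle_eq0// subrr mulr0.
have [vj|vj] := leP 0 (v m j 0); last by rewrite ltW// decr.
rewrite mulr_ge0_le0// gainE [y j 0]mxE ltNge vj andbF sub0r oppr_le0.
by have /andP[] := routing_idle_le q j hSm.
Qed.

Lemma face_exit q m : nonneg q -> min_speed (optimal q) m ->
  (forall t, 0 <= t -> face Rm S MW m (q + t *: v m)) \/
  exists2 T : R, 0 < T & (forall t, 0 <= t <= T -> face Rm S MW m (q + t *: v m)) /\
    speed (optimal (q + T *: v m)) < speed (optimal q).
Proof.
move=> q0 mm; have [hm vm] := mm; have [hSm mmax] := (hull_optimalP _ _ _ _ _).1 hm.
have face0 : face Rm S MW m q by apply/faceP.
have inward (j : 'I_n + seq_sub S) p : nonneg p -> min_speed (optimal p) m ->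
    face_slack Rm MW m p j = 0 -> 0 <= face_slack Rm MW m (v m) j.
  case: j => [i|nu] p0 mp; first exact: min_speed_inward.
  exact: (min_speed_tight mp (ssvalP nu)).
have slackE t j := face_slack_line Rm MW m q (v m) t j.
have [v0|[T T0 [faceT [j jT vj]]]] := affine_exit face0 (fun j => inward j q q0 mm).
  by left=> t t0 j; rewrite slackE addr_ge0// mulr_ge0.
right; exists T => //; split=> [t tT j'|]; first by rewrite slackE faceT.
have [qT0 hmT] : nonneg (q + T *: v m) /\ hull (optimal (q + T *: v m)) m.
  by apply/faceP => // j'; rewrite slackE faceT// lexx (ltW T0).
rewrite lt_neqAle -vm speed_le// andbT; apply/eqP => speedT.
have := inward j _ qT0 (conj hmT (esym speedT)); rewrite slackE jT leNgt vj.
by move=> /(_ erefl).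
Qed.

(* The speed takes finitely many values, one per subset of services, and it
   decreases each time the trajectory leaves a face. *)
Lemma pl_fluid_exists q0 : nonneg q0 -> exists2 q, pl_fluid Rm S MW lam q & q 0 = q0.
Proof.
pose rank (x : R) := #|[set b : (size S).-tuple bool | speed (mask b S) < x]%SET|.
have [k] := ubnP (rank (speed (optimal q0))); elim: k q0 => // k IH q0 rank_k q00.
have [m mm] := min_speed_exists (optimal_services_neq0 Rm MW q0 S0).
have [hm _] := (hull_optimalP _ _ _ _ _).1 mm.1.
have [ray|[T T0 [segment slower]]] := face_exit q00 mm.
  exists (fun t => q0 + t *: v m); last by rewrite scale0r addr0.
  exact: pl_fluid_ray.
have [||q' plq' q'T] := IH (q0 + T *: v m).
- rewrite -ltnS (leq_trans _ rank_k)// ltnS; apply: proper_card; apply/properP; split.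
    by apply/fintype.subsetP => b; rewrite !inE => /lt_trans; exact.
  exists (map_tuple (fun mu => `[< wmw_choice Rm S MW (q0 + T *: v m) mu >]) (in_tuple S)).
    by rewrite !inE /= -filter_mask.
  by rewrite inE /= -filter_mask ltxx.
- by have [] := (faceP _ _ _ hm).1 (segment T _); rewrite ?lexx ?(ltW T0).
exists (fun t => if t <= T then q0 + t *: v m else q' (t - T)).
  exact: pl_fluid_cons.
by rewrite (ltW T0) scale0r addr0.
Qed.

End LeastSpeed.

Section DiniDerivative.
Variable R : realType.
Implicit Types (phi psi : R -> R) (a b t alpha : R).

Lemma right_invariant_le0 psi a b : a <= b -> continuous psi -> psi a <= 0 ->
  (forall u, a <= u < b -> psi u <= 0 -> \forall h \near 0^'+, psi (u + h) <= 0) ->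
  psi b <= 0.
Proof.
move=> ab cpsi psia inv; pose X := `[a, b]%classic `&` [set u | psi u <= 0].
have Xa : X a by split; rewrite //= in_itv /= lexx ab.
have compX : compact X.
  apply: (subclosed_compact _ (@segment_compact R a b)); last by move=> u [].
  apply: closedI; first exact: itv_closed.
  apply: (@preimage_closed _ _ psi [set r | r <= 0]); last exact: closed_le.
  by move=> u _; exact: cpsi.
have [|c] := @compact_EVT_max _ _ id _ (ex_intro _ a Xa) compX.
  by apply: continuous_subspaceT => u; exact: cvg_id.
rewrite inE => -[/=]; rewrite in_itv /= => /andP[ac cb] psic cmax.
have [ltcb|] := ltP c b; last by move=> bc; have -> : b = c by apply/eqP; rewrite eq_le bc.
have psi_near : \forall h \near 0^'+, psi (c + h) <= 0 by apply: inv; rewrite ?ac.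
have : \forall h \near (0 : R)^'+, False.
  near=> h; have h0 : 0 < h by near: h; exact: nbhs_right_gt.
  have : c + h <= c.
    apply: cmax; rewrite inE; split; last by near: h.
    rewrite /= in_itv /= (le_trans ac) ?lerDl ?(ltW h0)//= -lerBrDl.
    by near: h; apply: nbhs_right_le; rewrite subr_gt0.
  by rewrite gerDl leNgt h0.
by move/filter_ex => [].
Unshelve. all: end_near. Qed.

Lemma dini_attraction phi alpha t : 0 < alpha -> continuous phi -> 0 <= t ->
  (forall u, 0 <= u -> 0 < phi u -> exists2 D, D <= - alpha &
      (fun h => (phi (u + h) - phi u) / h) @ 0^'+ --> D) ->
  phi t <= Num.max (phi 0 - alpha * t) 0.
Proof.
move=> alpha0 cphi t0 attr; apply/ler_addgt0Pr => eps eps0.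
have t1 : 0 < t + 1 by rewrite ltr_wpDl.
pose e := Num.min (eps / (t + 1)) alpha.
have e0 : 0 < e by rewrite lt_min alpha0 divr_gt0.
have et : e * (t + 1) <= eps by rewrite -ler_pdivlMr// ge_min lexx.
have ea : e <= alpha by rewrite ge_min lexx orbT.
pose barrier u := Num.max (phi 0 - (alpha - e) * u) e.
suff : phi t <= barrier t.
  move=> /le_trans; apply; have := mulr_ge0 (ltW e0) t0.
  rewrite /barrier ge_max -!lerBlDr !le_max => et0.
  by apply/andP; split; apply/orP; [left|right]; lra.
rewrite -subr_le0; apply: (@right_invariant_le0 (fun u => phi u - barrier u) 0 t) => //.
- move=> u; apply: continuousB; first exact: cphi.
  apply: (@continuous_max _ _ (fun u => phi 0 - (alpha - e) * u) (cst e));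
    last exact: cst_continuous.
  apply: continuousB; first exact: cst_continuous.
  by apply: continuousM; [exact: cst_continuous|exact: cvg_id].
- by rewrite subr_le0 le_max mulr0 subr0 lexx.
move=> u /andP[u0 _]; rewrite subr_le0 => phiu.
have [phiu_gt0|phiu_le0] := ltP 0 (phi u).
  have [D Da cvD] := attr u u0 phiu_gt0.
  have slope : \forall h \near 0^'+, (phi (u + h) - phi u) / h < - (alpha - e).
    by apply: (cvgr_lt D) => //; lra.
  near=> h; have h0 : 0 < h by near: h; exact: nbhs_right_gt.
  have : (phi (u + h) - phi u) / h < - (alpha - e) by near: h.
  rewrite ltr_pdivrMr// subr_le0 => decr.
  have : 0 <= (alpha - e) * h by rewrite mulr_ge0 ?subr_ge0// ltW.
  by move: phiu; rewrite /barrier !le_max => /orP[below|below] ?; apply/orP; [left|right]; lra.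
have shift_cvg : (u + h) @[h --> 0^'+] --> u.
  rewrite -[X in _ --> X]addr0; apply: cvgD; first exact: cvg_cst.
  exact: cvg_at_right_filter (@cvg_id _ _).
have phi_cvg := cvg_comp _ _ shift_cvg (cphi u).
near=> h; rewrite subr_le0 le_max; apply/orP; right; rewrite ltW//; near: h.
by apply: (cvgr_lt (phi u)) => //; exact: le_lt_trans e0.
Unshelve. all: end_near. Qed.

End DiniDerivative.

Section MaxWeightFluid.
Variables (R : realType) (n : nat) (Rm : 'M[R]_n) (S : seq 'cV[R]_n) (lam : 'cV[R]_n).
Hypotheses (net : network_ok Rm S) (lam0 : nonneg lam) (S0 : S != [::]).
Local Notation MW := (ones R n).
Local Notation I := (invariant_states Rm S MW lam).

Lemma dist_pl_fluid_continuous w q (A : set 'cV[R]_n) : A !=set0 ->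
  pl_fluid Rm S w lam q -> continuous (fun t => dist_set (q t) A).
Proof.
move=> A0 [_ [c c0 qlip] _] t; apply/cvgrPdist_le => e e0.
have c1 : 0 < c + 1 by rewrite ltr_wpDl.
near=> u; apply: le_trans (dist_set_lipschitz _ _ A0) _; apply: le_trans (qlip _ _) _.
apply: (@le_trans _ _ (c * (e / (c + 1)))).
  by rewrite ler_wpM2l//; near: u; apply: cvgr_dist_le; rewrite ?divr_gt0.
by rewrite mulrCA ler_piMr ?(ltW e0)// ler_pdivrMr// mul1r lerDl.
Unshelve. all: end_near. Qed.

Lemma mw_distance_bound C alpha A Q : sensitivity_const Rm S C ->
  attraction_const Rm S lam alpha -> I !=set0 ->
  wmw_path Rm S MW A Q -> (forall t, nonneg (A t)) -> nonneg (Q 0%N) ->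
  forall k, dist_set (Q k) I <= Num.max (dist_set (Q 0%N) I - alpha * k%:R) 0 +
    C * (1 + norm2 lam + max_dev A lam k).
Proof.
move=> [C0 sens] [alpha0 attr] I0 path A0 Q0 k.
have [q plq q0] := pl_fluid_exists net lam0 S0 Q0.
have fluid := pl_fluid_solution net plq.
apply: le_trans (dist_set_leD _ (q k%:R) I0) _; rewrite lerD ?sens// -q0.
apply: (@dini_attraction _ (fun t => dist_set (q t) I)) => //.
  exact: dist_pl_fluid_continuous plq.
move=> u u0 du; apply: attr => // Iu.
by move: du; rewrite dist_set_self// ltxx.
Qed.

End MaxWeightFluid.

(** * Measurability and stationarity *)

Lemma measurable_preimage (d d' : measure_display) (T : measurableType d)
    (T' : measurableType d') (f : T -> T') (B : set T') :
  measurable_fun setT f -> measurable B -> measurable (f @^-1` B).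
Proof. by move=> mf mB; rewrite -[f @^-1` B]setTI; exact: mf. Qed.

Section Measurability.
Variables (R : realType) (n : nat) (d : measure_display) (T : measurableType d).
Implicit Types (X : T -> 'cV[R]_n) (f g : T -> R) (A : nat -> T -> 'cV[R]_n).

Lemma measurable_set_lt f g : measurable_fun setT f -> measurable_fun setT g ->
  measurable [set x | f x < g x].
Proof.
move=> mf mg; rewrite (_ : mkset _ = (fun x => f x < g x) @^-1` [set true]).
  by apply: measurable_preimage => //; exact: measurable_fun_ltr.
by apply/seteqP; split=> x /=; case: (f x < g x).
Qed.

Lemma measurable_bigmax (J : Type) (s : seq J) (F : J -> T -> R) (c : R) :
  (forall j, measurable_fun setT (F j)) ->
  measurable_fun setT (fun x => \big[Num.max/c]_(j <- s) F j x).
Proof.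
move=> mF; elim: s => [|j s IH].
  by under eq_fun do rewrite big_nil; exact: measurable_cst.
by under eq_fun do rewrite big_cons; exact: measurable_maxr.
Qed.

Lemma measurable_norm2B X x : (forall i, measurable_fun setT (fun om => X om i 0)) ->
  measurable_fun setT (fun om => norm2 (X om - x)).
Proof.
move=> mX; apply: (measurableT_comp (f := @Num.sqrt R)).
  exact: continuous_measurable_fun (@sqrt_continuous R).
apply: measurable_sum => i; under eq_fun do rewrite !mxE.
by apply: measurable_funX; apply: measurable_funB => //; exact: measurable_cst.
Qed.

Lemma measurable_max_dev A lam k :
  (forall t i, measurable_fun setT (fun om => A t om i 0)) ->
  measurable_fun setT (fun om => max_dev (A^~ om) lam k).
Proof.
move=> mA; apply: measurable_bigmax => t; under eq_fun do rewrite sumrB.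
apply: measurable_norm2B => i; under eq_fun do rewrite summxE.
by apply: measurable_sum => tau; exact: mA.
Qed.

Lemma rat_col_dense (x : 'cV[R]_n) (e : R) : 0 < e ->
  exists z : 'cV[rat]_n, norm2 (x - map_mx ratr z) < e.
Proof.
move=> e0; have eS0 : 0 < e / n.+1%:R by rewrite divr_gt0.
have /choice[z zP] : forall i : 'I_n, exists q : rat, `|x i 0 - ratr q| <= e / n.+1%:R.
  move=> i; have [|q] := @rat_in_itvoo R (x i 0 - e / n.+1%:R) (x i 0).
    by rewrite ltrBlDr ltrDl.
  rewrite in_itv /= => /andP[q_gt q_lt]; exists q.
  by rewrite ger0_norm ?subr_ge0 ?(ltW q_lt)// lerBlDr -lerBlDl ltW.
by exists (\col_i z i); apply: norm2_lt_coord => // i; rewrite !mxE.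
Qed.

Lemma measurable_dist_set_gt X (I : set 'cV[R]_n) (a : R) : I !=set0 ->
  (forall i, measurable_fun setT (fun om => X om i 0)) ->
  measurable [set om | a < dist_set (X om) I].
Proof.
move=> I0 mX; rewrite (_ : mkset _ = \bigcup_(z : 'cV[rat]_n)
    [set om | norm2 (X om - map_mx ratr z) < dist_set (map_mx ratr z) I - a]).
  apply: countable_bigcupT_measurable => [|z]; first exact: countableP.
  by apply: measurable_set_lt; [exact: measurable_norm2B|exact: measurable_cst].
apply/seteqP; split=> om /= [].
  move=> aX; have e0 : 0 < (dist_set (X om) I - a) / 2 by rewrite divr_gt0// subr_gt0.
  have [z zX] := rat_col_dense (X om) e0; exists z => //=.
  have := dist_set_leD (X om) (map_mx ratr z) I0; lra.
move=> z _ /=; have := dist_set_leD (map_mx ratr z) (X om) I0.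
by rewrite norm2_distC; lra.
Qed.

End Measurability.

Section Stationarity.
Variables (R : realType) (n : nat) (d : measure_display) (T : measurableType d).
Variables (P : probability T R) (A : nat -> T -> 'cV[R]_n).
Hypotheses (mA : forall t i, measurable_fun setT (fun om => A t om i 0))
  (stat : stationary P A).

Definition cylinder (B : nat -> 'I_n -> set R) (m : nat) : set (nat -> 'cV[R]_n) :=
  [set a | forall t i, (t < m)%N -> B t i (a t i 0)].

Definition cylinders : set (set (nat -> 'cV[R]_n)) :=
  [set E | exists B m, (forall t i, measurable (B t i)) /\ E = cylinder B m].

Local Notation path := (g_sigma_algebraType cylinders).

Lemma cylinders_setI : setI_closed cylinders.
Proof.
move=> _ _ [B [m [mB ->]]] [B' [m' [mB' ->]]].
pose trunc k (C : nat -> 'I_n -> set R) t i := if (t < k)%N then C t i else setT.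
exists (fun t i => trunc m B t i `&` trunc m' B' t i), (maxn m m'); split.
  by move=> t i; apply: measurableI; rewrite /trunc; case: ifP.
apply/seteqP; split=> a.
  by move=> [aB aB'] t i _; rewrite /trunc; split; case: ifP => // tm; [exact: aB|exact: aB'].
by move=> aBB'; split=> t i tm; have := aBB' t i;
  rewrite leq_max tm ?orbT => /(_ isT)[]; rewrite /trunc tm.
Qed.

Lemma measurable_path k : measurable_fun setT ((fun om => after k (A^~ om)) : T -> path).
Proof.
apply: (@measurability _ _ T path setT _ cylinders erefl) => _ [_ [B [m [mB ->]]] <-].
rewrite setTI (_ : _ @^-1` _ = \bigcap_t \bigcap_(i : 'I_n)
   (if (t < m)%N then (fun om => A (k + t)%N om i 0) @^-1` B t i else setT)).
  apply: bigcapT_measurable => t; apply: fin_bigcap_measurable => [|i _].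
    exact: finite_finset.
  by case: ifP => // _; exact: measurable_preimage.
apply/seteqP; split=> om /=.
  by move=> omB t _ i _; case: ifP => // tm; exact: omB.
by move=> omB t i tm; have := omB t Logic.I i Logic.I; rewrite tm.
Qed.

Lemma stationary_after_law k (E : set path) : measurable E ->
  P ((fun om => after k (A^~ om)) @^-1` E) = P ((fun om => A^~ om) @^-1` E).
Proof.
pose X j : {RV P >-> path} := mfun_Sub (mem_set (measurable_path j)).
move=> mE; apply: (@measure_unique _ R path cylinders (fun=> setT) erefl cylinders_setI
  _ _ (distribution P (X k)) (distribution P (X 0%N)) _ _ E mE).
- by move=> _; exists (fun _ _ => setT), 0%N; split=> //; apply/seteqP; split.
- by rewrite bigcup_const.
- move=> _ [B [m [mB ->]]]; have := stat k m mB.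
  rewrite (_ : [set om | _] = X k @^-1` cylinder B m)//.
  by apply/seteqP; split=> om omB t i tm; have := omB t i tm; rewrite /= /after addnC.
- by move=> _; apply: le_lt_trans (ltry 1); exact: probability_le1.
Qed.

Lemma stationary_max_dev lam (k m : nat) (c : R) :
  measurable [set om | c < max_dev (after k (A^~ om)) lam m] /\
  P [set om | c < max_dev (after k (A^~ om)) lam m] =
  P [set om | c < max_dev (A^~ om) lam m].
Proof.
pose E : set path := [set a | c < max_dev a lam m].
have mE : measurable E.
  apply: measurable_set_lt; first exact: measurable_cst.
  apply: (@measurable_max_dev _ _ _ path (fun t a => a t)) => t i _ B mB; rewrite setTI.
  apply: sub_sigma_algebra.
  exists (fun t' i' => if (t' == t) && (i' == i) then B else setT), t.+1; split.
    by move=> t' i'; case: ifP.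
  apply/seteqP; split=> a /= aB.
    by move=> t' i' _; case: ifP => // /andP[/eqP-> /eqP->].
  by have := aB t i (ltnSn t); rewrite !eqxx.
split; last exact: (stationary_after_law k mE).
exact: (measurable_preimage (measurable_path k) mE).
Qed.

End Stationarity.

(** * Union bound over windows *)

Section FarEvent.
Variables (R : realType) (n : nat) (g : nat -> R) (Tend : R) (r : nat).
Variables (d : measure_display) (Om : measurableType d).
Variables (Q : nat -> Om -> 'cV[R]_n) (I : set 'cV[R]_n).
Hypotheses (g0 : 0 < g r) (T0 : 0 <= Tend) (r0 : (0 < r)%N).
Hypotheses (I0 : I !=set0) (coneI : forall b x, 0 < b -> I x -> I (b *: x)).

Definition horizon : nat := Num.truncn (g r * Tend).

Lemma horizon_arg_ge0 : 0 <= g r * Tend.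
Proof. by rewrite mulr_ge0// ltW. Qed.

Lemma absz_floor (x : R) : 0 <= x -> `|Num.floor x|%N = Num.truncn x.
Proof. by move=> x0; rewrite truncn_floor x0. Qed.

Lemma far_eventP delta om : far_event g r Q I Tend delta om <->
  exists2 k, (k <= horizon)%N & delta * r%:R < dist_set (Q k om) I.
Proof.
have rV0 : 0 < r%:R^-1 :> R by rewrite invr_gt0 ltr0n.
have farE k : (delta < dist_set (r%:R^-1 *: Q k om) I) = (delta * r%:R < dist_set (Q k om) I).
  by rewrite dist_setZ// mulrC ltr_pdivlMr// ltr0n.
rewrite /far_event /=; set D := [set _ | _ in _].
have DE x : D x <-> exists2 k, (k <= horizon)%N & x = dist_set (r%:R^-1 *: Q k om) I.
  split=> [[t] /=|[k kM ->]].
    rewrite in_itv /= => /andP[t0 tT] <-; have gt0 : 0 <= g r * t by rewrite mulr_ge0// ltW.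
    by exists (Num.truncn (g r * t)); rewrite /scaled ?absz_floor// le_truncn// ler_pM2l.
  exists (k%:R / g r) => /=; last first.
    by rewrite /scaled mulrCA divff ?gt_eqF// mulr1 absz_floor// natrK.
  rewrite in_itv /= divr_ge0 ?(ltW g0)//= ler_pdivrMr// mulrC.
  by rewrite -truncn_ge_nat ?horizon_arg_ge0.
have D0 : D !=set0 by exists (dist_set (r%:R^-1 *: Q 0%N om) I); apply/DE; exists 0%N.
split=> [/(sup_gt D0)[x /DE[k kM ->] dx]|[k kM dk]]; first by exists k; rewrite -?farE.
rewrite -farE in dk; apply: lt_le_trans dk _; apply: sup_upper_bound; last by apply/DE; exists k.
split=> //; exists (\sum_(l < horizon.+1) dist_set (r%:R^-1 *: Q l om) I) => x /DE[l lM ->].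
rewrite (bigD1 (Ordinal (lM : (l < horizon.+1)%N)))//= lerDl.
by apply: sumr_ge0 => j _; exact: dist_set_ge0.
Qed.

Hypothesis mQ : forall t i, measurable_fun setT (fun om => Q t om i 0).

Lemma measurable_far_event delta : measurable (far_event g r Q I Tend delta).
Proof.
rewrite (_ : far_event _ _ _ _ _ _ = \bigcup_(k in `I_horizon.+1)
   [set om | delta * r%:R < dist_set (Q k om) I]).
  apply: fin_bigcup_measurable => [|k _]; first exact: finite_II.
  exact: measurable_dist_set_gt.
by apply/seteqP; split=> om; rewrite far_eventP => -[k kM dk]; exists k.
Qed.

Definition regular_windows (A : nat -> 'cV[R]_n) lam h e : Prop := forall j,
  (j * h <= horizon)%N -> max_dev (after (j * h) A) lam r.+1 <= e * r%:R.

Lemma far_event_prob_le (P : probability Om R) (A : nat -> Om -> 'cV[R]_n) h lam delta e :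
  arrival_process A -> stationary P A -> (0 < h)%N ->
  (forall om, regular_windows (A^~ om) lam h e ->
    forall k, (k <= horizon)%N -> dist_set (Q k om) I <= delta * r%:R) ->
  fine (P (far_event g r Q I Tend delta)) <= (horizon %/ h).+1%:R *
    fine (P [set om | r%:R^-1 * max_dev (A^~ om) lam r.+1 > e]).
Proof.
move=> [mA _] stat h0 regular_close.
have -> : [set om | e < r%:R^-1 * max_dev (A^~ om) lam r.+1] =
    [set om | e * r%:R < max_dev (A^~ om) lam r.+1].
  by apply/seteqP; split=> om /=; rewrite ltr_pdivlMl ?ltr0n// [_ * e]mulrC.
pose irregular j := [set om | e * r%:R < max_dev (after (j * h) (A^~ om)) lam r.+1].
have law j := stationary_max_dev mA stat lam (j * h) r.+1 (e * r%:R).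
have union : (P (far_event g r Q I Tend delta) <=
    \sum_(j < (horizon %/ h).+1) P (irregular j))%E.
  apply: (@content_subadditive _ _ _ P _ irregular).
  - by move=> j _; exact: (law j).1.
  - exact: measurable_far_event.
  move=> om /far_eventP[k kM]; rewrite -bigcup_mkord; apply: contraPP => regular.
  apply/negP; rewrite -leNgt; apply: regular_close => // j jM.
  rewrite leNgt; apply/negP => irr; apply: regular; exists j => //=.
  by rewrite ltnS leq_divRL.
have m0 : measurable [set om | e * r%:R < max_dev (A^~ om) lam r.+1] by exact: (law 0%N).1.
move: union; rewrite (eq_bigr (fun=> P [set om | e * r%:R < max_dev (A^~ om) lam r.+1])).
  rewrite -(fineK (fin_num_measure P _ (measurable_far_event delta))).
  rewrite -(fineK (fin_num_measure P _ m0)).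
  by rewrite sumEFin lee_fin sumr_const card_ord mulr_natl.
by move=> j _; exact: (law j).2.
Qed.

End FarEvent.

Section Asymptotics.
Variable R : realType.

Lemma limn_einf_gt0_near (u : nat -> R) : (0 < limn_einf (fun r => (u r)%:E))%E ->
  exists2 c : R, 0 < c & \forall r \near \oo, c <= u r.
Proof.
rewrite limn_einf_lim (cvg_lim _ (@cvg_einfs_sup _ _))// => /ereal_sup_gt[_ [m _ <-]] /= m0.
have inf_le k : (m <= k)%N -> (ereal_inf (sdrop (fun r => (u r)%:E) m) <= (u k)%:E)%E.
  by move=> mk; apply: ereal_inf_lbound; exists k.
have {}m0 : (0 < ereal_inf (sdrop (fun r => (u r)%:E) m))%E := m0.
move: (ereal_inf (sdrop (fun r => (u r)%:E) m)) m0 inf_le => [c| |] //.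
  by rewrite lte_fin => c0 c_le; exists c => //; exists m.
by move=> _ y_le; have := y_le m (leqnn m); rewrite leye_eq.
Qed.

Lemma window_count_le (g Tend c : R) (r h : nat) : 0 <= Tend -> 0 < c -> (0 < r)%N ->
  c * r%:R <= g -> (r <= 4 * h)%N ->
  (Num.truncn (g * Tend) %/ h).+1%:R <= (4 * Tend + c^-1) * (g / r%:R).
Proof.
move=> T0 c0 r0 cg rh; have rR : 0 < r%:R :> R by rewrite ltr0n.
have hR : 0 < h%:R :> R by rewrite ltr0n; lia.
have g0 : 0 <= g by rewrite (le_trans _ cg)// mulr_ge0// ltW.
rewrite -natr1 mulrDl lerD//; last first.
  by rewrite ler_pdivlMl// ler_pdivlMr// mulr1.
apply: (@le_trans _ _ (g * Tend / h%:R)).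
  rewrite ler_pdivlMr// -natrM (le_trans (_ : _ <= (Num.truncn (g * Tend))%:R))//.
    by rewrite ler_nat leq_divM.
  by rewrite truncn_le mulr_ge0.
rewrite ler_pdivrMr// [leRHS](_ : _ = g * Tend * (4 * h%:R / r%:R)); last first.
  by field; rewrite gt_eqF.
by rewrite ler_peMr ?mulr_ge0// ler_pdivlMr// mul1r -natrM ler_nat.
Qed.

Lemma far_prob_cvg (f g : nat -> R) (h : nat -> nat) (F p : nat -> R) (Tend : R) :
  0 <= Tend -> (forall r, 0 <= f r) -> (forall r, 0 <= p r) -> (forall r, 0 <= F r) ->
  (exists2 c : R, 0 < c & \forall r \near \oo, c <= g r / r%:R) ->
  (forall r, r <= 4 * h r)%N ->
  (\forall r \near \oo, F r <= (Num.truncn (g r * Tend) %/ h r).+1%:R * p r) ->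
  (fun r => f r * p r) @ \oo --> (0 : R) ->
  (fun r => r%:R * f r / g r * F r) @ \oo --> (0 : R).
Proof.
move=> T0 f0 p0 F0 [c c0 gc] rh Fle fp.
have bound_cvg : (fun r => (4 * Tend + c^-1) * (f r * p r)) @ \oo --> (0 : R).
  by rewrite -(mulr0 (4 * Tend + c^-1)); apply: cvgMl_tmp fp.
apply: squeeze_cvgr (cvg_cst 0) bound_cvg.
near=> r; have r0 : (0 < r)%N by near: r; exact: nbhs_infty_gt.
have rR : 0 < r%:R :> R by rewrite ltr0n.
have cg : c * r%:R <= g r by rewrite -ler_pdivlMr//; near: r.
have g0 : 0 < g r by rewrite (lt_le_trans _ cg)// mulr_gt0.
have rfg0 : 0 <= r%:R * f r / g r by rewrite divr_ge0 ?mulr_ge0// ltW.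
rewrite mulr_ge0//=; apply: (@le_trans _ _ (r%:R * f r / g r *
    ((4 * Tend + c^-1) * (g r / r%:R) * p r))).
  rewrite ler_wpM2l//; apply: (@le_trans _ _ ((Num.truncn (g r * Tend) %/ h r).+1%:R * p r)).
    by near: r.
  by rewrite ler_wpM2r// window_count_le.
rewrite le_eqVlt; apply/orP; left; apply/eqP; field.
by rewrite !gt_eqF ?addr_gt0.
Unshelve. all: end_near. Qed.

End Asymptotics.

(** * Following a queue over many windows *)

Section MaximalDeviation.
Variables (R : realType) (n : nat).
Implicit Types (lam : 'cV[R]_n) (A : nat -> 'cV[R]_n).

Lemma max_dev_ge0 A lam k : 0 <= max_dev A lam k.
Proof. by apply/bigmax_geP; left. Qed.

Lemma cumdev_le_max_dev A lam lam' l m : (l <= m)%N ->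
  norm2 (cumdev lam A l) <= max_dev A lam' m + l%:R * norm2 (lam' - lam).
Proof.
case: l => [|l] lm; first by rewrite /cumdev big_ord0 norm2_0 mul0r addr0 max_dev_ge0.
have -> : cumdev lam A l.+1 = cumdev lam' A l.+1 + l.+1%:R *: (lam' - lam).
  rewrite scaler_nat -[X in _ *+ X]card_ord -sumr_const -big_split /=.
  by apply: eq_bigr => t _; rewrite addrA subrK.
apply: le_trans (norm2D _ _) _; rewrite norm2Z normr_nat lerD2r.
by apply/bigmax_geP; right; exists (Ordinal lm).
Qed.

Lemma max_dev_change A lam lam' k m : (k <= m)%N ->
  max_dev A lam k <= max_dev A lam' m + m%:R * norm2 (lam' - lam).
Proof.
move=> km; apply/bigmax_leP; split=> [|t _].
  by rewrite addr_ge0 ?max_dev_ge0// mulr_ge0// norm2_ge0.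
have tm : (t < m)%N by exact: leq_trans km.
apply: le_trans (cumdev_le_max_dev A lam lam' tm) _.
by rewrite lerD2l ler_wpM2r ?norm2_ge0// ler_nat.
Qed.

Lemma norm2_cvg (x : nat -> 'cV[R]_n) (y : 'cV[R]_n) (e : R) : 0 < e ->
  (forall i, (fun r => x r i 0) @ \oo --> y i 0) ->
  \forall r \near \oo, norm2 (x r - y) < e.
Proof.
move=> e0 cvx; have eS0 : 0 < e / n.+1%:R by rewrite divr_gt0.
have : \forall r \near \oo, forall i : 'I_n, `|y i 0 - x r i 0| <= e / n.+1%:R.
  by apply: filter_forall => i; have /cvgrPdist_le := cvx i; apply.
by apply: filterS => r xr; apply: norm2_lt_coord => // i; rewrite !mxE distrC.
Qed.

End MaximalDeviation.

Section WindowsStayClose.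
Variables (R : realType) (n : nat) (Rm : 'M[R]_n) (S : seq 'cV[R]_n) (w lam : 'cV[R]_n).
Hypotheses (net : network_ok Rm S) (w_gt0 : pos_weights w) (sus : sustainable Rm S lam).
Local Notation K := (inv_cone Rm S w lam).

Lemma windows_stay_close (delta : R) : 0 < delta -> exists2 th : R, 0 < th &
  exists2 e : R, 0 < e & \forall r \near \oo, forall (g : nat -> R) Tend A Q lamr,
    wmw_path Rm S w A Q -> (forall t, nonneg (A t)) -> nonneg (Q 0%N) ->
    norm2 (lamr - lam) < e -> dist_set (Q 0%N) K <= th * r%:R ->
    regular_windows g Tend r A lamr r e ->
    forall k, (k <= horizon g Tend r)%N -> dist_set (Q k) K <= delta * r%:R.
Proof.
move=> delta0; have [th th0 [e e0 ret]] := window_return net w_gt0 sus delta0.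
exists th => //; exists (e / 2); first by rewrite divr_gt0.
near=> r => g Tend A Q lamr path A0 Q0 lamre dQ0 regular.
have r0 : (0 < r)%N by near: r; exact: nbhs_infty_gt.
have queue : wmw_queue Rm S w A Q by split=> //; exact: wmw_path_nonneg path A0 Q0.
have quiet_window j : (j * r <= horizon g Tend r)%N ->
    quiet lam (after (j * r) A) r (e * r%:R).
  move=> jM l lr; apply: le_trans (cumdev_le_max_dev _ lam lamr (leqW lr)) _.
  have : l%:R * norm2 (lamr - lam) <= r%:R * (e / 2).
    by rewrite ler_pM ?norm2_ge0 ?ler_nat// ltW.
  have := regular j jM; lra.
have window j : (j * r <= horizon g Tend r)%N -> dist_set (Q (j * r)%N) K <= th * r%:R ->
    (forall k, (k <= r)%N -> dist_set (Q (j * r + k)%N) K <= delta * r%:R) /\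
    dist_set (Q (j.+1 * r)%N) K <= th * r%:R.
  move=> jM dj; rewrite mulSn addnC.
  apply: (near ret r _ (after (j * r) A) (after (j * r) Q)) => //.
  - exact: wmw_queue_after.
  - by rewrite /after addn0.
  - exact: quiet_window.
have starts j : (j * r <= horizon g Tend r)%N -> dist_set (Q (j * r)%N) K <= th * r%:R.
  elim: j => [|j IH] jM; first by rewrite mul0n.
  have jM' : (j * r <= horizon g Tend r)%N by rewrite (leq_trans _ jM)// leq_pmul2r.
  exact: (window j jM' (IH jM')).2.
move=> k kM; rewrite (divn_eq k r).
have jM : (k %/ r * r <= horizon g Tend r)%N by rewrite (leq_trans _ kM)// leq_divM.
by apply: (window _ jM (starts _ jM)).1; rewrite ltnW// ltn_pmod.
Unshelve. all: end_near. Qed.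

End WindowsStayClose.

(* Consecutive windows start a quarter of a window apart, so that every late
   time lies in the last quarter of some window. *)
Lemma overlapping_window r k : (4 <= r)%N -> (r < k)%N -> exists j,
  [/\ (j * (r %/ 4).+1 < k)%N, (k - j * (r %/ 4).+1 <= r)%N &
      (3 * r <= 4 * (k - j * (r %/ 4).+1))%N].
Proof.
move=> r4 rk; set q := (r %/ 4)%N; exists ((k - r + q) %/ q.+1)%N.
have := divn_eq (k - r + q) q.+1; have := ltn_pmod (k - r + q) (ltn0Sn q).
have : (4 * q <= r)%N by rewrite mulnC leq_divM.
have : (r < 4 * q.+1)%N by rewrite mulnC ltn_ceil.
move: (_ %% _)%N (_ %/ q.+1 * _)%N => rem start; move: q rk r4 => q.
by clear; split; lia.
Qed.

Section MaxWeightWindows.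
Variables (R : realType) (n : nat) (Rm : 'M[R]_n) (S : seq 'cV[R]_n) (lam : 'cV[R]_n).
Hypotheses (net : network_ok Rm S) (lam0 : nonneg lam) (S0 : S != [::]).
Local Notation MW := (ones R n).
Local Notation I := (invariant_states Rm S MW lam).
Variables (C alpha delta e eta Tend : R) (g : nat -> R).
Variables (A Q : nat -> 'cV[R]_n) (r : nat) (lamr : 'cV[R]_n).
Hypotheses (I0 : I !=set0) (sens : sensitivity_const Rm S C)
  (attr : attraction_const Rm S lam alpha).
Hypotheses (path : wmw_path Rm S MW A Q) (A0 : forall t, nonneg (A t))
  (Q0 : nonneg (Q 0%N)) (r4 : (4 <= r)%N)
  (noise : C * (1 + norm2 lam + r.+1%:R * norm2 (lamr - lam)) <= eta * r%:R)
  (regular : regular_windows g Tend r A lamr (r %/ 4).+1 e).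
Local Notation M := (horizon g Tend r).

Lemma mw_window_bound j l : (j * (r %/ 4).+1 <= M)%N -> (l <= r)%N ->
  dist_set (Q (j * (r %/ 4).+1 + l)%N) I <=
  Num.max (dist_set (Q (j * (r %/ 4).+1)%N) I - alpha * l%:R) 0 + (C * e + eta) * r%:R.
Proof.
move=> jM lr; set s := (j * _)%N; have C0 := sens.1.
have := mw_distance_bound net lam0 S0 sens attr I0 (wmw_path_after s path)
  (fun t => A0 _) (wmw_path_nonneg net path A0 Q0 _) l.
rewrite /after addn0 -/(after s A) => /le_trans; apply; rewrite lerD2l.
have dev : max_dev (after s A) lam l <= e * r%:R + r.+1%:R * norm2 (lamr - lam).
  apply: le_trans (max_dev_change _ lam lamr (leqW lr)) _.
  by rewrite lerD2r regular.
have : C * max_dev (after s A) lam l <= C * (e * r%:R + r.+1%:R * norm2 (lamr - lam)).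
  by rewrite ler_pM2l.
move: noise; lra.
Qed.

Hypotheses (eta_delta : C * e + eta <= 3 / 4 * delta)
  (eta_alpha : C * e + eta <= 3 / 4 * alpha) (eta_small : eta <= delta / 4)
  (start : dist_set (Q 0%N) I <= eta * r%:R) (delta0 : 0 < delta).

Lemma mw_windows_stay_close k : (k <= M)%N -> dist_set (Q k) I <= delta * r%:R.
Proof.
have alpha0 := attr.1; have r0 : 0 < r%:R :> R by rewrite ltr0n (leq_trans _ r4).
have noise_delta : (C * e + eta) * r%:R <= 3 / 4 * delta * r%:R by rewrite ler_pM2r.
elim/ltn_ind: k => k IH kM; have [kr|rk] := leqP k r.
  have := mw_window_bound (j := 0) (leq0n _) kr; rewrite !mul0n add0n.
  have : Num.max (dist_set (Q 0%N) I - alpha * k%:R) 0 <= dist_set (Q 0%N) I.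
    by rewrite ge_max dist_set_ge0 gerBl andbT mulr_ge0// ltW.
  have : eta * r%:R <= delta / 4 * r%:R by rewrite ler_wpM2r.
  move: start noise_delta; lra.
have [j [jk lr late]] := overlapping_window r4 rk.
have jM : (j * (r %/ 4).+1 <= M)%N by rewrite ltnW// (leq_trans jk).
have := mw_window_bound jM lr; rewrite subnKC; last exact: ltnW.
have := IH _ jk jM.
have lR : 3 / 4 * r%:R <= (k - j * (r %/ 4).+1)%:R :> R.
  by move: late; rewrite -(ler_nat R) !natrM; lra.
have : (C * e + eta) * r%:R <= 3 / 4 * alpha * r%:R by rewrite ler_pM2r.
have : alpha * (3 / 4 * r%:R) <= alpha * (k - j * (r %/ 4).+1)%:R by rewrite ler_pM2l.
have : 0 < delta * r%:R by rewrite mulr_gt0.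
rewrite /Num.max; case: ifP => _; lra.
Qed.

End MaxWeightWindows.

(** * A lower law of large numbers *)

Section IndependentPairs.
Variables (R : realType) (d : measure_display) (T : measurableType d) (P : probability T R).
Local Open Scope ereal_scope.

Definition independent_pair (X Y : T -> R) : Prop := forall B C : set R,
  measurable B -> measurable C ->
  P (X @^-1` B `&` Y @^-1` C) = P (X @^-1` B) * P (Y @^-1` C).

Lemma independent_pair_comp (f : R -> R) (X Y : T -> R) : measurable_fun setT f ->
  independent_pair X Y -> independent_pair (f \o X) (f \o Y).
Proof.
by move=> mf XY B C mB mC; apply: (XY (f @^-1` B) (f @^-1` C)); exact: measurable_preimage.
Qed.

Lemma expectationM_independent (X Y : {RV P >-> R}) :
  (forall x, 0 <= X x)%R -> (forall x, 0 <= Y x)%R ->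
  independent_pair X Y -> 'E_P[X \* Y] = 'E_P[X] * 'E_P[Y].
Proof.
move=> X0 Y0 XY.
have mXY : measurable_fun setT (fun x => (X x, Y x)) by exact: measurable_fun_pair.
pose joint : {RV P >-> (R * R)%type} := mfun_Sub (mem_set mXY).
pose absM (z : R * R) : \bar R := (`|z.1| * `|z.2|)%:E.
have mabs : measurable_fun [set: R] (fun u : R => `|u|%:E).
  by apply/measurable_EFinP; exact: normr_measurable.
have mabsM : measurable_fun setT absM.
  by apply/measurable_EFinP/measurable_funM; apply: measurableT_comp.
have absM0 z : 0 <= absM z by rewrite lee_fin mulr_ge0.
have absE (Z : {RV P >-> R}) : (forall x, 0 <= Z x)%R ->
    'E_P[Z] = \int[distribution P Z]_u `|u|%:E.
  move=> Z0; rewrite unlock ge0_integral_distribution//.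
  by apply: eq_integral => x _; rewrite /= ger0_norm.
have -> : 'E_P[X \* Y] = \int[distribution P joint]_z absM z.
  rewrite unlock ge0_integral_distribution//.
  by apply: eq_integral => x _; rewrite /absM /= !ger0_norm.
transitivity (\int[distribution P X \x distribution P Y]_z absM z).
  apply: eq_measure_integral => B mB _.
  by apply/esym/product_measure_unique => // B1 B2 mB1 mB2; exact: XY.
rewrite fubini_tonelli1// !absE// -ge0_integralZr//; last exact: integral_ge0.
by apply: eq_integral => u _; rewrite -ge0_integralZl.
Qed.

Lemma Lfun_bounded (X : {mfun T >-> R}) (L p : R) :
  (forall x, `|X x| <= L)%R -> (0 <= p)%R -> (X : T -> R) \in Lfun P p%:E.
Proof.
move=> XL p0; apply/andP; split; first by rewrite inE /=; exact: measurable_funPT.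
rewrite inE/= /finite_norm unlock poweR_lty//.
apply: (@le_lt_trans _ _ (\int[P]_x (L `^ p)%:E)).
  apply: ge0_le_integral => //.
  - by move=> x _; rewrite lee_fin powR_ge0.
  - apply/measurable_EFinP; apply: (measurableT_comp (measurable_powR _)) => //.
    exact: measurableT_comp.
  - by move=> x _; rewrite lee_fin ge0_ler_powR// nnegrE (le_trans _ (XL x)).
by rewrite integral_cst//= probability_setT mule1 ltry.
Qed.

Lemma covariance_independent (X Y : {RV P >-> R}) :
  (X : T -> R) \in Lfun P 2%:E -> (Y : T -> R) \in Lfun P 2%:E ->
  (forall x, 0 <= X x)%R -> (forall x, 0 <= Y x)%R ->
  independent_pair X Y -> covariance P X Y = 0.
Proof.
move=> X2 Y2 X0 Y0 XY.
have X1 : (X : T -> R) \in Lfun P 1 by rewrite Lfun_subset12 ?fin_num_measure.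
have Y1 : (Y : T -> R) \in Lfun P 1 by rewrite Lfun_subset12 ?fin_num_measure.
rewrite covarianceE ?Lfun2_mul_Lfun1// expectationM_independent// subee//.
by rewrite fin_numM ?expectation_fin_num.
Qed.

End IndependentPairs.

Section UncorrelatedSums.
Variables (R : realType) (d : measure_display) (T : measurableType d) (P : probability T R).
Variables (Y : nat -> {RV P >-> R}) (m v : R).
Hypotheses (Y2 : forall t, (Y t : T -> R) \in Lfun P 2%:E)
  (meanY : forall t, ('E_P[Y t] = m%:E)%E) (varY : forall t, ('V_P[Y t] <= v%:E)%E)
  (uncorrelated : forall s t, s != t -> covariance P (Y s) (Y t) = 0%E).

Definition partial_sum N : T -> R := \sum_(t < N) (Y t : T -> R).

Lemma partial_sumE N x : partial_sum N x = \sum_(t < N) Y t x.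
Proof. by rewrite /partial_sum fct_sumE. Qed.

Lemma partial_sum_Lfun2 N : partial_sum N \in Lfun P 2%:E.
Proof. by apply: rpred_sum => [|le12 t _]; [rewrite lee1n|exact: Y2]. Qed.

Lemma partial_sum_covariance N k : (N <= k)%N -> covariance P (partial_sum N) (Y k) = 0%E.
Proof.
elim: N => [|N IH] Nk; first by rewrite /partial_sum big_ord0 covariance_cst_l.
rewrite /partial_sum big_ord_recr covarianceDl ?partial_sum_Lfun2//.
by rewrite IH ?(ltnW Nk)// uncorrelated ?addr0// ltn_eqF.
Qed.

Lemma partial_sum_expectation N : ('E_P[partial_sum N] = (N%:R * m)%:E)%E.
Proof.
have Lfun1 (X : T -> R) : X \in Lfun P 2%:E -> X \in Lfun P 1.
  by move=> X2; rewrite Lfun_subset12 ?fin_num_measure.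
elim: N => [|N IH]; first by rewrite /partial_sum big_ord0 expectation_cst mul0r.
rewrite /partial_sum big_ord_recr expectationD ?Lfun1 ?partial_sum_Lfun2//.
by rewrite IH meanY -EFinD -natr1 mulrDl mul1r.
Qed.

Lemma partial_sum_variance N : ('V_P[partial_sum N] <= (N%:R * v)%:E)%E.
Proof.
elim: N => [|N IH]; first by rewrite /partial_sum big_ord0 variance_cst mul0r.
rewrite /partial_sum big_ord_recr varianceD ?partial_sum_Lfun2// partial_sum_covariance//.
by rewrite mule0 adde0 -natr1 mulrDl mul1r EFinD leeD.
Qed.

Lemma partial_sum_tail N e : 0 < e ->
  (P [set x | e <= `|partial_sum N x - N%:R * m|]%R <= (N%:R * v / e ^+ 2)%:E)%E.
Proof.
move=> e0; pose X : {RV P >-> R} := mfun_Sub (sub_Lfun_mfun (partial_sum_Lfun2 N)).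
have := @chebyshev _ _ _ P X e e0; rewrite (_ : 'E_P[X]%E = (N%:R * m)%:E).
  move=> /le_trans; apply; rewrite mulrC EFinM lee_pmul2l ?lte_fin ?invr_gt0 ?exprn_gt0//.
  exact: partial_sum_variance.
exact: partial_sum_expectation.
Qed.

Lemma inv_square_sum_le N : \sum_(0 <= k < N) (k.+1%:R ^+ 2)^-1 <= 2 - 2 / N.+1%:R :> R.
Proof.
elim: N => [|N IH]; first by rewrite big_nil divr1 subrr.
rewrite big_nat_recr//= -[N.+2%:R]natr1; move: IH; set a : R := N.+1%:R => IH.
have a1 : 1 <= a by rewrite ler1n.
have a0 : 0 < a := lt_le_trans ltr01 a1.
clearbody a.
have : (a ^+ 2)^-1 <= 2 / a - 2 / (a + 1).
  have -> : 2 / a - 2 / (a + 1) = (a * (a + 1) / 2)^-1 by field; rewrite !gt_eqF ?addr_gt0.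
  rewrite lef_pV2 ?posrE ?exprn_gt0 ?divr_gt0 ?mulr_gt0 ?addr_gt0//.
  by rewrite ler_pdivrMr// expr2 -mulrA ler_pM2l//; lra.
lra.
Qed.

Lemma partial_sum_squares e : 0 < e -> {ae P, forall x, \forall k \near \oo,
  `|partial_sum (k ^ 2) x - (k ^ 2)%:R * m| < e * (k ^ 2)%:R}.
Proof.
move=> e0; pose deviates k := [set x |
  e * (k.+1 ^ 2)%:R <= `|partial_sum (k.+1 ^ 2) x - (k.+1 ^ 2)%:R * m|].
have v0 : 0 <= v by rewrite -lee_fin (le_trans (variance_ge0 P (Y 0%N))).
have measurable_deviates k : measurable (deviates k).
  have mS : measurable_fun setT (partial_sum (k.+1 ^ 2)).
    by have /sub_Lfun_mfun/set_mem := partial_sum_Lfun2 (k.+1 ^ 2).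
  rewrite -[deviates k]setTI; apply: measurable_fun_le => //.
  by apply: measurableT_comp => //; exact: measurable_funB.
have deviates_prob k : (P (deviates k) <= (v / e ^+ 2 * (k.+1%:R ^+ 2)^-1)%:E)%E.
  have ek0 : 0 < e * (k.+1 ^ 2)%:R by rewrite mulr_gt0// ltr0n expn_gt0.
  apply: le_trans (partial_sum_tail _ ek0) _.
  rewrite lee_fin natrX le_eqVlt; apply/orP; left; apply/eqP; field.
  by rewrite gt_eqF// gt_eqF.
exists (lim_sup_set deviates); split.
- by apply: bigcap_measurable => // N _; exact: bigcup_measurable.
- apply: lim_sup_set_cvg0 => //; apply: le_lt_trans (ltry (v / e ^+ 2 * 2)).
  apply: lime_le; first by apply: is_cvg_nneseries => k _ _; exact: measure_ge0.
  apply: nearW => N; apply: le_trans (lee_sum _ (fun k _ => deviates_prob k)) _.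
  rewrite sumEFin lee_fin -mulr_sumr ler_wpM2l ?divr_ge0 ?sqr_ge0//.
  by rewrite (le_trans (inv_square_sum_le N))// gerBl divr_ge0.
- move=> x /= often N _; apply: contrapT => good; apply: often.
  exists N.+1 => // -[//|k] /= Nk; rewrite ltNge; apply/negP => dev_k; apply: good.
  by exists k.
Qed.

End UncorrelatedSums.

Lemma square_interval t : exists k, (k ^ 2 <= t < k.+1 ^ 2)%N.
Proof.
elim: t => [|t [k /andP[kt tk]]]; first by exists 0%N.
have [tk'|kt'] := ltnP t.+1 (k.+1 ^ 2); first by exists k; rewrite (leqW kt).
by exists k.+1; rewrite kt' /=; move: tk; rewrite !expnS !expn0; nia.
Qed.

(* From [k ^ 2] to the next square the linear bound grows by [O(k)] only. *)
Lemma squares_interpolation (R : realFieldType) (y : nat -> R) (m e : R) :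
  (forall t, 0 <= y t) -> 0 < e ->
  (exists N, forall k, (N <= k)%N -> m * (k ^ 2)%:R <= \sum_(t < k ^ 2) y t) ->
  exists K, forall t, (m - e) * t%:R - K <= \sum_(s < t) y s.
Proof.
move=> y0 e0 [N squares]; exists (`|m| * (N ^ 2)%:R + m ^+ 2 / e) => t.
have [k /andP[kt tk]] := square_interval t.
have me0 : 0 <= m ^+ 2 / e by rewrite divr_ge0 ?sqr_ge0// ltW.
have mN0 : 0 <= `|m| * (N ^ 2)%:R by rewrite mulr_ge0.
have et0 : 0 <= e * t%:R by rewrite mulr_ge0// ltW.
have [kN|Nk] := ltnP k N.
  have : m * t%:R <= `|m| * (N ^ 2)%:R.
    rewrite (le_trans (ler_norm _))// normrM normr_nat ler_wpM2l// ler_nat.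
    by rewrite ltnW// (leq_trans tk)// leq_sqr.
  have : 0 <= \sum_(s < t) y s by apply: sumr_ge0.
  lra.
have : \sum_(s < k ^ 2) y s <= \sum_(s < t) y s.
  rewrite -!(big_mkord xpredT y) [leRHS](@big_cat_nat _ _ _ (k ^ 2)%N)//= lerDl.
  exact: sumr_ge0.
have := squares k Nk.
have loss : m * (t - k ^ 2)%:R <= `|m| * (2 * k)%:R.
  rewrite (le_trans (ler_norm _))// normrM normr_nat ler_wpM2l// ler_nat.
  by move: tk; rewrite !expnS !expn0; lia.
rewrite natrB// mulrBr natrM in loss.
have am_gm : 2 * (`|m| * k%:R) <= e * (k ^ 2)%:R + m ^+ 2 / e.
  have : 0 <= (e * k%:R - `|m|) ^+ 2 / e by rewrite divr_ge0 ?sqr_ge0// ltW.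
  rewrite sqrrB real_normK ?num_real// natrX.
  suff -> : ((e * k%:R) ^+ 2 - e * k%:R * `|m| *+ 2 + m ^+ 2) / e =
    e * k%:R ^+ 2 - 2 * (`|m| * k%:R) + m ^+ 2 / e by lra.
  by field; rewrite gt_eqF.
have : e * (k ^ 2)%:R <= e * t%:R by rewrite ler_pM2l// ler_nat.
lra.
Qed.

Section LowerLaw.
Variables (R : realType) (d : measure_display) (T : measurableType d) (P : probability T R).
Variables (X : nat -> {RV P >-> R}) (lam : R).
Hypotheses (X0 : forall t x, 0 <= X t x) (meanX : ('E_P[X 0%N] = lam%:E)%E).
Hypothesis ident : forall t (B : set R), measurable B -> P (X t @^-1` B) = P (X 0%N @^-1` B).
Hypothesis indep : forall s t, s != t -> independent_pair P (X s) (X t).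

Section Truncation.
Variable L : R.
Hypothesis L0 : 0 <= L.

Definition truncated t : {RV P >-> R} := X t \min cst L.

Lemma truncated_bounds t x : 0 <= truncated t x <= L.
Proof. by rewrite /truncated /= le_min X0 L0 ge_min lexx orbT. Qed.

Lemma truncated_Lfun2 t : (truncated t : T -> R) \in Lfun P 2%:E.
Proof.
apply: (@Lfun_bounded _ _ _ _ _ L) => // x.
by have /andP[Y0 YL] := truncated_bounds t x; rewrite ger0_norm.
Qed.

Lemma measurable_truncation : measurable_fun [set: R] (fun u : R => Num.min u L).
Proof. by apply: measurable_minr. Qed.

Lemma truncated_expectation t : 'E_P[truncated t]%E = 'E_P[truncated 0%N]%E.
Proof.
have lawE s : 'E_P[truncated s]%E = (\int[distribution P (X s)]_u `|Num.min u L|%:E)%E.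
  rewrite unlock ge0_integral_distribution//.
    by apply: eq_integral => x _; have /andP[Y0 _] := truncated_bounds s x; rewrite /= ger0_norm.
  by apply/measurable_EFinP/measurableT_comp => //; exact: measurable_truncation.
by rewrite !lawE; apply: eq_measure_integral => B mB _; exact: ident.
Qed.

Lemma truncated_variance t : ('V_P[truncated t] <= (L ^+ 2)%:E)%E.
Proof.
rewrite varianceE ?truncated_Lfun2//; apply: (@le_trans _ _ ('E_P[(truncated t : T -> R) ^+ 2])%E).
  rewrite leeBlDr; first exact/leeDl/sqre_ge0.
  by rewrite fin_numX// expectation_fin_num// Lfun_subset12 ?fin_num_measure ?truncated_Lfun2.
rewrite -(expectation_cst P (L ^+ 2)); apply: expectation_le => //.
- by move=> x; exact: sqr_ge0.
- by move=> x; exact: sqr_ge0.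
apply: aeW => x; have /andP[Y0 YL] := truncated_bounds t x.
by have : truncated t x ^+ 2 <= L ^+ 2 by rewrite ler_sqr.
Qed.

Lemma truncated_uncorrelated s t : s != t -> covariance P (truncated s) (truncated t) = 0%E.
Proof.
move=> st; apply: covariance_independent; rewrite ?truncated_Lfun2//.
- by move=> x; have /andP[] := truncated_bounds s x.
- by move=> x; have /andP[] := truncated_bounds t x.
- exact: (independent_pair_comp measurable_truncation (indep st)).
Qed.

Lemma truncated_law_lower m e : ('E_P[truncated 0%N] = m%:E)%E -> 0 < e ->
  {ae P, forall x, exists K, forall t, (m - 2 * e) * t%:R - K <= \sum_(s < t) X s x}.
Proof.
move=> meanY e0; have meanYt t : ('E_P[truncated t] = m%:E)%E by rewrite truncated_expectation.
have := partial_sum_squares truncated_Lfun2 meanYt truncated_variance truncated_uncorrelated e0.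
apply: filterS => x [N _ squares].
have [|||K lower] := @squares_interpolation R (truncated ^~ x) (m - e) e => //.
- by move=> t; have /andP[] := truncated_bounds t x.
- exists N => k Nk; have := squares k Nk; rewrite partial_sumE ltr_norml => /andP[+ _].
  by rewrite mulrBl; lra.
exists K => t; have -> : m - 2 * e = m - e - e by lra.
by apply: le_trans (lower t) (ler_sum _ _) => s _; rewrite /truncated /= ge_min lexx.
Qed.

End Truncation.

Lemma truncated_expectation_cvg :
  ('E_P[truncated k%:R 0%N])%E @[k --> \oo] --> lam%:E.
Proof.
rewrite -meanX unlock.
have -> : (\int[P]_x (X 0%N x)%:E =
    \int[P]_x (limn (fun k => (Num.min (X 0%N x) k%:R)%:E)))%E.
  apply: eq_integral => x _; apply/esym/cvg_lim => //.
  apply: cvg_near_cst; near=> k; congr EFin; apply/min_idPl.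
  by near: k; exact: nbhs_infty_ger.
apply: cvg_monotone_convergence => //.
- by move=> k; apply/measurable_EFinP; exact: measurable_funPT.
- by move=> k x _; rewrite lee_fin le_min X0 ler0n.
- by move=> x _ k l kl; rewrite lee_fin le_min ge_min lexx /= ge_min ler_nat kl orbT.
Unshelve. all: end_near. Qed.

Lemma lower_law_of_large_numbers eta : 0 < eta ->
  {ae P, forall x, exists K, forall t, (lam - eta) * t%:R - K <= \sum_(s < t) X s x}.
Proof.
move=> eta0; have /fine_cvgP[fin cvg] := truncated_expectation_cvg.
have eta3 : 0 < eta / 3 by rewrite divr_gt0.
have close : \forall k \near \oo, lam - eta / 3 <= fine ('E_P[truncated k%:R 0%N])%E.
  by apply: (cvgr_ge lam cvg); rewrite gtrBl.
have [k [Efin Ege]] := filter_ex (filterI fin close).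
have := truncated_law_lower (ler0n _ _) (esym (fineK Efin)) eta3.
apply: filterS => x [K lower]; exists K => t; apply: le_trans (lower t); rewrite lerD2r ler_wpM2r//.
by move: Ege => /=; lra.
Qed.

End LowerLaw.

(** * The capacity region *)

Section HittingTime.
Variables (R : realType) (d : measure_display) (T : measurableType d) (P : probability T R).
Variable H : nat -> set T.
Hypothesis mH : forall t, measurable (H t).

Definition hitting_time om : \bar R :=
  ereal_inf [set t%:R%:E | t in [set t : nat | (1 <= t)%N /\ H t om]].

Lemma hitting_time_ge0 om : (0 <= hitting_time om)%E.
Proof. by apply: le_ereal_inf_tmp => _ [t _ <-]; rewrite lee_fin. Qed.

Lemma measurable_hitting_time : measurable_fun setT hitting_time.
Proof.
pose value t om : \bar R := if om \in H t then t%:R%:E else +oo%E.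
rewrite (_ : hitting_time = fun om => einfs (value ^~ om) 1%N); last first.
  apply/funext => om; apply/eqP; rewrite eq_le; apply/andP; split.
    apply: le_ereal_inf_tmp => _ [t /= t1 <-]; rewrite /value.
    case: ifPn => [|_]; last exact: leey.
    by rewrite inE => Ht; apply: ereal_inf_lbound; exists t.
  apply: le_ereal_inf_tmp => _ [t [t1 Ht] <-]; apply: ereal_inf_lbound.
  by exists t => //; rewrite /value mem_set.
have mvalue t : measurable_fun setT (value t).
  apply: measurable_fun_ifT => //; apply: (measurable_fun_bool true).
  by rewrite setTI preimage_mem_true.
exact: (measurable_fun_einfs mvalue 1%N).
Qed.

Lemma ae_hitting : (\int[P]_om hitting_time om < +oo)%E ->
  {ae P, forall om, exists2 t, (1 <= t)%N & H t om}.
Proof.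
move=> time_lty; have itime : P.-integrable setT hitting_time.
  apply/integrableP; split; first exact: measurable_hitting_time.
  by under eq_integral do rewrite gee0_abs ?hitting_time_ge0//.
apply: filterS (integrable_ae measurableT itime) => om /(_ Logic.I) time_fin.
apply: contrapT => never; move: time_fin; rewrite /hitting_time.
rewrite (_ : [set _ | _ in _] = set0) ?ereal_inf0//.
by apply/seteqP; split=> // y [t [t1 Ht] _]; apply: never; exists t.
Qed.

End HittingTime.

Section IidCoordinates.
Variables (R : realType) (n : nat) (d : measure_display) (T : measurableType d).
Variables (P : probability T R) (A : nat -> T -> 'cV[R]_n) (i : 'I_n).
Hypothesis iidA : iid P A.

Let only (B : set R) (j : 'I_n) : set R := if j == i then B else setT.

Let measurable_only B j : measurable B -> measurable (only B j).
Proof. by rewrite /only; case: ifP. Qed.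

Let only_coordinate t B : [set om | forall j, only B j (A t om j 0)] =
  (fun om => A t om i 0) @^-1` B.
Proof.
apply/seteqP; split=> om /=; first by move=> /(_ i); rewrite /only eqxx.
by move=> Bom j; rewrite /only; case: eqP => // ->.
Qed.

Lemma iid_coordinate_ident t (B : set R) : measurable B ->
  P ((fun om => A t om i 0) @^-1` B) = P ((fun om => A 0%N om i 0) @^-1` B).
Proof.
by move=> mB; rewrite -!only_coordinate; apply: iidA.2 => j; exact: measurable_only.
Qed.

Lemma iid_coordinate_independent s t : s != t ->
  independent_pair P (fun om => A s om i 0) (fun om => A t om i 0).
Proof.
move=> st B C mB mC.
pose test u : 'I_n -> set R := if u == s then only B else if u == t then only C else fun=> setT.
have test_s : test s = only B by rewrite /test eqxx.
have test_t : test t = only C by rewrite /test eq_sym (negPf st) eqxx.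
have mtest u j : measurable (test u j).
  by rewrite /test; case: ifP => _; [|case: ifP => _ //]; exact: measurable_only.
have sM : (s < (maxn s t).+1)%N by rewrite ltnS leq_maxl.
have tM : (t < (maxn s t).+1)%N by rewrite ltnS leq_maxr.
have := iidA.1 (maxn s t).+1 test mtest.
rewrite (_ : [set om | _] = (fun om => A s om i 0) @^-1` B `&` (fun om => A t om i 0) @^-1` C).
  move=> ->; rewrite (bigD1 (Ordinal sM))//= (bigD1 (Ordinal tM))/=; last first.
    by rewrite -(inj_eq val_inj) /= eq_sym.
  rewrite test_s test_t !only_coordinate big1 ?mule1// => u /andP[us ut].
  rewrite -(probability_setT P); congr (P _); apply/seteqP; split=> // om _ j.
  rewrite -!(inj_eq val_inj) /= in us ut.
  by rewrite /test (negPf us) (negPf ut).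
rewrite -!only_coordinate -test_s -test_t; apply/seteqP; split=> [om omA|om [As At] u j _].
  by split=> j; exact: omA.
by rewrite /test; case: eqP => [->|_]; [|case: eqP => [->|//]]; rewrite -?test_s -?test_t.
Qed.

End IidCoordinates.

Section SubInvariantService.
Variables (R : realType) (n : nat).
Implicit Types (y lam rho : 'cV[R]_n) (Rm : 'M[R]_n).

(* Knaster-Tarski for the monotone map [y |-> lam + Rm y] on the box [0, rho]. *)
Lemma routing_fixpoint Rm lam rho : (forall i j, 0 <= Rm i j) ->
  nonneg lam -> nonneg rho -> (forall i, lam i 0 <= ((1%:M - Rm) *m rho) i 0) ->
  exists2 y, lam = (1%:M - Rm) *m y & forall i, 0 <= y i 0 <= rho i 0.
Proof.
move=> R0 lam0 rho0 lamrho; pose F y := lam + Rm *m y.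
have Fmono (y z : 'cV[R]_n) : (forall i, y i 0 <= z i 0) -> forall i, F y i 0 <= F z i 0.
  by move=> yz i; rewrite !mxE lerD2l; apply: ler_sum => j _; exact: ler_wpM2l.
pose D : set 'cV[R]_n := [set y | [/\ nonneg y, forall i, y i 0 <= rho i 0 &
  forall i, F y i 0 <= y i 0]].
have Drho : D rho by split=> // i; have := lamrho i; rewrite /F mulmxBl mul1mx !mxE; lra.
pose l : 'cV[R]_n := \col_i inf [set y i 0 | y in D].
have hinf i : has_inf [set y i 0 | y in D].
  by split; [exists (rho i 0), rho|exists 0 => _ [y [y0 _ _] <-]].
have l_le (y : 'cV[R]_n) i : D y -> l i 0 <= y i 0.
  by move=> Dy; rewrite mxE; apply: ge_inf; [exact: (hinf i).2|exists y].
have l_ge (z : R) i : (forall y, D y -> z <= y i 0) -> z <= l i 0.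
  by move=> zy; rewrite mxE; apply: lb_le_inf (hinf i).1 _ => _ [y Dy <-]; exact: zy.
have Fl i : F l i 0 <= l i 0.
  apply: l_ge => y Dy; have [_ _ Fy] := Dy; apply: le_trans (Fy i).
  by apply: Fmono => j; exact: l_le.
have l0 : nonneg l by move=> i; apply: l_ge => y [].
have lrho i : l i 0 <= rho i 0 by exact: l_le.
have DFl : D (F l).
  split=> [i|i|]; last exact: Fmono; last exact: le_trans (Fl i) (lrho i).
  by rewrite !mxE addr_ge0//; apply: sumr_ge0 => j _; exact: mulr_ge0.
have lE : l = F l by apply/colP => i; apply/eqP; rewrite eq_le Fl l_le.
exists l => [|i]; last by rewrite l0 lrho.
by rewrite mulmxBl mul1mx {1}lE /F addrK.
Qed.

End SubInvariantService.

Section Capacity.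
Variables (R : realType) (n : nat) (Rm : 'M[R]_n) (S : seq 'cV[R]_n).
Hypothesis net : network_ok Rm S.
Implicit Types (x rho lam : 'cV[R]_n) (A : nat -> 'cV[R]_n) (pi : 'cV[R]_n -> 'cV[R]_n).

Lemma pol_queue_nonneg pi A x t : (forall x, pi x \in S) ->
  (forall t, nonneg (A t)) -> nonneg x -> nonneg (pol_queue Rm pi A x t).
Proof. by move=> piS A0 x0; elim: t => //= t IH; exact: (qstep_nonneg net). Qed.

Lemma pol_queueE pi A x t : pol_queue Rm pi A x t = x + \sum_(s < t) A s -
  (1%:M - Rm) *m \sum_(s < t) cmin (pi (pol_queue Rm pi A x s)) (pol_queue Rm pi A x s).
Proof.
elim: t => [|t IH]; first by rewrite !big_ord0 mulmx0 subr0 addr0.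
rewrite /= !big_ord_recr /= /qstep; set q := pol_queue _ _ _ _ t in IH *.
rewrite {1}IH -(opprB 1%:M Rm) mulNmx mulmxDr; apply/colP => i; rewrite !mxE; ring.
Qed.

Lemma pol_queue_return_hull_le pi A x lam (M : R) t : (forall x, pi x \in S) ->
  (forall t, nonneg (A t)) -> nonneg x -> (0 < t)%N ->
  norm2 (pol_queue Rm pi A x t) <= M ->
  (forall i, lam i 0 * t%:R + M <= x i 0 + \sum_(s < t) A s i 0) ->
  exists2 rho, hull S rho & forall i, lam i 0 <= ((1%:M - Rm) *m rho) i 0.
Proof.
move=> piS A0 x0 t0 qM arrivals; pose q s := pol_queue Rm pi A x s.
have tR : 0 < t%:R :> R by rewrite ltr0n.
exists (\sum_(s <- index_enum 'I_t) t%:R^-1 *: cmin (pi (q s)) (q s)).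
  apply: hull_comb => [s _||s _]; first by rewrite invr_ge0.
    by rewrite sumr_const card_ord -[_ *+ _]mulr_natl divff// gt_eqF.
  exact/(cmin_hull net)/pol_queue_nonneg.
move=> i; rewrite -scaler_sumr -scalemxAr mxE mulrC ler_pdivlMr//.
have := le_trans (ler_norm _) (le_trans (coord_le_norm2 _ i) qM).
by have := arrivals i; rewrite pol_queueE !mxE summxE; lra.
Qed.

(* The policy is not assumed measurable, so a return time need not be a
   stopping time and Wald's identity is not available; the argument is pathwise,
   on one sample path that returns and obeys the lower law of large numbers. *)
Lemma supportable_hull_le lam (eta : R) : supportable Rm S lam -> 0 < eta ->
  exists2 rho, hull S rho & forall i, lam i 0 - eta <= ((1%:M - Rm) *m rho) i 0.
Proof.
move=> [d [T [P [A [pi [[mA A0] [iidA [meanA [piS [mQ [M ret]]]]]]]]]]] eta0.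
pose q k om := pol_queue Rm pi (A^~ om) (const_mx k%:R).
have start0 k : nonneg (const_mx k%:R : 'cV[R]_n) by move=> i; rewrite mxE.
have lower : {ae P, forall om, forall i, exists K, forall t,
    (lam i 0 - eta) * t%:R - K <= \sum_(s < t) A s om i 0}.
  apply: filter_forall => i; pose X t : {RV P >-> R} := mfun_Sub (mem_set (mA t i)).
  apply: (@lower_law_of_large_numbers _ _ _ P X) eta0 => [t om|||].
  - exact: A0.
  - by rewrite unlock; exact: meanA.
  - exact: iid_coordinate_ident.
  - exact: iid_coordinate_independent.
have returns : {ae P, forall om, forall k, exists2 t, (1 <= t)%N & norm2 (q k om t) <= M}.
  apply: ae_foralln => k; apply: ae_hitting => [t|]; last exact: ret.
  rewrite -[X in measurable X]setTI; apply: measurable_fun_le => //.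
  under eq_fun do rewrite -[q k _ t]subr0; apply: measurable_norm2B => i; exact: mQ.
have P_gt0 : (0 < P setT)%E by rewrite probability_setT lte_fin.
have aeP := ae_properfilter_algebraOfSetsType P_gt0.
have [om [/choice[K lower_om] returns_om]] := filter_ex (filterI lower returns).
have [t t1 qM] := returns_om (Num.truncn (M + \sum_i `|K i|)).+1.
have [i|rho hull_rho rho_ge] :=
  pol_queue_return_hull_le (lam := lam - const_mx eta) piS (A0^~ om) (start0 _) t1 qM.
  have := lower_om i t; have := truncnS_gt (M + \sum_i `|K i|).
  have : K i <= \sum_i `|K i|.
    by rewrite (le_trans (ler_norm _))// (bigD1 i)//= lerDl sumr_ge0.
  rewrite !mxE; lra.
by exists rho => // i; have := rho_ge i; rewrite !mxE.
Qed.

Lemma supportable_nonneg lam : supportable Rm S lam -> nonneg lam /\ S != [::].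
Proof.
move=> [d [T [P [A [pi [[mA A0] [_ [meanA [piS _]]]]]]]]]; split.
  by move=> i; rewrite -lee_fin -meanA integral_ge0// => om _; rewrite lee_fin; exact: A0.
by apply/eqP => S0; have := piS 0; rewrite S0.
Qed.

Lemma capacity_nonneg lam : capacity_region Rm S lam -> nonneg lam /\ S != [::].
Proof.
move=> cap; split; last by have [lam' [/supportable_nonneg[]]] := cap 1 ltr01.
move=> i; apply/ler_addgt0Pr => e e0.
have [lam' [/supportable_nonneg[/(_ i) l0 _] dl]] := cap e e0.
have := le_trans (coord_le_norm2 (lam - lam') i) (ltW dl).
rewrite !mxE ler_norml => /andP[]; lra.
Qed.

Definition deficit lam rho : R := \sum_i Num.max 0 (lam i 0 - ((1%:M - Rm) *m rho) i 0).

Lemma deficit_continuous lam : continuous (deficit lam).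
Proof.
apply: sum_continuous => i x.
apply: (@continuous_max _ _ (cst 0) (fun y => lam i 0 - ((1%:M - Rm) *m y) i 0)).
  exact: cst_continuous.
apply: continuousB; first exact: cst_continuous.
apply: (@continuous_comp _ _ _ (mulmx (1%:M - Rm)) (fun z => z i 0)).
  exact: mulmx_continuous.
exact: coord_continuous.
Qed.

Lemma deficit_le0 lam rho : deficit lam rho <= 0 ->
  forall i, lam i 0 <= ((1%:M - Rm) *m rho) i 0.
Proof.
move=> def0 i; have def_ge0 j : 0 <= Num.max 0 (lam j 0 - ((1%:M - Rm) *m rho) j 0).
  by rewrite le_max lexx.
rewrite -subr_le0; apply: le_trans def0; rewrite /deficit (bigD1 i)//=.
by rewrite (le_trans (_ : _ <= Num.max 0 (lam i 0 - ((1%:M - Rm) *m rho) i 0)))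
  ?le_max ?lexx ?orbT// lerDl sumr_ge0.
Qed.

Lemma capacity_deficit_le lam (e : R) : capacity_region Rm S lam -> 0 < e ->
  exists2 rho, hull S rho & deficit lam rho <= e.
Proof.
move=> cap e0; have slack0 : 0 < e / n.+1%:R / 2 by rewrite !divr_gt0.
have [lam' [sup near_lam]] := cap _ slack0.
have [rho hull_rho rho_ge] := supportable_hull_le sup slack0; exists rho => //.
apply: (@le_trans _ _ (\sum_(i < n) (e / n.+1%:R))); last first.
  by rewrite sumr_const card_ord -[_ *+ n]mulr_natl mulrCA ger_pMr// ler_pdivrMr// mul1r ler_nat.
apply: ler_sum => i _; rewrite ge_max divr_ge0 ?(ltW e0)//=.
have := le_trans (coord_le_norm2 (lam - lam') i) (ltW near_lam).
have := rho_ge i; rewrite [(lam - lam') i 0]mxE [(- lam') i 0]mxE ler_norml.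
by move: (e / n.+1%:R) => e'; lra.
Qed.

Lemma capacity_sustainable lam : capacity_region Rm S lam -> sustainable Rm S lam.
Proof.
move=> cap; have [lam0 S0] := capacity_nonneg cap.
have hull0 : hull S !=set0.
  by have [rho hull_rho _] := capacity_deficit_le cap ltr01; exists rho.
have [rho hull_rho rho_min] := compact_EVT_min hull0 (hull_compact (S := S))
  (continuous_subspaceT (@deficit_continuous lam)).
rewrite inE in hull_rho.
have rho_ge : forall i, lam i 0 <= ((1%:M - Rm) *m rho) i 0.
  apply: deficit_le0; apply/ler_addgt0Pr => e e0; rewrite add0r.
  have [rho' hull_rho' def_le] := capacity_deficit_le cap e0.
  by apply: le_trans def_le; apply: rho_min; rewrite inE.
have [y lamE yrho] := routing_fixpoint net.1 lam0 (hull_nonneg net hull_rho) rho_ge.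
by exists y => //; exact: (hull_le net hull_rho).
Qed.

End Capacity.

(** * State space collapse *)

Section StateSpaceCollapse.
Variables (R : realType) (n : nat) (Rm : 'M[R]_n) (S : seq 'cV[R]_n) (w lam : 'cV[R]_n)
  (Tend : R) (lamr : nat -> 'cV[R]_n) (f : nat -> R -> R) (g : nat -> R)
  (d : nat -> measure_display) (Om : forall r, measurableType (d r))
  (P : forall r, probability (Om r) R)
  (A : forall r, nat -> Om r -> 'cV[R]_n)
  (Q : forall r, nat -> Om r -> 'cV[R]_n) (Q0 : nat -> 'cV[R]_n).
Hypotheses (net : network_ok Rm S) (w_gt0 : pos_weights w) (cap : capacity_region Rm S lam)
  (T0 : 0 <= Tend) (f0 : forall r e, 0 <= e -> 0 <= f r e)
  (g_growth : (0 < limn_einf (fun r => (g r / r%:R)%:E))%E)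
  (tailed : f_tailed f P A lamr lam) (Q00 : forall r, nonneg (Q0 r))
  (queues : queue_processes Rm S w A Q Q0)
  (start : (dist_set ((r%:R)^-1 *: Q0 r) (invariant_states Rm S w lam)) @[r --> \oo] --> 0).
Local Notation I := (invariant_states Rm S w lam).
Local Notation far r delta := (fine (P r (far_event g r (@Q r) I Tend delta))).

Let sus : sustainable Rm S lam := capacity_sustainable net cap.
Let IE : I = inv_cone Rm S w lam := invariant_statesE net w_gt0 sus.

Lemma far_rate (delta e : R) (h : nat -> nat) : 0 < e -> (forall r, r <= 4 * h r)%N ->
  (\forall r \near \oo, forall om,
    regular_windows g Tend r ((@A r)^~ om) (lamr r) (h r) e ->
    forall k, (k <= horizon g Tend r)%N -> dist_set (@Q r k om) I <= delta * r%:R) ->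
  (r%:R * f r e / g r * far r delta) @[r --> \oo] --> 0.
Proof.
move=> e0 rh regular_close; have growth := limn_einf_gt0_near g_growth.
apply: (far_prob_cvg T0 _ _ _ growth rh _ (tailed.2.2 e e0)) => [r|r|r|].
- exact/f0/ltW.
- exact: fine_ge0.
- exact: fine_ge0.
near=> r; have r0 : (0 < r)%N by near: r; exact: nbhs_infty_gt.
have g0 : 0 < g r.
  near: r; case: growth => c c0; apply: filterS2 (nbhs_infty_gt 0) => k k0 ck.
  by rewrite -(pmulr_lgt0 _ (_ : 0 < k%:R^-1)) ?invr_gt0 ?ltr0n// (lt_le_trans c0).
have [arr [stat _]] := tailed.1 r; have h0 : (0 < h r)%N by have := rh r; lia.
rewrite IE; apply: (far_event_prob_le g0 T0 r0 _ _ (queues r).1 arr stat h0).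
- exact: inv_cone_neq0.
- by move=> b x b0; apply: inv_coneZ; exact: ltW.
- by rewrite -IE; near: r.
Unshelve. all: end_near. Qed.

Lemma initial_near (eta : R) : 0 < eta ->
  \forall r \near \oo, dist_set (Q0 r) I <= eta * r%:R.
Proof.
move=> eta0; have /cvgrPdist_lt/(_ _ eta0) := start.
apply: filterS2 (nbhs_infty_gt 0) => r r0; rewrite IE.
rewrite sub0r normrN ger0_norm ?dist_set_ge0// dist_inv_coneZ ?invr_gt0 ?ltr0n//.
by rewrite mulrC ltr_pdivrMr ?ltr0n// => /ltW.
Qed.

Lemma far_rate_exists (delta : R) : 0 < delta -> exists2 e, 0 < e &
  (r%:R * f r e / g r * far r delta) @[r --> \oo] --> 0.
Proof.
move=> delta0; have [th th0 [e e0 stay]] := windows_stay_close net w_gt0 sus delta0.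
exists e => //; apply: (@far_rate delta e id) => // [r|]; first by rewrite leq_pmull.
near=> r => om regular k kM; have [QE path] := (queues r).2 om.
have [[_ A0] _] := tailed.1 r; rewrite IE.
apply: (near stay r _ g Tend ((@A r)^~ om) ((@Q r)^~ om) (lamr r)) => //.
- by rewrite QE.
- by near: r; exact: norm2_cvg tailed.2.1.
- by rewrite QE -IE; near: r; exact: initial_near.
Unshelve. all: end_near. Qed.

Lemma far_prob_cvg0 (delta : R) :
  (forall e, 0 < e -> (0 < limn_einf (fun r => (r%:R * f r e / g r)%:E))%E) ->
  0 < delta -> far r delta @[r --> \oo] --> 0.
Proof.
move=> rf_growth /far_rate_exists[e e0 rate].
have [c c0 rfc] := limn_einf_gt0_near (rf_growth e e0).
have bound : (c^-1 * (r%:R * f r e / g r * far r delta)) @[r --> \oo] --> 0.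
  by rewrite -(mulr0 c^-1); apply: cvgMl_tmp rate.
apply: squeeze_cvgr (cvg_cst 0) bound.
near=> r; rewrite fine_ge0//= -ler_pdivrMl ?invr_gt0// invrK.
by rewrite ler_wpM2r ?fine_ge0//; near: r.
Unshelve. all: end_near. Qed.

Lemma far_rate_mw (C alpha delta e : R) : w = ones R n -> sensitivity_const Rm S C ->
  attraction_const Rm S lam alpha -> 0 < delta -> 0 < e ->
  e <= Num.min delta alpha / (2 * C) ->
  (r%:R * f r e / g r * far r delta) @[r --> \oo] --> 0.
Proof.
move=> wE sens attr delta0 e0; have [lam0 S0] := capacity_nonneg cap.
have [C0 alpha0] := (sens.1, attr.1).
rewrite ler_pdivlMr ?mulr_gt0// le_min => /andP[e_delta e_alpha].
apply: (@far_rate delta e (fun r => (r %/ 4).+1)) => [//|r|].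
  by rewrite mulnC ltnW// -ltn_divLR.
pose eta := Num.min delta alpha / 4; pose e' := eta / (4 * C).
have eta0 : 0 < eta by rewrite divr_gt0// lt_min delta0.
have eta_delta : eta <= delta / 4 by rewrite ler_pM2r ?ge_min ?lexx// invr_gt0.
have eta_alpha : eta <= alpha / 4 by rewrite ler_pM2r ?ge_min ?lexx ?orbT// invr_gt0.
have e'0 : 0 < e' by apply: divr_gt0 => //; exact: mulr_gt0.
have Ce' : C * e' = eta / 4 by rewrite /e'; field; rewrite gt_eqF.
have noise : \forall r \near \oo,
    C * (1 + norm2 lam + r.+1%:R * norm2 (lamr r - lam)) <= eta * r%:R.
  near=> r; have rge : (1 + norm2 lam) / e' <= r%:R by near: r; exact: nbhs_infty_ger.
  have lamr_near : norm2 (lamr r - lam) < e' by near: r; exact: norm2_cvg tailed.2.1.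
  have r1 : 1 <= r%:R :> R by rewrite ler1n; near: r; exact: nbhs_infty_gt.
  have : r.+1%:R * norm2 (lamr r - lam) <= (r%:R + r%:R) * e'.
    by rewrite ler_pM ?norm2_ge0 ?(ltW lamr_near)// -natr1; lra.
  rewrite ler_pdivrMr// in rge => drift.
  apply: (@le_trans _ _ (C * (3 * r%:R * e'))); first by rewrite ler_pM2l//; lra.
  have -> : C * (3 * r%:R * e') = 3 * r%:R * (C * e') by ring.
  by rewrite Ce'; nra.
near=> r => om regular k kM; have [QE path] := (queues r).2 om; have [[_ A0] _] := tailed.1 r.
have Cer : C * e + eta <= 3 / 4 * delta /\ C * e + eta <= 3 / 4 * alpha by split; lra.
have Q0I : dist_set (@Q r 0%N om) I <= eta * r%:R by rewrite QE; near: r; exact: initial_near.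
have I0 : I !=set0 by rewrite IE; exact: inv_cone_neq0.
rewrite wE in I0 Q0I path *; apply: (mw_windows_stay_close net lam0 S0 I0 sens attr path
  (A0^~ om) _ _ _ regular Cer.1 Cer.2 eta_delta Q0I delta0 kM).
- by rewrite QE.
- by near: r; exact: nbhs_infty_ge.
- by near: r.
Unshelve. all: end_near. Qed.

End StateSpaceCollapse.

(** * Bursty arrivals *)

Section UniformPhase.
Variables (R : realType) (N : nat).

Lemma inv_natS_ge0 : 0 <= (N.+1%:R^-1 : R).
Proof. by rewrite invr_ge0. Qed.

Definition unif : set nat -> \bar R :=
  mscale (NngNum inv_natS_ge0) (msum (fun k : nat => \d_k) N.+1).

HB.instance Definition _ := Measure.on unif.

Lemma unifE (E : set nat) :
  unif E = (N.+1%:R^-1 * \sum_(k < N.+1) (nat_of_ord k \in E)%:R)%:E.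
Proof. by rewrite /unif /mscale /msum /= EFinM -sumEFin. Qed.

Lemma unif_full (E : set nat) : (forall k, (k <= N)%N -> E k) -> unif E = 1%E.
Proof.
move=> NE; rewrite unifE (eq_bigr (fun=> 1)) => [|k _]; last first.
  by rewrite mem_set//; apply: NE; rewrite -ltnS.
by rewrite sumr_const card_ord mulVf.
Qed.

Lemma unif_setT : unif setT = 1%E.
Proof. exact: unif_full. Qed.

HB.instance Definition _ := Measure_isProbability.Build _ _ _ unif unif_setT.

Definition unif_prob : probability nat R := unif.

Lemma unif_rotate (E : set nat) k : unif [set om | E ((om + k) %% N.+1)%N] = unif E.
Proof.
rewrite !unifE; congr (_ * _)%:E.
rewrite [RHS](reindex_inj (addIr (inZp k : 'I_N.+1))) /=.
apply: eq_bigr => om _; congr (nat_of_bool _)%:R.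
by apply/idP/idP; rewrite !inE /= modnDmr.
Qed.

Lemma unif_integral (h : nat -> R) : (forall k, 0 <= h k) ->
  (\int[unif_prob]_om (h om)%:E = (N.+1%:R^-1 * \sum_(k < N.+1) h k)%:E)%E.
Proof.
move=> h0; rewrite /unif_prob /unif ge0_integral_mscale//=; last by move=> k _; rewrite lee_fin.
rewrite ge0_integral_measure_sum// ?EFinM; last by move=> k _; rewrite lee_fin.
congr (_ * _)%E; rewrite -sumEFin; apply: eq_bigr => k _.
by rewrite integral_dirac// diracT mul1e.
Qed.

Definition is_burst (t om : nat) : bool := (N.+1 %| t + om)%N.

Lemma sum_is_burst0 : \sum_(k < N.+1) (is_burst 0 k)%:R = 1 :> R.
Proof.
rewrite (bigD1 ord0)// big1 => [|k /= k0]; first by rewrite /is_burst dvdn0 /= addr0.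
by rewrite -(inj_eq val_inj) /= -lt0n in k0; rewrite /is_burst add0n gtnNdvd.
Qed.

Lemma is_burst_prob t : unif [set om | is_burst t om] = (N.+1%:R^-1)%:E.
Proof.
rewrite (_ : mkset _ = [set om | [set k | is_burst 0 k] ((om + t) %% N.+1)%N]).
  rewrite unif_rotate unifE (eq_bigr (fun k => (is_burst 0 (nat_of_ord k))%:R)) => [|k _].
    by rewrite sum_is_burst0 mulr1.
  by congr (nat_of_bool _)%:R; apply/idP/idP; rewrite inE.
by apply/seteqP; split=> om; rewrite /is_burst /= add0n /dvdn modn_mod addnC.
Qed.

Lemma first_burstP om : (om <= N)%N -> exists t0,
  [/\ (t0 <= N)%N, is_burst t0 om & forall t, (t < t0)%N -> ~~ is_burst t om].
Proof.
rewrite /is_burst; case: om => [_|om omN]; first by exists 0%N; split=> //; rewrite dvdn0.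
exists (N - om)%N; split=> [||t tN]; first exact: leq_subr.
  by rewrite addnS subnK// ltnW.
by rewrite gtnNdvd// addnS// ltnS addnC -ltn_subRL.
Qed.

End UniformPhase.

Section NoninvariantStates.
Variables (R : realType) (n : nat) (Rm : 'M[R]_n) (S : seq 'cV[R]_n) (w lam : 'cV[R]_n).
Hypotheses (net : network_ok Rm S) (w_gt0 : pos_weights w).
Local Notation K := (inv_cone Rm S w lam).

Lemma dominating_extreme_point (D : set 'cV[R]_n) : D lam ->
  (forall y, D y -> forall i, y i 0 <= lam i 0) -> extreme_point D lam.
Proof.
move=> Dlam dom; split=> // y z th Dy Dz /andP[th0 th1] lamE.
have convE i : lam i 0 = th * y i 0 + (1 - th) * z i 0 by rewrite {1}lamE !mxE.
by split; apply/colP => i; apply/eqP; rewrite eq_le dom//= leNgt; apply/negP => lt_lam;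
  have := convE i; have := dom _ Dy i; have := dom _ Dz i; nra.
Qed.

Lemma inv_cone_full_dominates : (forall u, nonneg u -> K u) ->
  forall y, capacity_region Rm S y -> forall i, y i 0 <= lam i 0.
Proof.
move=> full y /(capacity_sustainable net)[rho hull_rho ->] i.
have delta0 : nonneg (delta_mx i 0 : 'cV[R]_n) by move=> j; rewrite mxE ler0n.
have := hull_wobj_le (full _ delta0).2 hull_rho.
by rewrite wobjE !dotw_delta ler_pM2l.
Qed.

Lemma noninvariant_exists : capacity_region Rm S lam ->
  ~ extreme_point (capacity_region Rm S) lam ->
  exists2 u, nonneg u & 0 < dist_set u K.
Proof.
move=> cap not_extreme; apply: contrapT => none; apply: not_extreme.
apply: dominating_extreme_point cap (inv_cone_full_dominates _) => u u0.
apply: closed_dist_set_eq0; [exact: inv_cone_closed|exact: inv_cone_neq0|].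
apply/eqP; rewrite eq_le dist_set_ge0 andbT leNgt; apply/negP => du.
by apply: none; exists u.
Qed.

End NoninvariantStates.

Section BurstArrivals.
Variables (R : realType) (n : nat) (lam u : 'cV[R]_n) (N : nat) (b : R).
Hypotheses (lam0 : nonneg lam) (u0 : nonneg u) (b0 : 0 <= b).

Definition burst_arrival (t om : nat) : 'cV[R]_n := lam + ((is_burst N t om)%:R * b) *: u.

Definition burst_mean : 'cV[R]_n := lam + (b / N.+1%:R) *: u.

Lemma burst_arrival_nonneg t om : nonneg (burst_arrival t om).
Proof. by move=> i; rewrite !mxE addr_ge0 ?mulr_ge0. Qed.

Lemma burst_stationary : stationary_with_mean (unif_prob R N) burst_arrival burst_mean.
Proof.
split; [|split].
- by split=> [t i|t om]; [|exact: burst_arrival_nonneg].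
- move=> k m B mB.
  have rotE t om : burst_arrival t ((om + k) %% N.+1) = burst_arrival (t + k) om.
    by rewrite /burst_arrival /is_burst /dvdn modnDmr addnCA [(om + _)%N]addnC.
  rewrite -[RHS](unif_rotate _ _ _ k); congr (unif_prob _ _ _).
  by apply/seteqP; split=> om /= omB t i tm; have := omB t i tm; rewrite rotE.
- move=> i; rewrite unif_integral; last by move=> k; exact: burst_arrival_nonneg.
  congr EFin; rewrite (eq_bigr (fun k : 'I_N.+1 =>
     lam i 0 + (b * u i 0) * (is_burst N 0 k)%:R)) => [|k _]; last by rewrite !mxE; ring.
  rewrite big_split /= sumr_const card_ord -mulr_sumr sum_is_burst0 mulr1 !mxE.
  rewrite mulrDr -[lam i 0 *+ _]mulr_natl mulKf ?pnatr_eq0//; congr (_ + _).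
  by rewrite mulrC mulrAC.
Qed.

Lemma no_burst_cumdev k om l : (forall t, (t < k)%N -> ~~ is_burst N t om) -> (l <= k)%N ->
  cumdev lam (burst_arrival^~ om) l = 0.
Proof.
move=> quiet_until lk; rewrite /cumdev big1// => t _.
rewrite /burst_arrival (negPf (quiet_until _ (leq_trans (ltn_ord t) lk))).
by rewrite mul0r scale0r addr0 subrr.
Qed.

Lemma no_burst_max_dev k om : (forall t, (t < k)%N -> ~~ is_burst N t om) ->
  max_dev (burst_arrival^~ om) burst_mean k <= k%:R * (b / N.+1%:R * norm2 u).
Proof.
move=> quiet_until; apply: le_trans (max_dev_change _ burst_mean lam (leqnn k)) _.
have -> : lam - burst_mean = - ((b / N.+1%:R) *: u) by rewrite /burst_mean opprD addrA subrr add0r.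
rewrite norm2N norm2Z ger0_norm ?divr_ge0// gerDr; apply/bigmax_leP; split=> // t _.
by have := no_burst_cumdev quiet_until (ltn_ord t); rewrite /cumdev => ->; rewrite norm2_0.
Qed.

Lemma burst_tail_le k (a : R) : k%:R * (b / N.+1%:R * norm2 u) <= a ->
  fine (unif_prob R N [set om | a < max_dev (burst_arrival^~ om) burst_mean k]) <=
  k%:R / N.+1%:R.
Proof.
move=> small; set loud := [set om | _]; pose burst_at t := [set om | is_burst N t om].
have : (unif_prob R N loud <= \sum_(t < k) unif_prob R N (burst_at t))%E.
  apply: (@content_subadditive _ _ _ (unif_prob R N) loud burst_at) => //.
  move=> om loud_om; rewrite -bigcup_mkord; apply: contrapT => no_burst.
  have {}no_burst t : (t < k)%N -> ~~ is_burst N t om.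
    by move=> tk; apply/negP => burst; apply: no_burst; exists t.
  by move: loud_om; rewrite /loud /= ltNge (le_trans (no_burst_max_dev no_burst)).
rewrite (eq_bigr (fun=> (N.+1%:R^-1)%:E)) => [|t _]; last exact: is_burst_prob.
rewrite sumEFin -[unif_prob _ _ _]fineK ?fin_num_measure// lee_fin.
by rewrite sumr_const card_ord -[_ *+ k]mulr_natl.
Qed.

End BurstArrivals.

Section BurstJump.
Variables (R : realType) (n : nat) (Rm : 'M[R]_n) (S : seq 'cV[R]_n) (w lam : 'cV[R]_n).
Hypotheses (net : network_ok Rm S) (w_gt0 : pos_weights w) (sus : sustainable Rm S lam).
Local Notation K := (inv_cone Rm S w lam).

Lemma steady_deviation A Q k : wmw_queue Rm S w A Q -> K (Q 0%N) -> quiet lam A k 0 ->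
  min_weight w * norm2 (Q k - Q 0%N) ^+ 2 <= k%:R * step_cost Rm S w lam.
Proof.
move=> queue K0 steady; have [c c0 err] := inv_cone_error_bound w sus.
have := lyapunov_sum net w_gt0 err queue K0 steady.
have -> : cumdev lam A k = 0.
  by apply/eqP; rewrite -norm2_eq0 eq_le norm2_ge0 steady.
rewrite !subr0 subrr dotw0l mulr0 !add0r => energy.
apply: le_trans (norm2_le_dotw _ _) (le_trans _ energy).
by rewrite lerDl !mulr_ge0 ?(ltW c0)// sumr_ge0// => l _; exact: dist_set_ge0.
Qed.

Lemma jump_dist q mu u (b : R) : mu \in S -> nonneg q -> 0 < b ->
  b * dist_set u K <=
  dist_set (qstep Rm q (lam + b *: u) mu) K + (norm2 q + max_speed Rm S lam).
Proof.
move=> muS q0 b0; rewrite -dist_inv_coneZ//; set q' := qstep _ _ _ _.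
apply: le_trans (dist_set_leD _ q' (inv_cone_neq0 Rm S w lam)) _; rewrite lerD2l.
rewrite /q' (veloc_qstep _ lam) norm2_distC.
rewrite (_ : _ - _ = q + veloc Rm lam (cmin mu q)); last by apply/colP => i; rewrite !mxE; ring.
by rewrite (le_trans (norm2D _ _))// lerD2l; exact: hull_speed_le (cmin_hull net muS q0).
Qed.

Lemma burst_jump u N (b : R) om Q : nonneg lam -> nonneg u -> 0 < b -> (om <= N)%N ->
  wmw_path Rm S w (burst_arrival lam u N b ^~ om) Q -> K (Q 0%N) ->
  exists2 k, (k <= N.+1)%N & exists2 dev : R,
    min_weight w * dev ^+ 2 <= N%:R * step_cost Rm S w lam &
    b * dist_set u K <= dist_set (Q k) K + (dev + norm2 (Q 0%N) + max_speed Rm S lam).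
Proof.
move=> lam0 u0 b0 omN path K0; have [t0 [t0N burst before]] := first_burstP omN.
have queue : wmw_queue Rm S w (burst_arrival lam u N b ^~ om) Q.
  split=> //; apply: (wmw_path_nonneg net path _ K0.1) => t.
  exact/burst_arrival_nonneg/ltW.
exists t0.+1 => //; exists (norm2 (Q t0 - Q 0%N)).
  apply: le_trans (steady_deviation queue K0 _) _.
    by move=> l lt0; rewrite (no_burst_cumdev _ _ _ before)// norm2_0.
  by rewrite ler_wpM2r ?ler_nat// step_cost_ge0.
have [mu [choice_mu ->]] := path t0.
rewrite /burst_arrival burst mul1r.
apply: le_trans (jump_dist u choice_mu.1 (queue.2 t0) b0) _; rewrite lerD2l lerD2r.
by rewrite -{1}(subrK (Q 0%N) (Q t0)) norm2D.
Qed.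

End BurstJump.

Section BurstScales.
Variables (R : realType) (g : nat -> R) (Tend : R).
Hypotheses (g_superlinear : (g r / r%:R) @[r --> \oo] --> +oo) (T0 : 0 < Tend).

Definition last_phase r : nat := (horizon g Tend r).-1.

Local Notation period r := (last_phase r).+1.

(* Between [r] and [g r] in order of magnitude, so that one burst per period is
   visible at scale [r] while the mean is unchanged in the limit; it also
   dominates the drift [sqrt (g r)] accumulated over a period. *)
Definition burst_size r : R := Num.sqrt (r%:R * g r).

Lemma growth_near (a : R) : \forall r \near \oo, a * r%:R <= g r.
Proof.
move/cvgryPge : g_superlinear => /(_ a); apply: filterS2 (nbhs_infty_gt 0) => r r0 ag.
by rewrite -ler_pdivlMr// ltr0n.
Qed.

Lemma period_near : \forall r \near \oo,
  [/\ 0 < g r, period r = horizon g Tend r & g r * Tend / 2 <= (period r)%:R].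
Proof.
near=> r; have r1 : 1 <= r%:R :> R by rewrite ler1n; near: r; exact: nbhs_infty_gt.
have T2 : 0 < 2 / Tend by rewrite divr_gt0.
have rg : 2 / Tend * r%:R <= g r by near: r; exact: growth_near.
have gT : 2 <= g r * Tend by rewrite -ler_pdivrMr// (le_trans _ rg)// ler_peMr// ltW.
have periodE : period r = horizon g Tend r.
  by rewrite /last_phase prednK// /horizon truncn_gt0 (le_trans _ gT)// ler1n.
split=> //; first by apply: lt_le_trans rg; rewrite mulr_gt0// (lt_le_trans ltr01).
have := truncnS_gt (g r * Tend); rewrite periodE /horizon -natr1; lra.
Unshelve. all: end_near. Qed.

Lemma burst_size_near (e : R) : 0 < e -> \forall r \near \oo,
  [/\ 0 < burst_size r, r%:R <= e * burst_size r & burst_size r <= e * g r].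
Proof.
move=> e0; near=> r; have r0 : 0 < r%:R :> R by rewrite ltr0n; near: r; exact: nbhs_infty_gt.
have rg : (e ^+ 2)^-1 * r%:R <= g r by near: r; exact: growth_near.
rewrite ler_pdivrMl ?exprn_gt0// in rg.
have g0 : 0 < g r by rewrite -(pmulr_rgt0 _ (exprn_gt0 2 e0)) (lt_le_trans r0).
have b0 : 0 < burst_size r by rewrite sqrtr_gt0 mulr_gt0.
have b2 : burst_size r ^+ 2 = r%:R * g r by rewrite sqr_sqrtr// mulr_ge0 ?ltW.
split=> //.
- rewrite -(@ler_pXn2r _ 2%N) ?nnegrE ?mulr_ge0 ?(ltW b0) ?(ltW e0)//.
  by rewrite exprMn b2 mulrCA expr2 ler_pM2l.
- rewrite -(@ler_pXn2r _ 2%N) ?nnegrE ?mulr_ge0 ?(ltW b0) ?(ltW g0) ?(ltW e0)//.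
  by rewrite exprMn b2 [g r ^+ 2]expr2 mulrA ler_pM2r.
Unshelve. all: end_near. Qed.

Lemma burst_rate_cvg : (burst_size r / (period r)%:R) @[r --> \oo] --> (0 : R).
Proof.
apply/cvgrPdist_le => e e0; have eT : 0 < e * Tend / 2 by rewrite divr_gt0 ?mulr_gt0.
near=> r; have [b0 _ bg] : [/\ 0 < burst_size r, r%:R <= e * Tend / 2 * burst_size r
    & burst_size r <= e * Tend / 2 * g r] by near: r; exact: burst_size_near.
have [_ _ period_ge] : [/\ 0 < g r, period r = horizon g Tend r &
    g r * Tend / 2 <= (period r)%:R] by near: r; exact: period_near.
rewrite sub0r normrN ger0_norm ?divr_ge0 ?(ltW b0)// ler_pdivrMr//.
apply: le_trans bg (le_trans _ (ler_wpM2l (ltW e0) period_ge)).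
by rewrite le_eqVlt; apply/orP; left; apply/eqP; ring.
Unshelve. all: end_near. Qed.

End BurstScales.

Section Bursts.
Variables (R : realType) (n : nat) (Rm : 'M[R]_n) (S : seq 'cV[R]_n) (w lam q0 u : 'cV[R]_n).
Variables (f : nat -> R -> R) (g : nat -> R) (Tend : R).
Hypotheses (net : network_ok Rm S) (w_gt0 : pos_weights w) (cap : capacity_region Rm S lam).
Hypotheses (f0 : forall r e, 0 <= e -> 0 <= f r e)
  (rf_small : forall e, 0 < e -> (r%:R * f r e / g r) @[r --> \oo] --> 0)
  (g_superlinear : (g r / r%:R) @[r --> \oo] --> +oo) (T0 : 0 < Tend).
Local Notation I := (invariant_states Rm S w lam).
Local Notation K := (inv_cone Rm S w lam).
Local Notation phase r := (unif_prob R (last_phase g Tend r)).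
Hypotheses (Iq0 : I q0) (u0 : nonneg u) (u_far : 0 < dist_set u K).

Definition bursts r : nat -> nat -> 'cV[R]_n :=
  burst_arrival lam u (last_phase g Tend r) (burst_size g r).

Definition bursts_mean r : 'cV[R]_n := burst_mean lam u (last_phase g Tend r) (burst_size g r).

Let lam0 : nonneg lam := (capacity_nonneg cap).1.
Let sus : sustainable Rm S lam := capacity_sustainable net cap.
Let IE : I = K := invariant_statesE net w_gt0 sus.

Lemma bursts_mean_cvg i : (fun r => bursts_mean r i 0) @ \oo --> lam i 0.
Proof.
have -> : (fun r => bursts_mean r i 0) =
    fun r => lam i 0 + burst_size g r / (last_phase g Tend r).+1%:R * u i 0.
  by apply/funext => r; rewrite !mxE.
rewrite -[X in _ @ _ --> X]addr0 -(mul0r (u i 0)).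
by apply: cvgD; [exact: cvg_cst|apply: cvgMr_tmp; exact: burst_rate_cvg].
Qed.

Lemma bursts_tail (delta : R) : 0 < delta -> \forall r \near \oo,
  fine (phase r [set om | r%:R^-1 * max_dev (bursts r ^~ om) (bursts_mean r) r.+1 > delta]) <=
  4 / Tend * (r%:R / g r).
Proof.
move=> delta0; have u1 : 0 < 2 * (1 + norm2 u) by rewrite mulr_gt0// ltr_pwDl// norm2_ge0.
have rate0 : 0 < delta / (2 * (1 + norm2 u)) by rewrite divr_gt0.
near=> r; have r1 : 1 <= r%:R :> R by rewrite ler1n; near: r; exact: nbhs_infty_gt.
have r0 : 0 < r%:R :> R := lt_le_trans ltr01 r1.
have [g0 _ period_ge] : [/\ 0 < g r, (last_phase g Tend r).+1 = horizon g Tend r &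
    g r * Tend / 2 <= (last_phase g Tend r).+1%:R] by near: r; exact: period_near.
have rate : burst_size g r / (last_phase g Tend r).+1%:R <= delta / (2 * (1 + norm2 u)).
  by near: r; exact: (cvgr_le (0 : R) (burst_rate_cvg g_superlinear T0)).
have -> : [set om | delta < r%:R^-1 * max_dev (bursts r ^~ om) (bursts_mean r) r.+1] =
    [set om | delta * r%:R < max_dev (bursts r ^~ om) (bursts_mean r) r.+1].
  by apply/seteqP; split=> om /=; rewrite ltr_pdivlMl// [_ * delta]mulrC.
have r2 : r.+1%:R <= 2 * r%:R :> R by rewrite -natr1; lra.
apply: le_trans (burst_tail_le lam (sqrtr_ge0 _) _) _.
  have -> : delta * r%:R = 2 * r%:R * (delta / (2 * (1 + norm2 u)) * (1 + norm2 u)).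
    by field; rewrite gt_eqF// ltr_pwDl// norm2_ge0.
  rewrite ler_pM ?mulr_ge0 ?divr_ge0 ?sqrtr_ge0 ?norm2_ge0//.
  by rewrite ler_pM ?divr_ge0 ?sqrtr_ge0 ?norm2_ge0// lerDr.
rewrite ler_pdivrMr ?ltr0n//; apply: (le_trans r2).
apply: (@le_trans _ _ (4 / Tend * (r%:R / g r) * (g r * Tend / 2))).
  by rewrite le_eqVlt; apply/orP; left; apply/eqP; field; rewrite !gt_eqF.
by rewrite ler_wpM2l// mulr_ge0 ?divr_ge0 ?(ltW T0) ?(ltW g0).
Unshelve. all: end_near. Qed.

Lemma bursts_f_tailed : f_tailed f (fun r => phase r) bursts bursts_mean lam.
Proof.
split; [|split; first exact: bursts_mean_cvg].
  by move=> r; apply: burst_stationary => //; exact: sqrtr_ge0.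
move=> delta delta0; have bound : (4 / Tend * (r%:R * f r delta / g r)) @[r --> \oo] --> 0.
  by rewrite -(mulr0 (4 / Tend)); apply: cvgMl_tmp; exact: rf_small.
apply: squeeze_cvgr (cvg_cst 0) bound.
near=> r; have f_ge0 : 0 <= f r delta by exact/f0/ltW.
rewrite mulr_ge0 ?fine_ge0//=.
have -> : 4 / Tend * (r%:R * f r delta / g r) = f r delta * (4 / Tend * (r%:R / g r)) by ring.
by rewrite ler_wpM2l//; near: r; exact: bursts_tail.
Unshelve. all: end_near. Qed.

Lemma bursts_queues : exists Q : nat -> nat -> nat -> 'cV[R]_n,
  queue_processes Rm S w (d := fun=> _) (T := fun=> nat) bursts Q (fun r => r%:R *: q0).
Proof.
have /choice[pi piP] q := wmw_choice_exists Rm w q (capacity_nonneg cap).2.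
exists (fun r t om => pol_queue Rm pi (bursts r ^~ om) (r%:R *: q0) t) => r; split=> // om.
by split=> // t; exists (pi (pol_queue Rm pi (bursts r ^~ om) (r%:R *: q0) t)).
Qed.

Definition drift_gain : R := step_cost Rm S w lam / min_weight w * Tend.

Lemma drift_gain_ge0 : 0 <= drift_gain.
Proof.
by rewrite mulr_ge0 ?divr_ge0 ?(ltW T0)//; [exact: step_cost_ge0|exact/ltW/min_weight_gt0].
Qed.

Lemma drift_before_burst (e : R) : 0 < e -> \forall r \near \oo, forall dev : R,
  min_weight w * dev ^+ 2 <= (last_phase g Tend r)%:R * step_cost Rm S w lam ->
  dev <= (drift_gain + 1) * (e * burst_size g r).
Proof.
move=> e0; have [G0 m0] := (drift_gain_ge0, min_weight_gt0 w_gt0).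
have B0 : 0 <= step_cost Rm S w lam := step_cost_ge0 _ _ _ w_gt0.
near=> r => dev; have e2r : (e ^+ 2)^-1 <= r%:R by near: r; exact: nbhs_infty_ger.
have [g0 periodE _] : [/\ 0 < g r, (last_phase g Tend r).+1 = horizon g Tend r &
    g r * Tend / 2 <= (last_phase g Tend r).+1%:R] by near: r; exact: period_near.
have phase_le : (last_phase g Tend r)%:R <= g r * Tend.
  by rewrite -truncn_ge_nat ?mulr_ge0 ?(ltW g0) ?(ltW T0)// -/(horizon g Tend r) -periodE.
have g_le : g r <= (e * burst_size g r) ^+ 2.
  rewrite exprMn sqr_sqrtr ?mulr_ge0 ?(ltW g0)// mulrA ler_peMl ?(ltW g0)//.
  by rewrite -ler_pdivrMl ?exprn_gt0// mulr1.
rewrite -ler_pdivlMl// => dev_sqr.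
have bound0 : 0 <= (drift_gain + 1) * (e * burst_size g r).
  exact: mulr_ge0 (addr_ge0 G0 ler01) (mulr_ge0 (ltW e0) (sqrtr_ge0 _)).
rewrite (le_trans (ler_norm _))// -(@ler_pXn2r _ 2%N) ?nnegrE//.
rewrite real_normK ?num_real// (le_trans dev_sqr)// exprMn.
apply: (@le_trans _ _ (drift_gain * g r)).
  have -> : drift_gain * g r = (min_weight w)^-1 * (g r * Tend * step_cost Rm S w lam).
    by rewrite /drift_gain; ring.
  by rewrite ler_wpM2l ?invr_ge0 ?(ltW m0)// ler_wpM2r.
by rewrite ler_pM ?(ltW g0)//; nra.
Unshelve. all: end_near. Qed.

Lemma bursts_far Q (delta : R) :
  queue_processes Rm S w (d := fun=> _) (T := fun=> nat) bursts Q (fun r => r%:R *: q0) ->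
  0 < delta -> \forall r \near \oo, forall om, (om <= last_phase g Tend r)%N ->
    far_event g r (Q r) I Tend delta om.
Proof.
move=> queues delta0; pose V := max_speed Rm S lam.
have [[V0 G0] q0_ge0] := (max_speed_ge0 Rm S lam : 0 <= V, drift_gain_ge0, norm2_ge0 q0).
pose swing := delta + norm2 q0 + (drift_gain + 1) + V.
have swing0 : 0 < swing by rewrite /swing; lra.
pose e := dist_set u K / (swing + 1); have e0 : 0 < e by rewrite divr_gt0// addr_gt0.
near=> r => om omN; have r1 : 1 <= r%:R :> R by rewrite ler1n; near: r; exact: nbhs_infty_gt.
have [b0 reb _] : [/\ 0 < burst_size g r, r%:R <= e * burst_size g r &
    burst_size g r <= e * g r] by near: r; exact: burst_size_near.
have [g0 periodE _] : [/\ 0 < g r, (last_phase g Tend r).+1 = horizon g Tend r &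
    g r * Tend / 2 <= (last_phase g Tend r).+1%:R] by near: r; exact: period_near.
have [Q0E path] := (queues r).2 om.
have start : K (Q r 0%N om) by rewrite Q0E; apply: inv_coneZ => //; rewrite -IE.
have [k kN [dev dev_sqr jump]] := burst_jump net w_gt0 sus lam0 u0 b0 omN path start.
have dev_le : dev <= (drift_gain + 1) * (e * burst_size g r).
  by move: dev dev_sqr {jump}; near: r; exact: drift_before_burst.
have coneK a x : 0 < a -> K x -> K (a *: x) by move=> a0; exact/inv_coneZ/ltW.
rewrite IE; apply/(far_eventP _ g0 (ltW T0) _ (inv_cone_neq0 Rm S w lam) coneK).
  by rewrite -(ltr_nat R); lra.
exists k; first by rewrite -periodE.
move: jump; rewrite /= Q0E norm2Z ger0_norm// -/V => jump.
have jumpE : burst_size g r * dist_set u K = e * burst_size g r * (swing + 1).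
  by rewrite /e; field; rewrite gt_eqF// addr_gt0.
move: (e * _) reb dev_le jumpE => scale reb dev_le jumpE.
have : r%:R * norm2 q0 <= scale * norm2 q0 by rewrite ler_wpM2r.
have : delta * r%:R <= delta * scale by rewrite ler_pM2l.
have : V <= scale * V by rewrite ler_peMl// (le_trans r1).
rewrite /swing in jumpE; lra.
Unshelve. all: end_near. Qed.

End Bursts.

Theorem theorem3 (R : realType) :
  (* parts (a) and (b) *)
  (forall (n : nat) (Rm : 'M[R]_n) (S : seq 'cV[R]_n) (w : 'cV[R]_n)
          (lam : 'cV[R]_n) (Tend : R) (lamr : nat -> 'cV[R]_n)
          (f : nat -> R -> R) (g : nat -> R)
          (d : nat -> measure_display) (Om : forall r, measurableType (d r))
          (P : forall r, probability (Om r) R)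
          (A : forall r, nat -> Om r -> 'cV[R]_n)
          (Q : forall r, nat -> Om r -> 'cV[R]_n) (Q0 : nat -> 'cV[R]_n),
     network_ok Rm S -> pos_weights w ->
     capacity_region Rm S lam ->
     0 <= Tend ->
     (forall r e, 0 <= e -> 0 <= f r e) -> (forall r, 0 <= g r) ->
     (0 < limn_einf (fun r => (g r / r%:R)%:E))%E ->
     f_tailed f P A lamr lam ->
     (forall r, nonneg (Q0 r)) ->
     queue_processes Rm S w A Q Q0 ->
     (dist_set ((r%:R)^-1 *: Q0 r) (invariant_states Rm S w lam)) @[r --> \oo] --> 0 ->
     (forall e, 0 < e -> (0 < limn_einf (fun r => (r%:R * f r e / g r)%:E))%E) ->
     (* (a) *)
     (forall delta, 0 < delta ->
        fine (P r (far_event g r (Q r) (invariant_states Rm S w lam) Tend delta))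
          @[r --> \oo] --> 0)
     /\
     (* (b) *)
     (forall delta, 0 < delta -> exists2 e, 0 < e &
        (r%:R * f r e / g r *
           fine (P r (far_event g r (Q r) (invariant_states Rm S w lam) Tend delta)))
          @[r --> \oo] --> 0)
     /\
     (* (b), MW case *)
     (w = @ones R n -> forall C alpha, sensitivity_const Rm S C ->
        attraction_const Rm S lam alpha ->
        forall delta, 0 < delta -> forall e, 0 < e -> e <= Num.min delta alpha / (2 * C) ->
        (r%:R * f r e / g r *
           fine (P r (far_event g r (Q r) (invariant_states Rm S w lam) Tend delta)))
          @[r --> \oo] --> 0))
  /\
  (* part (c) *)
  (forall (f : nat -> R -> R) (g : nat -> R) (Tend : R),
     (forall r e, 0 <= e -> 0 <= f r e) -> (forall r, 0 <= g r) ->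
     (forall e, 0 < e -> (r%:R * f r e / g r) @[r --> \oo] --> 0) ->
     (g r / r%:R) @[r --> \oo] --> +oo ->
     0 < Tend ->
     forall (n : nat) (Rm : 'M[R]_n) (S : seq 'cV[R]_n) (lam : 'cV[R]_n) (q0 : 'cV[R]_n),
       network_ok Rm S ->
       capacity_region Rm S lam -> ~ extreme_point (capacity_region Rm S) lam ->
       invariant_states Rm S (@ones R n) lam q0 ->
       exists (d : nat -> measure_display) (Om : forall r, measurableType (d r))
              (P : forall r, probability (Om r) R)
              (A : forall r, nat -> Om r -> 'cV[R]_n)
              (Q : forall r, nat -> Om r -> 'cV[R]_n) (lamr : nat -> 'cV[R]_n),
         f_tailed f P A lamr lam /\
         queue_processes Rm S (@ones R n) A Q (fun r => r%:R *: q0) /\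
         forall delta, 0 < delta ->
           fine (P r (far_event g r (Q r) (invariant_states Rm S (@ones R n) lam) Tend delta))
             @[r --> \oo] --> (1 : R)).
Proof.
split.
  move=> n Rm S w lam Tend lamr f g d Om P A Q Q0 net w_gt0 cap T0 f0 _ growth tailed Q00
    queues start rf_growth.
  split; [|split].
  - by move=> delta; exact: (far_prob_cvg0 net w_gt0 cap T0 f0 growth tailed Q00 queues start).
  - by move=> delta; exact: (far_rate_exists net w_gt0 cap T0 f0 growth tailed Q00 queues start).
  - move=> wE C alpha sens attr delta delta0 e e0 e_le.
    exact: (far_rate_mw net w_gt0 cap T0 f0 growth tailed Q00 queues start wE sens attr).
move=> f g Tend f0 _ rf_small superlinear T0 n Rm S lam q0 net cap not_extreme Iq0.
have w_gt0 := @ones_gt0 R n.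
have [u u0 u_far] := noninvariant_exists net w_gt0 cap not_extreme.
have [Q queues] := bursts_queues (ones R n) q0 u g Tend cap.
exists (fun=> _), (fun=> nat), (fun r => unif_prob R (last_phase g Tend r)).
exists (bursts lam u g Tend), Q, (bursts_mean lam u g Tend).
split; first exact: (bursts_f_tailed cap f0 rf_small superlinear T0 u0).
split=> // delta delta0; apply: cvg_near_cst.
have := bursts_far net w_gt0 cap superlinear T0 Iq0 u0 u_far queues delta0.
apply: filterS => r far.
rewrite (_ : unif_prob _ _ _ = 1%E)//; exact: unif_full.
Qed.
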